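(* Let $n=2k+1$ with $k\ge2$. In the random subgraph process on $K(n,k)$, with high probability (as $n\to\infty$) $\tau_{\mathrm{EKR}}=\tau_{\mathrm{near}}$.
   Context: For integers $k\ge 2$ and $n\ge 2k+1$, the Kneser graph $K(n,k)$ has vertex set $\binom{[n]}{k}$ (the $k$-subsets of $[n]=\{1,\dots,n\}$), two sets being adjacent exactly when they are disjoint. For $x\in[n]$, the star based at $x$ is $\mathcal K_x=\{S\in\binom{[n]}{k}:x\in S\}$. A near-star based at $x$ is a family of the form $\{A\}\cup(\mathcal K_x\setminus\{B\})$ with $A\in\binom{[n]}{k}$, $A\notin\mathcal K_x$ and $B\in\mathcal K_x$. A spanning subgraph of $K(n,k)$ is called EKR if every one of its maximum independent sets is a star. Random subgraph process: let $m=|E(K(n,k))|$ and choose a bijection $\pi:E(K(n,k))\to[m]$ uniformly at random; $K_i(n,k)$ is the spanning subgraph of $K(n,k)$ whose edges are the $e$ with $\pi(e)\le i$. Define the random variables $$\tau_{\mathrm{near}}=\min\{i: K_i(n,k)\text{ has no independent near-stars}\},\qquad \tau_{\mathrm{EKR}}=\min\{i:K_i(n,k)\text{ is EKR}\},$$ where a near-star is independent in $K_i(n,k)$ if it spans no edge of $K_i(n,k)$. ''With high probability'' means with probability (over $\pi$) tending to $1$ as $n\to\infty$. *)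

(* Defs.v *)
From mathcomp Require Import all_boot all_order all_algebra.
Set Implicit Arguments.
Unset Strict Implicit.
Unset Printing Implicit Defensive.
Import Order.TTheory GRing.Theory Num.Theory.
Local Open Scope ring_scope.

(* The ground set [n] is 'I_n. A graph on the k-subsets of 'I_n is given by
   its set of edges, an edge being an unordered pair {A, B}. *)

Definition ksets (n k : nat) : {set {set 'I_n}} := [set S : {set 'I_n} | #|S| == k].

Definition kneser_edges (n k : nat) : {set {set {set 'I_n}}} :=
  [set e | [exists A in ksets n k, exists B in ksets n k,
              [disjoint A & B] && (e == [set A; B])]].

Definition star (n k : nat) (x : 'I_n) : {set {set 'I_n}} :=
  [set S in ksets n k | x \in S].

Definition is_star (n k : nat) (F : {set {set 'I_n}}) : bool :=
  [exists x : 'I_n, F == star k x].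

Definition is_near_star (n k : nat) (F : {set {set 'I_n}}) : bool :=
  [exists x : 'I_n,
     exists A in ksets n k :\: star k x, exists B in star k x,
       F == A |: (star k x :\ B)].

(* In what follows G is the edge set of a spanning subgraph of K(n,k). *)

Definition independent (n k : nat) (G : {set {set {set 'I_n}}})
    (F : {set {set 'I_n}}) : bool :=
  (F \subset ksets n k) && [forall e in G, ~~ (e \subset F)].

Definition maximum_independent (n k : nat) (G : {set {set {set 'I_n}}})
    (F : {set {set 'I_n}}) : bool :=
  independent k G F &&
  [forall F' : {set {set 'I_n}}, independent k G F' ==> (#|F'| <= #|F|)%N].

Definition EKR (n k : nat) (G : {set {set {set 'I_n}}}) : bool :=
  [forall F : {set {set 'I_n}}, maximum_independent k G F ==> is_star k F].

Definition no_independent_near_star (n k : nat)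
    (G : {set {set {set 'I_n}}}) : bool :=
  [forall F : {set {set 'I_n}}, is_near_star k F ==> ~~ independent k G F].

Notation edge n k := {e : {set {set 'I_n}} | e \in kneser_edges n k}.

Notation labelling n k := {ffun edge n k -> 'I_#|kneser_edges n k|}.

(* Domain and codomain have the same cardinality, so the injective labellings
   are the bijections. *)
Definition bijections (n k : nat) : {set labelling n k} :=
  [set pi : labelling n k | injectiveb pi].

(* Labels run over 0, ..., m-1 instead of 1, ..., m, so the condition
   "label at most i" becomes a strict inequality. *)
Definition process (n k : nat) (pi : labelling n k) (i : nat) :
    {set {set {set 'I_n}}} :=
  [set val e | e : edge n k & (pi e < i)%N].

(* The least i in {0, ..., m} satisfying P, and m+1 if there is none. For
   k >= 2 and n >= 2k+1, both properties below hold at i = m (for EKR this is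
   the Erdos-Ko-Rado theorem), so the second case does not arise for them. *)
Definition hitting_time (m : nat) (P : pred nat) : nat := find P (iota 0 m.+1).

Definition tau_near (n k : nat) (pi : labelling n k) : nat :=
  hitting_time #|kneser_edges n k|
    (fun i => no_independent_near_star k (process pi i)).

Definition tau_EKR (n k : nat) (pi : labelling n k) : nat :=
  hitting_time #|kneser_edges n k| (fun i => EKR k (process pi i)).

Definition Pr_bij (R : realFieldType) (n k : nat) (ev : pred (labelling n k)) : R :=
  #|[set pi in bijections n k | ev pi]|%:R / #|bijections n k|%:R.

(* Main.v *)
(* Fix a constant time i0 (about 2m/3) of the process. With high probability
   some vertex of a star is still isolated at time i0, by a second moment
   computation, so that tau_near > i0. Conversely, at any later time without
   independent near-stars the graph is EKR unless one of two kinds of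
   obstruction is present at time i0; both are excluded by union bounds in which
   a structure that misses e edges of the Kneser graph has probability at most
   3^-e.

   - A family F of star size that spans e(F) > (star size)/32 Kneser edges but is
     independent in the random graph. A sparse subset T of F, chosen greedily,
     has a Kneser neighbourhood that agrees with the complement of F up to
     O((N + e(F)) / sqrt k) vertices, so that there are only exp(o(e(F))) such
     families.
   - A non-star F that spans few Kneser edges. Comparing F with its projection on
     linear functions (this uses the eigenvalues of the Johnson scheme only up to
     the second layer) shows that F contains at least 5/8 of some star K_x. Let
     A = F \ K_x. The set of random-graph neighbours of A in K_x is no larger
     than A; a minimal nonempty subset of A with this property either is a single
     vertex, which gives an independent near-star, or is connected through common
     Kneser neighbours. In the second case the isoperimetry of two adjacent layers
     of the cube produces E >= |A|/8 missing edges, and the sparse-cover encoding,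
     now carried by a walk because of the connectivity, leaves only
     4^k exp(o(E)) pairs. *)
Require Import Defs.
From mathcomp Require Import all_boot all_order all_algebra all_fingroup.
From mathcomp Require Import zify ring lra.
Set Implicit Arguments.
Unset Strict Implicit.
Unset Printing Implicit Defensive.
Import Order.TTheory GRing.Theory Num.Theory.
Local Open Scope ring_scope.

(** * Up and down operators on layers of the cube *)

(** Entropy competes with missing edges. An isolated vertex is [k + 1] absent edges and there are
    about [4^k] vertices, so at absence probability [c] isolated vertices exist when [4 * c > 1]. An
    obstruction with two or more vertices off the star forces at least [3k/2] absent edges, and
    excluding all of them needs [4 * c^(3/2) < 1]. The value [c = 1/3] satisfies both, which fixes
    the time; a single vertex off the star forces only about [k] absent edges, which is why
    near-stars stand apart from all other local obstructions.

    One time is enough: an edge present then stays present, so no union bound over times is made.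

    The obstacle is the entropy of larger structures. With [E] absent edges, only a small
    exponential factor in [E] can be afforded, while naming a vertex costs about [log k], even along
    a walk. With [r] the integer square root of [k], each structure is described by [O(E / r)]
    vertices, and [k^(O(1 / r))] tends to 1. The large constants only make this comparison
    explicit. *)

Section UpDown.
Variables (R : realFieldType) (T : finType) (G : {set T}).
Implicit Types (f g : {set T} -> R) (S : {set T}).

Definition ip f g : R := \sum_S f S * g S.
Definition down f S : R := \sum_(y in G :\: S) f (y |: S).
Definition up f S : R := \sum_(z in G :&: S) f (S :\ z).
(** Functions live on all subsets of [T], and the support is confined to one layer of the cube over
    [G]. The ground set is a parameter because the operators are used over all of [[n]] and over
    [[n]] without the base point of a star. *)
Definition layered t f := forall S, f S != 0 -> (S \subset G) && (#|S| == t).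

Lemma ipC f g : ip f g = ip g f.
Proof. by apply: eq_bigr => S _; rewrite mulrC. Qed.

Lemma ip_ge0 f : 0 <= ip f f.
Proof. by apply: sumr_ge0 => S _; rewrite -expr2 sqr_ge0. Qed.

Lemma ip_lin_sqr (a b : R) f g :
  ip (fun S => a * f S + b * g S) (fun S => a * f S + b * g S) =
  a ^+ 2 * ip f f + 2 * a * b * ip f g + b ^+ 2 * ip g g.
Proof.
rewrite /ip !mulr_sumr -!big_split /=; apply: eq_bigr => S _; ring.
Qed.

Lemma down_adj f g : ip (down f) g = ip f (up g).
Proof.
rewrite /ip /down /up.
under eq_bigr do rewrite mulr_suml.
under [RHS]eq_bigr do rewrite mulr_sumr.
rewrite (exchange_big_dep (fun y => y \in G)) /=; last by move=> S y _; rewrite inE => /andP[].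
rewrite [RHS](exchange_big_dep (fun y => y \in G)) /=; last by move=> S y _; rewrite inE => /andP[].
apply: eq_bigr => y yG.
rewrite [LHS](reindex_onto (fun S => S :\ y) (fun S => y |: S)) /=; last first.
  by move=> S; rewrite !inE => /andP[ynS _]; rewrite setU1K.
apply: eq_big => S.
  rewrite !inE yG eqxx /= .
  case: (boolP (y \in S)) => yS; first by rewrite setD1K ?eqxx.
  by apply/negbTE/eqP => /setP/(_ y); rewrite !inE eqxx (negbTE yS).
by rewrite !inE eqxx yG /= => /eqP ->.
Qed.

(** The [sl2] commutation relation of the cube: adding [y] commutes with removing [z] when [y != z],
    and the terms with [y = z] count the points outside and inside [S]. *)
Lemma down_up f S :
  down (up f) S = up (down f) S + (#|G :\: S|%:R - #|G :&: S|%:R) * f S.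
Proof.
rewrite /down /up mulrBl addrCA; apply/eqP; rewrite -subr_eq0; apply/eqP.
pose Z := \sum_(y in G :\: S) \sum_(z in G :&: S) f (y |: (S :\ z)).
have -> : \sum_(y in G :\: S) \sum_(z in G :&: (y |: S)) f ((y |: S) :\ z) =
          #|G :\: S|%:R * f S + Z.
  rewrite mulr_natl -sumr_const -big_split /=; apply: eq_bigr => y.
  rewrite !inE => /andP[ynS yG].
  rewrite (bigD1 y) /=; last by rewrite !inE eqxx yG.
  congr (_ + _); first by rewrite setU1K.
  apply: eq_big => [z|z]; rewrite !inE.
    by case: eqVneq => [->|] /=; rewrite ?andbT ?andbF // (negbTE ynS) andbF.
  case/andP=> /andP[zG _] zy; congr f; apply/setP=> w; rewrite !inE.
  by case: (eqVneq w y) => [->|]; rewrite ?andbT //= eq_sym zy.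
have -> : \sum_(z in G :&: S) \sum_(y in G :\: (S :\ z)) f (y |: S :\ z) =
          #|G :&: S|%:R * f S + Z.
  rewrite /Z exchange_big mulr_natl -sumr_const -big_split /=.
  apply: eq_bigr => z; rewrite !inE => /andP[zG zS].
  rewrite (bigD1 z) /=; last by rewrite !inE eqxx zG.
  rewrite setD1K //; congr (_ + _).
  apply: eq_bigl => y; rewrite !inE.
  by case: eqVneq => [->|] /=; rewrite ?zS ?andbF ?andbT.
by ring.
Qed.

Lemma layered_down t f : layered t.+1 f -> layered t (down f).
Proof.
move=> lf S nz; rewrite /down in nz.
have [y yGS fy] : exists2 y, y \in G :\: S & f (y |: S) != 0.
  apply/exists_inP; apply: contraNT nz; rewrite negb_exists_in => /forall_inP h.
  by rewrite big1 // => y /h; rewrite negbK => /eqP.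
move: yGS; rewrite inE => /andP[ynS yG].
have /andP[sG] := lf _ fy; rewrite cardsU1 ynS add1n eqSS => ->.
by rewrite (subset_trans _ sG) // subsetUr.
Qed.

Lemma norm_up t f : layered t f ->
  ip (up f) (up f) = ip (down f) (down f) + (#|G|%:R - 2 * t%:R) * ip f f.
Proof.
move=> lf; rewrite -down_adj ipC [in RHS]down_adj /ip mulr_sumr -big_split.
apply: eq_bigr => S _ /=; rewrite down_up mulrDr; congr (_ + _).
have [->|/lf /andP[sG /eqP cS]] := eqVneq (f S) 0; first by rewrite !(mulr0, mul0r).
rewrite cardsD (setIidPr sG) cS natrB; last by rewrite -cS subset_leq_card.
ring.
Qed.

(** Orthogonality to the monomials of degree [j] in the membership indicators; on a layer [t >= j]
    these span all polynomials of degree at most [j]. *)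
Definition balanced j f :=
  forall Q : {set T}, Q \subset G -> #|Q| = j -> \sum_(S : {set T} | Q \subset S) f S = 0.

(** A superset of [Q] in layer [t + 1] loses a point outside [Q] in [t + 1 - j] ways, so the sum
    over supersets of [Q] is only rescaled. *)
Lemma balanced_down j t f : layered t.+1 f -> balanced j f -> balanced j (down f).
Proof.
move=> lf bf Q sQ cQ; rewrite /down.
rewrite (exchange_big_dep (fun y => y \in G)) /=; last by move=> S y _; rewrite inE => /andP[].
transitivity (\sum_(y in G) \sum_(S : {set T} | (Q \subset S :\ y) && (y \in S)) f S).
  apply: eq_bigr => y yG.
  rewrite [RHS](reindex_onto (fun S => y |: S) (fun S => S :\ y)) /=; last first.
    by move=> S /andP[_ yS]; rewrite setD1K.
  apply: eq_bigl => S; rewrite !inE eqxx yG !andbT /=.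
  case: (boolP (y \in S)) => yS; last by rewrite setU1K // eqxx andbT.
  rewrite andbF; apply/esym/negbTE; rewrite negb_and orbC.
  by apply/orP; left; apply/eqP => /setP/(_ y); rewrite !inE eqxx yS.
rewrite (exchange_big_dep (fun S : {set T} => Q \subset S)) /=; last first.
  by move=> y S _ /andP[/subset_trans-> //]; apply: subsetDl.
transitivity (\sum_(S : {set T} | Q \subset S) (t.+1 - j)%:R * f S).
  apply: eq_bigr => S sQS; rewrite sumr_const.
  have [->|/lf /andP[sG /eqP cS]] := eqVneq (f S) 0; first by rewrite mul0rn mulr0.
  rewrite -[LHS]mulr_natl; congr (_%:R * _).
  rewrite -cS -cQ -{2}(setIidPr sQS) -cardsD; apply: eq_card => y.
  rewrite !inE unfold_in /= subsetD1 sQS /=.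
  by case: (boolP (y \in S)) => yS; rewrite ?andbF ?andbT // (subsetP sG) // andbT.
by rewrite -mulr_sumr bf ?mulr0.
Qed.

(* The bound is the i-th eigenvalue of [up \o down] on the t-th layer. *)
Lemma down_norm_le i t f : (0 < i)%N -> (i <= t.+1)%N -> (t + i <= #|G|.+1)%N ->
  layered t f -> balanced i.-1 f ->
  ip (down f) (down f) <= (t%:R - i%:R) * (#|G|%:R - t%:R - i%:R + 1) * ip f f.
Proof.
move=> i0 it; have [j ej] : exists j, t = (i.-1 + j)%N.
  by exists (t - i.-1)%N; lia.
move: it; rewrite {t}ej; elim: j f => [|j IH] f; rewrite ?addn0 ?addnS => it tG lf bf.
  have f0 S : f S = 0.
    apply/eqP/negPn/negP => nz; have /andP[sG /eqP cS] := lf _ nz.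
    have := bf S sG cS; rewrite (bigD1 S) //= big1 ?addr0 => [e|S' /andP[sS' neq]].
      by rewrite e eqxx in nz.
    apply/eqP/negPn/negP => nz'; have /andP[_ /eqP cS'] := lf _ nz'; case/negP: neq.
    by rewrite eq_sym eqEcard sS' cS cS' leqnn.
  rewrite /ip !big1 ?mulr0 // => S _; rewrite ?f0 ?mulr0 //.
  by rewrite /down big1 ?mulr0.
set t := (i.-1 + j)%N in IH it tG lf *.
have lr := layered_down lf; have br := balanced_down lf bf.
have {}IH := IH (down f) ltac:(lia) ltac:(lia) lr br.
have e1 := norm_up lr.
have e2 : ip (down f) (down f) = ip f (up (down f)) by rewrite down_adj.
set c := (X in _ <= X * _).
have c0 : 0 <= c.
  have h1 : i%:R <= t.+1%:R :> R by rewrite ler_nat; lia.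
  have h2 : t.+1%:R + i%:R <= #|G|%:R + 1 :> R by rewrite -!natrD natr1 ler_nat; lia.
  by rewrite /c; apply: mulr_ge0; lra.
have hu : ip (up (down f)) (up (down f)) <= c * ip (down f) (down f).
  rewrite e1; apply: le_trans (lerD IH (lexx _)) _.
  rewrite -mulrDl ler_wpM2r ?ip_ge0 // /c -natr1.
  by rewrite le_eqVlt; apply/orP; left; apply/eqP; ring.
(* Expanding the square and using [hu] gives [c * |down f|^2 <= c^2 * |f|^2]. Then [c] is cancelled;
   if [c = 0], [hu] makes [up (down f)] vanish instead. *)
have := ip_ge0 (fun S => c * f S + -1 * up (down f) S).
rewrite ip_lin_sqr -e2.
set nr := ip (down f) (down f) in hu *; set nf := ip f f => pos.
have nu0 := ip_ge0 (up (down f)).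
move: c0; rewrite le_eqVlt => /orP[/eqP c0|c0]; last by rewrite -subr_ge0 -(pmulr_rge0 _ c0); nra.
rewrite -c0 mul0r in hu *.
have u0 S : up (down f) S = 0.
  have /eqP : ip (up (down f)) (up (down f)) = 0 by apply/eqP; rewrite eq_le hu nu0.
  rewrite psumr_eq0; last by move=> S' _; rewrite -expr2 sqr_ge0.
  by move/allP/(_ S (mem_index_enum _)); rewrite /= mulf_eq0 orbb => /eqP.
by rewrite mul0r /nr e2 /ip big1 // => S _; rewrite u0 mulr0.
Qed.
End UpDown.

(** * The odd Kneser graph *)

Lemma card_supersets (T : finType) (Q : {set T}) t : (#|Q| <= t)%N ->
  #|[set S : {set T} | (Q \subset S) && (#|S| == t)]| = 'C(#|T| - #|Q|, t - #|Q|).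
Proof.
move=> Qt; have -> : (#|T| - #|Q|)%N = #|~: Q| by have := cardsC Q; lia.
rewrite -cards_draws.
rewrite -[RHS](card_in_imset (f := fun B => Q :|: B)) => [|B B' /[!inE] /andP[sB _] /andP[sB' _] e].
  apply: eq_card => S; rewrite [LHS]inE; apply/idP/imsetP => [/andP[sQ /eqP cS]|[B /[!inE] /andP[sB /eqP cB] ->]].
    exists (S :\: Q); last by rewrite -{1}(setID S Q) (setIidPr sQ).
    by rewrite !inE subsetDr cardsD (setIidPr sQ) cS eqxx.
  rewrite subsetUl cardsU cB (_ : Q :&: B = set0) ?cards0.
    by rewrite /= ; apply/eqP; lia.
  apply/setP=> z; rewrite !inE; case: (boolP (z \in B)) => zB; rewrite ?andbF // andbT.
  by have := subsetP sB z zB; rewrite inE => /negbTE.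
have h (X : {set T}) : X \subset ~: Q -> (Q :|: X) :\: Q = X.
  by move=> sX; rewrite setDUl setDv set0U; apply/setDidPl; rewrite disjoints_subset.
by rewrite -(h B) // e h.
Qed.

Section Kneser.
Variable k : nat.
Notation n := (2 * k + 1)%N.
Implicit Types (u v S Z : {set 'I_n}) (F A B C : {set {set 'I_n}}).

Definition nbr u : {set {set 'I_n}} := [set S in ksets n k | [disjoint u & S]].
Definition deg F u := #|nbr u :&: F|.
Definition star_size := 'C(2 * k, k.-1).

Lemma nbr_sym u v : u \in ksets n k -> v \in ksets n k -> (u \in nbr v) = (v \in nbr u).
Proof. by rewrite !inE => -> ->; rewrite disjoint_sym. Qed.

Lemma card_ksets : #|ksets n k| = 'C(n, k).
Proof. by rewrite card_draws card_ord. Qed.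

Lemma card_star (x : 'I_n) : (0 < k)%N -> #|star k x| = star_size.
Proof.
move=> k0; rewrite /star_size.
have -> : star k x = [set S : {set 'I_n} | ([set x] \subset S) && (#|S| == k)].
  by apply/setP=> S; rewrite !inE sub1set andbC.
by rewrite card_supersets cards1 // card_ord addnK subn1.
Qed.

Lemma card_nbr_compl u : u \in ksets n k -> #|~: u| = k.+1.
Proof. by rewrite inE => /eqP cu; have := cardsC u; rewrite card_ord; lia. Qed.

Lemma nbr_imset u : u \in ksets n k -> nbr u = [set ~: u :\ z | z in ~: u].
Proof.
move=> uV; have cu := card_nbr_compl uV; apply/setP=> S.
apply/idP/imsetP => [|[z zu ->]].
  rewrite !inE disjoint_sym disjoints_subset => /andP[/eqP cS sS].
  have /eqP/cards1P[z ez] : #|~: u :\: S| = 1%N by rewrite cardsD (setIidPr sS) cS cu; lia.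
  have zz : z \in ~: u :\: S by rewrite ez set11.
  exists z; first by move: zz; rewrite inE => /andP[].
  by rewrite -ez setDDr setDv set0U; apply/esym/setIidPr.
rewrite !inE disjoint_sym disjoints_subset subsetDl andbT.
by apply/eqP; have := cardsD1 z (~: u); rewrite zu cu; lia.
Qed.

Lemma nbr_inj u : {in ~: u &, injective (fun z => ~: u :\ z)}.
Proof.
move=> z z' zu _ e; apply/eqP; apply: contraT => ne.
by move/setP/(_ z): e; rewrite !inE eqxx ne /= -in_setC zu.
Qed.

(** The neighbours of [u] are its complement with one point deleted. Read through complementation,
    the adjacency operator is therefore [up] from layer [k] to layer [k + 1]. *)
Lemma up_compl (R : realFieldType) (f : {set 'I_n} -> R) u : u \in ksets n k ->
  up setT f (~: u) = \sum_(S in nbr u) f S.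
Proof.
move=> uV; rewrite (nbr_imset uV) big_imset /=; last exact: nbr_inj.
by rewrite /up; apply: eq_bigl => z; rewrite inE in_setT.
Qed.

Lemma card_nbr u : u \in ksets n k -> #|nbr u| = k.+1.
Proof.
by move=> uV; rewrite (nbr_imset uV) (card_in_imset (@nbr_inj u)) (card_nbr_compl uV).
Qed.

Lemma deg_star x v : v \in ksets n k -> x \notin v -> deg (star k x) v = k.
Proof.
move=> vV xv; rewrite /deg (nbr_imset vV).
have -> : [set ~: v :\ z | z in ~: v] :&: star k x = [set ~: v :\ z | z in ~: v :\ x].
  apply/setP=> S; apply/setIP/imsetP => [[/imsetP[z zv ->]]|[z]].
    rewrite inE => /andP[_ xz]; exists z => //; move: xz; rewrite !inE => /andP[xz _].
    by rewrite eq_sym xz -in_setC zv.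
  rewrite in_setD1 => /andP[zx zv] ->; split; first by apply/imsetP; exists z.
  have : ~: v :\ z \in nbr v by rewrite (nbr_imset vV); apply/imsetP; exists z.
  by rewrite !inE => /andP[-> _]; rewrite eq_sym zx xv.
rewrite card_in_imset; last first.
  by move=> z z' /setD1P[_ zv] /setD1P[_ zv']; apply: nbr_inj.
by have := cardsD1 x (~: v); rewrite (card_nbr_compl vV) inE xv; lia.
Qed.

(** Common neighbours lie in the complement of [v :|: v'], which has at most [k] elements and so
    contains at most one [k]-set. *)
Lemma codeg_le1 v v' : v \in ksets n k -> v' \in ksets n k -> v != v' ->
  (#|nbr v :&: nbr v'| <= 1)%N.
Proof.
move=> vV v'V ne; rewrite leqNgt; apply/negP => /card_gt1P[S [S' [hS hS' neq]]].
case/negP: neq.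
have cU : (#|~: (v :|: v')| <= k)%N.
  move: vV v'V; rewrite !inE => /eqP cv /eqP cv'; have := cardsC (v :|: v'); rewrite card_ord.
  suff : (k < #|v :|: v'|)%N by lia.
  rewrite -[X in (X < _)%N]cv ltn_neqAle subset_leq_card ?subsetUl // andbT; apply/negP => /eqP e.
  have /eqP e1 : v == v :|: v' by rewrite eqEcard subsetUl /= -e leqnn.
  by case/negP: ne; rewrite eq_sym eqEcard cv cv' leqnn andbT e1 subsetUr.
have h X : X \in nbr v :&: nbr v' -> X = ~: (v :|: v').
  rewrite !inE => /andP[/andP[/eqP cX d1] /andP[_ d2]].
  by apply/eqP; rewrite eqEcard cX cU andbT setCU subsetI -!disjoints_subset !(disjoint_sym X) d1 d2.
by rewrite (h _ hS) (h _ hS').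
Qed.

Lemma sum_deg_sym (R : realFieldType) (a b : {set 'I_n} -> R) :
  \sum_(u in ksets n k) a u * (\sum_(S in nbr u) b S) =
  \sum_(u in ksets n k) b u * (\sum_(S in nbr u) a S).
Proof.
under eq_bigr do rewrite mulr_sumr.
under [RHS]eq_bigr do rewrite mulr_sumr.
rewrite (exchange_big_dep (mem (ksets n k))) /=; last by move=> u S _; rewrite inE => /andP[].
apply: eq_bigr => S SV; apply: eq_big => [u|u _]; last by rewrite mulrC.
by case: (boolP (u \in ksets n k)) => uV /=;
  [rewrite nbr_sym|rewrite [RHS]inE (negbTE uV)].
Qed.

Lemma deg_sum C v : deg C v = (\sum_(u in C) (u \in nbr v))%N.
Proof.
rewrite /deg -sum1_card [RHS]big_mkcond [LHS]big_mkcond; apply: eq_bigr => u _.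
by rewrite inE andbC; case: (u \in C); case: (u \in nbr v).
Qed.

Lemma sum_deg_swap A B : A \subset ksets n k -> B \subset ksets n k ->
  (\sum_(v in A) deg B v = \sum_(u in B) deg A u)%N.
Proof.
move=> AV BV; under eq_bigr do rewrite deg_sum; rewrite exchange_big /=.
apply: eq_bigr => u uB; rewrite deg_sum; apply: eq_bigr => v vA.
by rewrite (nbr_sym (subsetP BV u uB) (subsetP AV v vA)).
Qed.

Lemma bin_star : (0 < k)%N -> (k.+1 * star_size = 2 * k * 'C((2 * k).-1, k.-1))%N.
Proof.
rewrite /star_size; case: k => [|j] //= _.
by rewrite mul_bin_down; congr (_ * _)%N; lia.
Qed.

Lemma bin_star2 : (1 < k)%N -> ('C((2 * k).-1, k.-1) + 'C((2 * k).-1, k.-2) = star_size)%N.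
Proof. by rewrite /star_size; case: k => [|[|j]] //= _; rewrite -binS; congr 'C(_, _); lia. Qed.

Lemma bin_ksets : (0 < k)%N -> (k * #|ksets n k| = n * star_size)%N.
Proof.
rewrite card_ksets /star_size addn1; case: k => [|j] // _.
by rewrite -mul_bin_diag.
Qed.

Lemma star_size_gt0 : (0 < k)%N -> (0 < star_size)%N.
Proof. by move=> k0; rewrite bin_gt0; lia. Qed.

Lemma card_star2 (x y : 'I_n) : (1 < k)%N -> x != y ->
  #|[set S in ksets n k | (x \in S) && (y \in S)]| = 'C((2 * k).-1, k.-2).
Proof.
move=> k1 xy; have c2 : #|[set x; y]| = 2%N by rewrite cards2 xy.
have -> : [set S in ksets n k | (x \in S) && (y \in S)] =
          [set S : {set 'I_n} | ([set x; y] \subset S) && (#|S| == k)].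
  by apply/setP=> S; rewrite !inE subUset !sub1set andbC.
by rewrite card_supersets c2 // card_ord; congr 'C(_, _); lia.
Qed.
End Kneser.

(** * Stability *)

Section Stability.
Variables (R : realFieldType) (k : nat) (F : {set {set 'I_(2 * k + 1)}}).
Notation n := (2 * k + 1)%N.
Notation V := (ksets n k).
Hypotheses (k1 : (1 < k)%N) (FV : F \subset V) (cF : #|F| = star_size k).
Let K : R := k%:R.
Let M : R := (star_size k)%:R.
Let C : R := 'C((2 * k).-1, k.-1)%:R.
Let C2 : R := 'C((2 * k).-1, k.-2)%:R.
Let f (S : {set 'I_n}) : R := (S \in F)%:R.
Let d (x : 'I_n) : R := \sum_(S in star k x) f S.
(** These weights make [q] the orthogonal projection of [f] onto the functions linear in membership:
    a star has [C + C2] members and two stars share [C2], so [q] gets the same star sums [d] as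
    [f]. *)
Let c x := (d x - C2) / C.
Let q (S : {set 'I_n}) : R := if S \in V then \sum_(x in S) c x else 0.
Let h S := f S - q S.
Let w : R := \sum_(u in V) f u * up setT f (~: u).
Let H : R := ip h h.

Let KK : K > 1. Proof. by rewrite /K ltr1n. Qed.
Let MC : (K + 1) * M = 2 * K * C.
Proof. by rewrite /K /M /C -!natrM natr1 -natrM bin_star // (ltnW k1). Qed.
Let CC2 : C + C2 = M.
Proof. by rewrite /C /C2 /M -natrD bin_star2. Qed.
Let C0 : C > 0.
Proof. by rewrite /C ltr0n bin_gt0; lia. Qed.
Let NM : K * #|V|%:R = (2 * K + 1) * M.
Proof. by rewrite /K /M -natrM bin_ksets ?(ltnW k1) // natrM natrD natrM. Qed.
Let fV S : f S != 0 -> S \in V.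
Proof. by rewrite /f; case: (boolP (S \in F)) => [/(subsetP FV)//|_]; rewrite eqxx. Qed.
Let hV S : h S != 0 -> S \in V.
Proof.
rewrite /h; case: (boolP (S \in V)) => // SV; apply: contraNT => _.
have /eqP -> : f S == 0 by apply: contraNT SV; apply: fV.
by rewrite /q (negbTE SV) subr0.
Qed.
Let sumV (g : {set 'I_n} -> R) : (forall S, g S != 0 -> S \in V) -> \sum_S g S = \sum_(S in V) g S.
Proof.
move=> gV; rewrite [RHS]big_mkcond; apply: eq_bigr => S _.
by case: ifPn => // SV; apply/eqP; apply: contraNT SV; apply: gV.
Qed.

Let sum_f : \sum_(S in V) f S = M.
Proof.
rewrite /M -cF -sumV // /f -natr_sum; congr _%:R.
by rewrite -sum1_card [RHS]big_mkcond; apply: eq_bigr => S _; case: (S \in F).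
Qed.

Let cardV (S : {set 'I_n}) : S \in V -> #|S| = k.
Proof. by rewrite inE => /eqP. Qed.

Let swap_incidence (g : {set 'I_n} -> R) (a : 'I_n -> R) :
  \sum_(S in V) g S * (\sum_(x in S) a x) = \sum_x a x * \sum_(S in star k x) g S.
Proof.
under eq_bigr do rewrite mulr_sumr.
rewrite (exchange_big_dep predT) //=; apply: eq_bigr => x _; rewrite mulr_sumr.
by apply: eq_big => [S|S _]; [rewrite !inE|rewrite mulrC].
Qed.

Let sum_d : \sum_x d x = K * M.
Proof.
transitivity (\sum_x 1 * \sum_(S in star k x) f S); first by apply: eq_bigr => x _; rewrite mul1r.
rewrite -swap_incidence -sum_f mulr_sumr; apply: eq_bigr => S SV.
by rewrite sumr_const cardV // mulrC.
Qed.

Let cardn : #|'I_n| = n. Proof. by rewrite card_ord. Qed.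

Let dE x : d x = C * c x + C2.
Proof. by rewrite /c mulrC divfK ?subrK // gt_eqF. Qed.

Let sum_c : \sum_x c x = 1.
Proof.
rewrite /c -mulr_suml big_split /= sum_d sumr_const cardn -mulr_natl natrD natrM.
rewrite -/K; apply: (mulIf (lt0r_neq0 C0)).
have e : C2 = M - C by rewrite -CC2; ring.
rewrite divfK ?gt_eqF // mul1r e. have := MC; lra.
Qed.

Let sum_q_star x : \sum_(S in star k x) q S = d x.
Proof.
transitivity (\sum_y c y * (if y == x then M else C2)).
  transitivity (\sum_(S in V) (x \in S)%:R * \sum_(y in S) c y).
    rewrite [RHS]big_mkcond [LHS]big_mkcond; apply: eq_bigr => S _; rewrite inE /q.
    by case: (S \in V) => //=; case: (x \in S); rewrite ?mul1r ?mul0r.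
  rewrite swap_incidence; apply: eq_bigr => y _; congr (_ * _).
  case: (eqVneq y x) => [->|yx].
    rewrite /M -(card_star x) ?(ltnW k1) // -sum1_card natr_sum.
    by apply: eq_bigr => S; rewrite inE => /andP[_ ->].
  rewrite /C2 -(card_star2 k1 yx) -sum1_card natr_sum [RHS]big_mkcond [LHS]big_mkcond.
  apply: eq_bigr => S _; rewrite !inE.
  by case: (#|S| == k) => //=; case: (y \in S); case: (x \in S).
rewrite (bigD1 x) //= eqxx dE.
under eq_bigr => y yx do rewrite (negbTE yx).
rewrite -mulr_suml; have := sum_c; rewrite (bigD1 x) //= => e.
have -> : \sum_(y | y != x) c y = 1 - c x by rewrite -e; ring.
by rewrite -CC2; ring.
Qed.

Let sum_h_star x : \sum_(S in star k x) h S = 0.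
Proof. by rewrite sumrB sum_q_star subrr. Qed.

Let layered_h : layered setT k h.
Proof. by move=> S /hV; rewrite inE subsetT. Qed.

Let balanced_h : balanced setT 1 h.
Proof.
move=> Q _ /eqP/cards1P[x ->].
transitivity (\sum_(S in star k x) h S); last exact: sum_h_star.
rewrite [LHS]big_mkcond [RHS]big_mkcond; apply: eq_bigr => S _.
rewrite sub1set inE; case: (x \in S); rewrite ?andbF // andbT.
by case: ifPn => // SV; apply/eqP; apply: contraNT SV; apply: hV.
Qed.

(** With [i = 2] the bound on [down] is [K * (K - 2)], and [norm_up] adds [n - 2 * k = 1], together
    [(K - 1) ^+ 2]. *)
Let up_h_norm : ip (up setT h) (up setT h) <= (K - 1) ^+ 2 * H.
Proof.
rewrite (norm_up layered_h).
have := @down_norm_le R _ setT 2 k h isT ltac:(lia) _ layered_h balanced_h.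
rewrite cardsT cardn => /(_ ltac:(lia)).
by rewrite natrD natrM -/K -/H; lra.
Qed.

Let sum_compl (g : {set 'I_n} -> R) :
  \sum_(u in V) g (~: u) = \sum_(Z : {set 'I_n} | #|Z| == k.+1) g Z.
Proof.
rewrite [RHS](reindex_inj (inv_inj (@setCK _))) /=; apply: eq_bigl => u; rewrite inE.
have := cardsC u; rewrite cardn => e; apply/eqP/eqP => e2; rewrite e2 in e; first by apply: (@addnI k); rewrite e; lia.
by apply: (@addIn k.+1); rewrite e; lia.
Qed.

Let up_q u : u \in V -> up setT q (~: u) = K * (1 - q u).
Proof.
move=> uV; rewrite /up setTI; pose s := \sum_(x in ~: u) c x.
transitivity (\sum_(z in ~: u) (s - c z)).
  apply: eq_bigr => z zu; rewrite /q.
  have -> : ~: u :\ z \in V.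
    by rewrite inE; have := cardsD1 z (~: u); rewrite zu card_nbr_compl // => e; apply/eqP; lia.
  by rewrite /s [in RHS](bigD1 z) //= [RHS]addrC addKr; apply: eq_bigl => y; rewrite !inE andbC.
rewrite big_split /= sumr_const card_nbr_compl // sumrN -/s.
have -> : s = 1 - q u.
  by rewrite /q uV -sum_c (bigID (mem u)) /= [RHS]addrC addKr; apply: eq_bigl => y; rewrite inE.
by rewrite -mulr_natl -natr1 -/K; ring.
Qed.

Let sum_h : \sum_(S in V) h S = 0.
Proof.
apply: (mulfI (_ : K != 0)); first by rewrite gt_eqF // (lt_trans ltr01 KK).
rewrite mulr0; transitivity (\sum_(S in V) h S * (\sum_(x in S) 1)).
  by rewrite mulr_sumr; apply: eq_bigr => S SV; rewrite sumr_const cardV // mulrC.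
by rewrite swap_incidence big1 // => x _; rewrite sum_h_star mulr0.
Qed.

Let sum_qh : \sum_(S in V) q S * h S = 0.
Proof.
transitivity (\sum_(S in V) h S * (\sum_(x in S) c x)).
  by apply: eq_bigr => S SV; rewrite mulrC /q SV.
by rewrite swap_incidence big1 // => x _; rewrite sum_h_star mulr0.
Qed.

Let ff S : f S * f S = f S.
Proof. by rewrite /f; case: (S \in F); rewrite ?mulr1 ?mulr0. Qed.
Let fqh S : f S = q S + h S. Proof. by rewrite /h addrCA subrr addr0. Qed.
Let HV : H = \sum_(S in V) h S * h S.
Proof. by apply: sumV => S; rewrite mulf_eq0 negb_or => /andP[_ /hV]. Qed.

Let sum_fq : \sum_(S in V) f S * q S = M - H.
Proof.
have e1 : \sum_(S in V) f S * q S = \sum_(S in V) q S * q S + \sum_(S in V) q S * h S.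
  by rewrite -big_split; apply: eq_bigr => S _ /=; rewrite fqh; ring.
have e2 : M = \sum_(S in V) f S * q S + (\sum_(S in V) q S * h S + \sum_(S in V) h S * h S).
  by rewrite -sum_f -!big_split; apply: eq_bigr => S _ /=; rewrite -[LHS]ff {2}(fqh S) (fqh S); ring.
by rewrite sum_qh add0r -HV in e2; rewrite [X in _ = X - _]e2 addrK.
Qed.

(** As the weights [c] sum to 1, the adjacency operator sends [q] to [K * (1 - q)]. Paired with [f]
    this gives [K * H], paired with [h] nothing, since [h] is orthogonal to [q] and to the
    constants. *)
Let wE : w = K * H + \sum_(u in V) h u * up setT h (~: u).
Proof.
have upD u : up setT f (~: u) = up setT q (~: u) + up setT h (~: u).
  by rewrite /up -big_split; apply: eq_bigr => z _; rewrite fqh.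
have e1 : w = K * (\sum_(u in V) f u - \sum_(u in V) f u * q u) + \sum_(u in V) f u * up setT h (~: u).
  rewrite -sumrB mulr_sumr -big_split; apply: eq_bigr => u uV /=.
  by rewrite upD up_q //; ring.
have e2 : \sum_(u in V) f u * up setT h (~: u) =
          \sum_(u in V) q u * up setT h (~: u) + \sum_(u in V) h u * up setT h (~: u).
  by rewrite -big_split; apply: eq_bigr => u _; rewrite fqh mulrDl.
have e3 : \sum_(u in V) q u * up setT h (~: u) = 0.
  transitivity (\sum_(u in V) q u * \sum_(S in nbr u) h S).
    by apply: eq_bigr => u uV; rewrite up_compl.
  rewrite sum_deg_sym; transitivity (\sum_(u in V) K * (h u - q u * h u)).
    by apply: eq_bigr => u uV; rewrite -up_compl // up_q //; ring.
  by rewrite -mulr_sumr sumrB sum_h sum_qh subrr mulr0.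
by rewrite e1 e2 e3 sum_fq sum_f; ring.
Qed.

(* The adjacency operator maps h to [u |-> up h (~: u)], and its norm on the
   functions orthogonal to the first two layers is at most k - 1. *)
Let H_le_w : H <= w.
Proof.
rewrite wE; set X := \sum_(u in V) _.
have h1 : \sum_(u in V) up setT h (~: u) * up setT h (~: u) <= (K - 1) ^+ 2 * H.
  apply: le_trans up_h_norm; rewrite (sum_compl (fun Z => up setT h Z * up setT h Z)).
  rewrite /ip [leRHS](bigID (fun Z : {set 'I_n} => #|Z| == k.+1)) /= lerDl.
  by apply: sumr_ge0 => Z _; rewrite -expr2 sqr_ge0.
have : 0 <= \sum_(u in V) ((K - 1) * h u + up setT h (~: u)) ^+ 2.
  by apply: sumr_ge0 => u _; rewrite sqr_ge0.
have -> : \sum_(u in V) ((K - 1) * h u + up setT h (~: u)) ^+ 2 =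
   (K - 1) ^+ 2 * H + 2 * (K - 1) * X + \sum_(u in V) up setT h (~: u) * up setT h (~: u).
  by rewrite HV !mulr_sumr -!big_split; apply: eq_bigr => u _ /=; ring.
move=> h2; have h3 : 0 <= (K - 1) * ((K - 1) * H + X) by lra.
have K1 : 0 < K - 1 by have := KK; lra.
have : 0 <= (K - 1) * H + X by move: h3; rewrite pmulr_rge0.
by move=> h4; lra.
Qed.

(** The linear part of [f] is determined by the star degrees, so their variance is what remains of
    the norm of [f] once [H] is removed: a small [H] forces the star degrees apart. *)
Let sum_pairs : \sum_i \sum_j (d i - d j) ^+ 2 = 2 * C * ((K + 1) * M - (2 * K + 1) * H).
Proof.
have e1 : \sum_x c x * d x = M - H.
  rewrite -sum_fq -swap_incidence; apply: eq_bigr => S SV.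
  by rewrite /q SV.
have e2 : \sum_x d x * d x = C * (M - H) + C2 * (K * M).
  rewrite -e1 -sum_d !mulr_sumr -big_split /=; apply: eq_bigr => x _.
  by rewrite {1}dE; ring.
have nE : n%:R = 2 * K + 1 :> R by rewrite natrD natrM.
transitivity (\sum_i ((2 * K + 1) * (d i * d i) - 2 * d i * (K * M) + (C * (M - H) + C2 * (K * M)))).
  apply: eq_bigr => i _; rewrite -e2 -sum_d.
  transitivity (\sum_j (d i * d i - 2 * d i * d j + d j * d j)).
    by apply: eq_bigr => j _; ring.
  by rewrite !big_split /= sumrN sumr_const cardn -mulr_sumr -[_ *+ (2 * k + 1)]mulr_natl nE.
rewrite !big_split /= sumrN -mulr_sumr e2 !sumr_const cardn -[C * _ *+ _]mulr_natl -[C2 * _ *+ _]mulr_natl !nE.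
rewrite -mulr_suml -mulr_sumr sum_d.
have -> : C2 = M - C by rewrite -CC2; ring.
have e4 : (2 * K + 1) * (M - C) = K * M - C by have := MC; lra.
apply/eqP; rewrite -subr_eq0; apply/eqP.
transitivity (2 * K * M * ((2 * K + 1) * (M - C) - (K * M - C))); first by ring.
by rewrite e4 subrr mulr0.
Qed.

Let d_diff i j : d i - d j =
  \sum_(Z : {set 'I_n} | (#|Z| == k.+1) && ((i \in Z) && (j \in Z))) (f (Z :\ j) - f (Z :\ i)).
Proof.
have [->|ij] := eqVneq i j; first by rewrite subrr big1 // => Z _; rewrite subrr.
have split_d a b : a != b -> d a = \sum_(S in V | (a \in S) && (b \in S)) f S +
    \sum_(Z : {set 'I_n} | (#|Z| == k.+1) && ((a \in Z) && (b \in Z))) f (Z :\ b).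
  move=> ab; rewrite /d (bigID (fun S : {set 'I_n} => b \in S)) /=; congr (_ + _).
    by apply: eq_bigl => S; rewrite !inE andbA.
  rewrite (reindex_onto (fun Z => Z :\ b) (fun S => b |: S)) /=; last first.
    by move=> S /andP[_ bS]; rewrite setU1K.
  apply: eq_bigl => Z; rewrite !inE eqxx /= (negbTE ab) /= .
  have [bZ|bZ] := boolP (b \in Z).
    rewrite setD1K // eqxx !andbT; have := cardsD1 b Z; rewrite bZ /= add1n => ->.
    by rewrite eqSS.
  rewrite !andbF; apply/negbTE; apply/negP => /andP[_ /eqP/setP/(_ b)].
  by rewrite !inE eqxx (negbTE bZ).
rewrite (split_d i j ij) (split_d j i) 1?eq_sym // sumrB.
have -> : \sum_(S in V | (j \in S) && (i \in S)) f S = \sum_(S in V | (i \in S) && (j \in S)) f S.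
  by apply: eq_bigl => S; rewrite [(j \in S) && _]andbC.
have -> : \sum_(Z : {set 'I_n} | (#|Z| == k.+1) && ((j \in Z) && (i \in Z))) f (Z :\ i) =
  \sum_(Z : {set 'I_n} | (#|Z| == k.+1) && ((i \in Z) && (j \in Z))) f (Z :\ i).
  by apply: eq_bigl => S; rewrite [(j \in S) && _]andbC.
by ring.
Qed.

(** By [d_diff], [|d i - d j|] is at most the number of [(k+1)]-sets [Z] containing both points for
    which exactly one of [Z :\ i], [Z :\ j] is in [F]. A set [Z] with [s] of its [k]-subsets in [F]
    serves [2 * s * (K + 1 - s)] ordered pairs. *)
Let sum_pairs_le D : (forall i j, d i - d j <= D) ->
  \sum_i \sum_j (d i - d j) ^+ 2 <=
  D * (2 * \sum_(u in V) up setT f (~: u) * (K + 1 - up setT f (~: u))).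
Proof.
move=> hD.
have D0 : 0 <= D by have := hD (Ordinal (ltn_addl (2 * k) (ltnSn 0))) (Ordinal (ltn_addl (2 * k) (ltnSn 0))); rewrite subrr.
pose t i j (Z : {set 'I_n}) := (f (Z :\ j) - f (Z :\ i)) ^+ 2.
have h1 i j : (d i - d j) ^+ 2 <=
    D * \sum_(Z : {set 'I_n} | (#|Z| == k.+1) && ((i \in Z) && (j \in Z))) t i j Z.
  rewrite -real_normK ?num_real // expr2; apply: ler_pM => //.
    by rewrite ler_norml hD lerNl opprB hD.
  rewrite d_diff; apply: le_trans (ler_norm_sum _ _ _) _; apply: ler_sum => Z _.
  by rewrite /t /f; case: (_ \in F); case: (_ \in F); rewrite ?subrr ?subr0 ?sub0r ?normrN ?normr1 ?normr0 ?sqrrN ?expr1n ?expr0n.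
apply: (@le_trans _ _ (\sum_i \sum_j D * \sum_(Z : {set 'I_n} | (#|Z| == k.+1) && ((i \in Z) && (j \in Z))) t i j Z)).
  by apply: ler_sum => i _; apply: ler_sum => j _.
under eq_bigr => i _ do rewrite -mulr_sumr.
rewrite -mulr_sumr; apply: ler_wpM2l => //.
rewrite (sum_compl (fun Z => up setT f Z * (K + 1 - up setT f Z))).
have -> : \sum_i \sum_j \sum_(Z : {set 'I_n} | (#|Z| == k.+1) && ((i \in Z) && (j \in Z))) t i j Z =
    \sum_(Z : {set 'I_n} | #|Z| == k.+1) \sum_(i in Z) \sum_(j in Z) t i j Z.
  transitivity (\sum_i \sum_(Z : {set 'I_n} | (#|Z| == k.+1) && (i \in Z)) \sum_(j in Z) t i j Z).
    apply: eq_bigr => i _.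
    rewrite (exchange_big_dep (fun Z : {set 'I_n} => (#|Z| == k.+1) && (i \in Z))) /=.
      by apply: eq_bigr => Z /andP[-> ->].
    by move=> j Z _ /and3P[-> ->].
  rewrite (exchange_big_dep (fun Z : {set 'I_n} => #|Z| == k.+1)) /=.
    by apply: eq_bigr => Z ->.
  by move=> j Z _ /andP[].
rewrite mulr_sumr le_eqVlt; apply/orP; left; apply/eqP; apply: eq_bigr => Z /eqP cZ.
rewrite /up setTI; set s := \sum_(z in Z) f (Z :\ z).
transitivity (\sum_(i in Z) (s - 2 * f (Z :\ i) * s + (K + 1) * f (Z :\ i))).
  apply: eq_bigr => i iZ; rewrite /s mulr_sumr.
  transitivity (\sum_(j in Z) (f (Z :\ j) - 2 * f (Z :\ i) * f (Z :\ j) + f (Z :\ i))).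
    apply: eq_bigr => j jZ.
    transitivity (f (Z :\ j) * f (Z :\ j) - 2 * f (Z :\ i) * f (Z :\ j) + f (Z :\ i) * f (Z :\ i)).
      by rewrite /t; ring.
    by rewrite !ff.
  by rewrite !big_split /= sumrN sumr_const cZ -[_ *+ k.+1]mulr_natl -[k.+1%:R]natr1.
rewrite !big_split /= sumrN -mulr_suml -!mulr_sumr sumr_const cZ -[_ *+ k.+1]mulr_natl -[k.+1%:R]natr1 -/s -/K.
by ring.
Qed.

Let sum_up : \sum_(u in V) up setT f (~: u) = (K + 1) * M.
Proof.
transitivity (\sum_(u in V) 1 * \sum_(S in nbr u) f S).
  by apply: eq_bigr => u uV; rewrite mul1r up_compl.
rewrite sum_deg_sym -sum_f mulr_sumr; apply: eq_bigr => u uV.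
by rewrite sumr_const card_nbr // mulrC -natr1.
Qed.

(** For a star, the degrees into the family are 0 inside and [K] outside. The two nonnegative sums
    measure the deviation from this pattern; the rest is fixed by edge counts, up to the term in
    [w]. *)
Let boundary_le : \sum_(u in V) up setT f (~: u) * (K + 1 - up setT f (~: u)) <= (K + 1) * M + 2 * K * w.
Proof.
have h1 : 0 <= \sum_(u in V) (1 - f u) * (up setT f (~: u) - K) ^+ 2.
  apply: sumr_ge0 => u _; apply: mulr_ge0; last exact: sqr_ge0.
  by rewrite /f; case: (u \in F); rewrite ?subrr ?subr0 ?ler01.
have h2 : 0 <= \sum_(u in V) f u * up setT f (~: u) ^+ 2.
  apply: sumr_ge0 => u _; apply: mulr_ge0; last exact: sqr_ge0.
  by rewrite /f; case: (u \in F); rewrite ?ler01.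
have e : \sum_(u in V) up setT f (~: u) * (K + 1 - up setT f (~: u)) =
  (K + 1) * (\sum_(u in V) up setT f (~: u)) - \sum_(u in V) (1 - f u) * (up setT f (~: u) - K) ^+ 2
  - (\sum_(u in V) f u * up setT f (~: u) ^+ 2) - 2 * K * (\sum_(u in V) up setT f (~: u)) + 2 * K * w + K ^+ 2 * (\sum_(u in V) 1 - \sum_(u in V) f u).
  rewrite /w -sumrB !mulr_sumr -!sumrN -!big_split /=; apply: eq_bigr => u _; ring.
rewrite e sum_up sum_f sumr_const.
have : K * (K * #|V|%:R) = K * ((2 * K + 1) * M) by rewrite NM.
by nra.
Qed.

(** If all differences were at most [3 / 4 * C], the two estimates of the pair sum would give [(K +
    1) * M <= 4 * (2 * K + 1) * H + 6 * K * w], and [H <= w] bounds this by [14 * (K + 1) * w]. *)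
Let gap : 14 * w < M -> exists i j, 3 / 4 * C < d i - d j.
Proof.
move=> hw; case: (boolP [exists i, exists j, 3 / 4 * C < d i - d j]).
  by move=> /existsP[i /existsP[j hij]]; exists i, j.
rewrite negb_exists => /forallP hn; exfalso.
have hD i j : d i - d j <= 3 / 4 * C.
  by have := hn i; rewrite negb_exists => /forallP/(_ j); rewrite -leNgt.
have := sum_pairs_le hD; rewrite sum_pairs => h1.
have h2 : C * (2 * ((K + 1) * M - (2 * K + 1) * H)) <= C * (3 / 2 * ((K + 1) * M + 2 * K * w)).
  apply: (@le_trans _ _ (3 / 4 * C * (2 * \sum_(u in V) up setT f (~: u) * (K + 1 - up setT f (~: u))))).
    by apply: le_trans h1; rewrite le_eqVlt; apply/orP; left; apply/eqP; ring.
  have -> : C * (3 / 2 * ((K + 1) * M + 2 * K * w)) = 3 / 4 * C * (2 * ((K + 1) * M + 2 * K * w)) by field.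
  apply: ler_wpM2l; first by have := C0; lra.
  by have := boundary_le; lra.
move: h2; rewrite ler_pM2l // => h2.
have h3 : (2 * K + 1) * H <= (2 * K + 1) * w.
  by apply: ler_wpM2l H_le_w; have := KK; lra.
have h4 : (K + 1) * (14 * w) < (K + 1) * M.
  by rewrite ltr_pM2l //; have := KK; lra.
have h5 : 0 <= w by apply: le_trans H_le_w; apply: ip_ge0.
lra.
Qed.

Let dN x : d x = #|F :&: star k x|%:R.
Proof.
rewrite /d /f -sum1_card natr_sum [RHS]big_mkcond [LHS]big_mkcond /=.
apply: eq_bigr => S _; rewrite in_setI.
by case: (S \in F); case: (S \in star k x).
Qed.

Let wN : w = (\sum_(S in F) deg F S)%:R.
Proof.
rewrite /w natr_sum [RHS]big_mkcond [LHS]big_mkcond /=.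
apply: eq_bigr => u _; rewrite {1}/f.
case: (boolP (u \in F)) => uF; last by rewrite mul0r; case: ifP.
rewrite (subsetP FV _ uF) mul1r up_compl ?(subsetP FV) // /f /deg -sum1_card natr_sum.
rewrite [RHS]big_mkcond [LHS]big_mkcond; apply: eq_bigr => S _.
by rewrite in_setI; case: (S \in nbr u); case: (S \in F).
Qed.

Lemma unbalanced_stars : (14 * (\sum_(S in F) deg F S) < star_size k)%N ->
  exists i j, (3 * star_size k + 8 * #|F :&: star k j| < 8 * #|F :&: star k i|)%N.
Proof.
rewrite -(ltr_nat R) natrM -wN => /gap[i [j]]; rewrite !dN => hij; exists i, j.
rewrite -(ltr_nat R) natrD !natrM -/M.
have h1 : M <= 2 * C by have := CC2; have := MC; have := C0; have := KK; nra.
by move: hij h1; lra.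
Qed.
End Stability.

(** Two stars differ by [3/8] of the star size in their share of [F]. If the larger share were below
    [5/8], the smaller would be below [1/4], so more than [3/4] of the star size would avoid [j].
    But [phi] pairs the [k]-sets avoiding [j] into edges, and only few pairs can lie wholly in
    [F]. *)
Lemma stability k (F : {set {set 'I_(2 * k + 1)}}) : (4 <= k)%N ->
  F \subset ksets (2 * k + 1) k -> #|F| = star_size k ->
  (16 * (\sum_(S in F) deg F S) <= star_size k)%N ->
  exists x, (5 * star_size k <= 8 * #|F :&: star k x|)%N.
Proof.
move=> k4 FV cF w16; set M := star_size k in cF w16 *.
have k1 : (1 < k)%N by lia.
have M0 : (0 < M)%N by apply: star_size_gt0; lia.
have [|i [j]] := unbalanced_stars rat k1 FV cF; first by rewrite -/M; lia.
rewrite -/M => hij; exists i; rewrite leqNgt; apply/negP => hi.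
pose P := F :\: star k j; pose phi (S : {set 'I_(2 * k + 1)}) := ~: (j |: S).
have sP S : S \in P -> [/\ S \in F, #|S| = k & j \notin S].
  rewrite !inE => /andP[jS SF]; have := subsetP FV _ SF; rewrite inE => /eqP cS.
  by rewrite SF cS eqxx /= in jS *.
pose W := ksets (2 * k + 1) k :\: star k j.
have cW : (k * #|W| = k.+1 * M)%N.
  have := bin_ksets (ltnW k1); rewrite (cardsD) (setIidPr _) ?card_star ?(ltnW k1) // -/M.
    by move=> e; rewrite mulnBr e; lia.
  by apply/subsetP => S; rewrite !inE => /andP[].
have phiP S : S \in P -> phi S \in W.
  move=> /sP[_ cS jS]; rewrite !inE eqxx /= andbF /=.
  have := cardsC (j |: S); rewrite cardsU1 jS cS card_ord => e.
  by apply/eqP; apply: (@addnI (1 + k)); rewrite e; lia.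
have phi_inj : {in P &, injective phi}.
  move=> S S' /sP[_ _ jS] /sP[_ _ jS'] /setC_inj e.
  by rewrite -(setU1K jS) e setU1K.
have PW : P \subset W by apply: setSD.
have cI : (2 * #|P| <= #|W| + #|P :&: phi @: P|)%N.
  rewrite mul2n -addnn -{2}(card_in_imset phi_inj) -(cardsUI P (phi @: P)) leq_add2r subset_leq_card //.
  by rewrite subUset PW; apply/subsetP => S /imsetP[S' /phiP + ->].
have cPw : (#|P :&: phi @: P| <= \sum_(S in F) deg F S)%N.
  have sIF : P :&: phi @: P \subset F by apply/subsetP => S /setIP[/sP[]].
  rewrite -sum1_card [leqRHS](big_setID (P :&: phi @: P)) /= (setIidPr sIF).
  apply: leq_trans (leq_addr _ _).
  apply: leq_sum => S /setIP[SP /imsetP[S' S'P eS]].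
  have [S'F cS' _] := sP _ S'P; apply/card_gt0P; exists S'.
  by rewrite !inE S'F cS' eqxx eS disjoint_sym disjoints_subset setCK subsetUr.
have cP : (#|P| + #|F :&: star k j| = M)%N by rewrite addnC -cF -(cardsID (star k j) F).
nia.
Qed.

(** * Edge isoperimetry around a star *)

Lemma sum_indicator (R : pzSemiRingType) (T : finType) (A : {set T}) (f : T -> R) :
  \sum_(v in A) f v = \sum_v (v \in A)%:R * f v.
Proof.
by rewrite big_mkcond; apply: eq_bigr => v _; case: (v \in A); rewrite ?mul1r ?mul0r.
Qed.

Lemma sum_sqr_le (T : finType) (B : {set T}) (d : T -> nat) :
  ((\sum_(u in B) d u) ^ 2 <= #|B| * \sum_(u in B) d u ^ 2)%N.
Proof.
rewrite -(@leq_pmul2l 2) // expnS expn1 big_distrl /= big_distrr /=.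
have -> : (2 * (#|B| * \sum_(u in B) d u ^ 2) = \sum_(u in B) \sum_(v in B) (d u ^ 2 + d v ^ 2))%N.
  under [RHS]eq_bigr do rewrite big_split /= sum_nat_const.
  by rewrite big_split /= sum_nat_const -big_distrr /= addnn mul2n.
apply: leq_sum => u _; rewrite big_distrr /= big_distrr /=; apply: leq_sum => v _.
exact: nat_Cauchy.
Qed.

Section Isoperimetry.
Variables (R : realFieldType) (k : nat) (x : 'I_(2 * k + 1)).
Variables (A B : {set {set 'I_(2 * k + 1)}}).
Notation n := (2 * k + 1)%N.
Notation V := (ksets n k).
Notation W := (V :\: star k x).
Hypotheses (k1 : (1 < k)%N) (AW : A \subset W) (BS : B \subset star k x).
Hypotheses (BA : (#|B| <= #|A|)%N) (A38 : (8 * #|A| <= 3 * star_size k)%N).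
(** Over [G], the vertices off the star form layer [k] and the complements of the vertices in the
    star form layer [k + 1]; Kneser adjacency between the two parts becomes inclusion. *)
Let G : {set 'I_n} := ~: [set x].
Let K : R := k%:R.
Let M : R := (star_size k)%:R.
Let N0 : R := #|W|%:R.
Let a : R := #|A|%:R.
Let b : R := #|B|%:R.
Let f (S : {set 'I_n}) : R := (S \in A)%:R.
Let h (S : {set 'I_n}) : R := f S - a / N0 * (S \in W)%:R.
Let H : R := ip h h.

Let KK : K > 1. Proof. by rewrite /K ltr1n. Qed.
Let M0 : M > 0. Proof. by rewrite /M ltr0n star_size_gt0 // ltnW. Qed.
Let inW S : (S \in W) = (S \subset G) && (#|S| == k).
Proof. by rewrite !inE subsetC sub1set inE andbC; case: (#|S| == k); rewrite ?andbT ?andbF. Qed.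
Let starV : star k x \subset V.
Proof. by apply/subsetP => S; rewrite !inE => /andP[]. Qed.
Let KN0 : K * N0 = (K + 1) * M.
Proof.
rewrite /N0 cardsD (setIidPr starV) card_star ?(ltnW k1) // natrB -/M.
  by rewrite mulrBr -natrM bin_ksets ?(ltnW k1) // !natrM natrD natrM -/K -/M; ring.
by rewrite -(card_star x) ?(ltnW k1) // subset_leq_card.
Qed.
Let N00 : N0 > 0.
Proof.
by rewrite -(pmulr_rgt0 _ (lt_trans ltr01 KK)) KN0 mulr_gt0 //; have := KK; lra.
Qed.

Let sum_ind (C D : {set {set 'I_n}}) : C \subset D -> \sum_(S in D) (S \in C)%:R = #|C|%:R :> R.
Proof.
move=> CD; rewrite -sum1_card natr_sum [RHS]sum_indicator sum_indicator.
by apply: eq_bigr => S _; case: (boolP (S \in C)) => [/(subsetP CD)->|]; rewrite ?mul0r ?mulr0.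
Qed.

Let hW S : h S != 0 -> S \in W.
Proof.
rewrite /h /f; apply: contraNT => SW; rewrite (negbTE SW) mulr0 subr0.
by case: (boolP (S \in A)) => // /(subsetP AW); rewrite (negbTE SW).
Qed.

Let sumW (g : {set 'I_n} -> R) : (forall S, g S != 0 -> S \in W) -> \sum_S g S = \sum_(S in W) g S.
Proof.
move=> gV; rewrite [RHS]big_mkcond; apply: eq_bigr => S _.
by case: ifPn => // SV; apply/eqP; apply: contraNT SV; apply: gV.
Qed.

Let sum_h : \sum_(S in W) h S = 0.
Proof.
rewrite sumrB sum_ind // -mulr_sumr sum_ind // divfK ?subrr //.
exact: lt0r_neq0.
Qed.

Let HE : H = a - a ^+ 2 / N0.
Proof.
rewrite /H /ip sumW; last by move=> S; rewrite mulf_eq0 negb_or => /andP[_ /hW].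
transitivity (\sum_(S in W) ((S \in A)%:R * (1 - 2 * (a / N0)) + (a / N0) ^+ 2 * (S \in W)%:R)).
  apply: eq_bigr => S SW; rewrite /h /f SW.
  by case: (S \in A); rewrite /=; ring.
rewrite big_split -mulr_suml -mulr_sumr !sum_ind //= -/a -/N0.
have e : a / N0 * N0 = a by rewrite divfK // lt0r_neq0.
have -> : (a / N0) ^+ 2 * N0 = a / N0 * a by rewrite expr2 -mulrA e.
by ring.
Qed.

Let cardG : #|G| = (2 * k)%N.
Proof. by have := cardsC [set x]; rewrite cards1 card_ord -/G addnC => /addIn. Qed.

Let layered_h : layered G k h.
Proof. by move=> S /hW; rewrite inW. Qed.

Let balanced_h : balanced G 0 h.
Proof.
move=> Q _ /eqP; rewrite cards_eq0 => /eqP ->.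
transitivity (\sum_S h S); first by apply: eq_bigl => S; rewrite sub0set.
by rewrite sumW.
Qed.

Let up_h_norm : ip (up G h) (up G h) <= K * (K - 1) * H.
Proof.
rewrite (norm_up layered_h).
have := @down_norm_le R _ G 1 k h isT ltac:(lia) _ layered_h balanced_h.
rewrite cardG addn1 => /(_ ltac:(lia)).
by rewrite natrM -/K -/H; lra.
Qed.

Let up_star (g : {set 'I_n} -> R) u : u \in star k x -> up G g (~: u) = \sum_(S in nbr u) g S.
Proof.
move=> uS; rewrite -up_compl ?(subsetP starV) // /up setTI; apply: eq_bigl => z.
rewrite !inE; have [->|] //= := eqVneq z x.
by move: uS; rewrite inE => /andP[_ ->].
Qed.

Let sum_up_h : \sum_(u in star k x) up G h (~: u) = 0.
Proof.
transitivity (\sum_(u in V) (u \in star k x)%:R * \sum_(S in nbr u) h S).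
  rewrite [RHS](big_setID (star k x)) /= (setIidPr starV) [X in _ + X]big1 ?addr0.
    by apply: eq_bigr => u uS; rewrite uS mul1r up_star.
  by move=> u /setDP[_ /negbTE ->]; rewrite mul0r.
rewrite sum_deg_sym; transitivity (\sum_(u in V) K * h u).
  apply: eq_bigr => u uV; have [->|hu] := eqVneq (h u) 0; first by rewrite mul0r mulr0.
  have := hW hu; rewrite inE => /andP[uS _].
  have xu : x \notin u by move: uS uV; rewrite !inE => + uk; rewrite uk.
  rewrite mulrC /K -[X in X%:R](deg_star uV xu) /deg; congr (_ * _).
  rewrite -sum1_card natr_sum [RHS]big_mkcond [LHS]big_mkcond; apply: eq_bigr => S _.
  by rewrite in_setI; case: (S \in nbr u); case: (S \in star k x).
rewrite -mulr_sumr (big_setID W) /= (setIidPr (subsetDl V (star k x))) sum_h add0r big1 ?mulr0 // => S /setDP[_ SW].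
by apply/eqP; apply: contraNT SW; apply: hW.
Qed.

(** A rational majorant of the square root of [K * (K - 1)], which bounds the norm of [up] on
    functions of sum zero in layer [k]. *)
Let kappa : R := K - 1 / 2.
Let X := \sum_(u in B) up G h (~: u).

Let X_le : 2 * X <= kappa * (b - b ^+ 2 / M + H).
Proof.
have k0 : 0 < kappa by have := KK; rewrite /kappa; lra.
pose g (u : {set 'I_n}) : R := (u \in B)%:R - b / M.
have cS : #|star k x|%:R = M by rewrite card_star // ltnW.
have XE : X = \sum_(u in star k x) g u * up G h (~: u).
  under [RHS]eq_bigr do rewrite mulrBl.
  rewrite sumrB -mulr_sumr sum_up_h mulr0 subr0 /X [RHS](big_setID B) /= (setIidPr BS).
  rewrite [X in _ = _ + X]big1 ?addr0; first by apply: eq_bigr => u ->; rewrite mul1r.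
  by move=> u /setDP[_ /negbTE ->]; rewrite mul0r.
have gg : \sum_(u in star k x) g u * g u = b - b ^+ 2 / M.
  transitivity (\sum_(u in star k x) ((u \in B)%:R * (1 - 2 * (b / M)) + (b / M) ^+ 2 * (u \in star k x)%:R)).
    apply: eq_bigr => S SW; rewrite /g SW.
    by case: (S \in B); rewrite /=; ring.
  rewrite big_split -mulr_suml -mulr_sumr !sum_ind //= cS -/b.
  have e : b / M * M = b by rewrite divfK // lt0r_neq0.
  have -> : (b / M) ^+ 2 * M = b / M * b by rewrite expr2 -mulrA e.
  by ring.
have uu : \sum_(u in star k x) up G h (~: u) * up G h (~: u) <= K * (K - 1) * H.
  apply: le_trans up_h_norm.
  rewrite /ip [leRHS](reindex_inj (inv_inj (@setCK _))) /=.
  rewrite [leRHS](bigID (mem (star k x))) /= lerDl.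
  by apply: sumr_ge0 => Z _; rewrite -expr2 sqr_ge0.
have := sumr_ge0 (index_enum _) (fun u (_ : u \in star k x) => sqr_ge0 (kappa * g u - up G h (~: u))).
have -> : \sum_(u in star k x) (kappa * g u - up G h (~: u)) ^+ 2 =
  kappa ^+ 2 * (b - b ^+ 2 / M) - 2 * kappa * X + \sum_(u in star k x) up G h (~: u) * up G h (~: u).
  rewrite -gg XE !mulr_sumr -sumrN -!big_split /=; apply: eq_bigr => u _; ring.
move=> h1; have H0 : 0 <= H by apply: ip_ge0.
have h2 : K * (K - 1) * H <= kappa ^+ 2 * H.
  by apply: ler_wpM2r => //; rewrite /kappa; lra.
have : kappa * (2 * X) <= kappa * (kappa * (b - b ^+ 2 / M + H)) by lra.
by rewrite ler_pM2l.
Qed.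

Let eAB : \sum_(v in A) (deg B v)%:R = X + (K + 1) * a * b / N0.
Proof.
transitivity (\sum_(u in V) (u \in A)%:R * \sum_(S in nbr u) (S \in B)%:R : R).
  have sAV : A \subset V by apply: subset_trans AW (subsetDl _ _).
  rewrite [RHS](big_setID A) /= (setIidPr sAV) [X in _ = _ + X]big1 ?addr0; last first.
    by move=> u /setDP[_ /negbTE ->]; rewrite mul0r.
  apply: eq_bigr => u ->; rewrite mul1r /deg -sum1_card natr_sum [LHS]big_mkcond [RHS]big_mkcond.
  by apply: eq_bigr => S _; rewrite in_setI; case: (S \in nbr u); case: (S \in B).
rewrite sum_deg_sym.
have sBV : B \subset V by apply: subset_trans BS starV.
rewrite (big_setID B) /= (setIidPr sBV) [X in _ + X = _]big1 ?addr0; last first.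
  by move=> u /setDP[_ /negbTE ->]; rewrite mul0r.
have -> : (K + 1) * a * b / N0 = \sum_(u in B) a / N0 * (K + 1).
  by rewrite sumr_const -[_ *+ #|B|]mulr_natl -/b; ring.
rewrite /X -big_split /=; apply: eq_bigr => u uB; have uS := subsetP BS u uB.
have xu : x \in u by move: uS; rewrite inE => /andP[].
have nW S : S \in nbr u -> S \in W.
  rewrite !inE => /andP[-> duS] /=; rewrite andbT.
  by apply/negP => xS; rewrite (disjointFr duS xu) in xS.
rewrite uB mul1r up_star // /h sumrB.
have -> : \sum_(S in nbr u) a / N0 * (S \in W)%:R = a / N0 * (K + 1).
  transitivity (\sum_(S in nbr u) a / N0); first by apply: eq_bigr => S /nW ->; rewrite mulr1.
  by rewrite sumr_const card_nbr ?(subsetP sBV) // -[_ *+ k.+1]mulr_natl -[k.+1%:R]natr1 mulrC.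
by rewrite subrK.
Qed.

Lemma deg_star_setD (C : {set {set 'I_n}}) v : C \subset star k x -> v \in W ->
  (deg C v + deg (star k x :\: C) v)%N = k.
Proof.
move=> CS; rewrite inE => /andP[vS vV].
have xv : x \notin v by move: vS vV; rewrite !inE => + vk; rewrite vk.
by rewrite -[RHS](deg_star vV xv) /deg -(cardsID C (nbr v :&: star k x)) -setIA (setIidPr CS) setIDA.
Qed.

(** In the densities [al], [be] of [A], [B] relative to the star size, the worst case is [be = al].
    The defect density is then at least [al / 2 - al ^+ 2], the [1 / 2] being the gap between [K]
    and [kappa], and [al <= 3 / 8] leaves [al / 8]. *)
Lemma isoperimetry_R : a <= 8 * \sum_(v in A) (deg (star k x :\: B) v)%:R.
Proof.
have -> : \sum_(v in A) (deg (star k x :\: B) v)%:R = K * a - \sum_(v in A) (deg B v)%:R.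
  apply/esym/eqP; rewrite subr_eq -big_split /=; apply/eqP/esym.
  transitivity (\sum_(v in A) K); last by rewrite sumr_const -[_ *+ #|A|]mulr_natr.
  by apply: eq_bigr => v vA; rewrite -natrD addnC deg_star_setD // (subsetP AW).
have ba : b <= a by rewrite ler_nat.
have a38 : 8 * a <= 3 * M by rewrite -!natrM ler_nat.
have b0 : 0 <= b by apply: ler0n.
rewrite eAB; have := X_le; rewrite HE /kappa.
pose al := a / M; pose be := b / M.
have ea : a = al * M by rewrite divfK // lt0r_neq0.
have eb : b = be * M by rewrite divfK // lt0r_neq0.
have nz1 : M != 0 by apply: lt0r_neq0.
have nz2 : K != 0 by apply: lt0r_neq0; have := KK; lra.
have nz3 : K + 1 != 0 by apply: lt0r_neq0; have := KK; lra.
have eN : N0 = (K + 1) * M / K by rewrite -KN0 mulrC mulKf.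
rewrite eN.
have -> : (K + 1) * a * b / ((K + 1) * M / K) = K * al * be * M by rewrite ea eb; field; rewrite ?nz1 ?nz2 ?nz3.
have -> : a ^+ 2 / ((K + 1) * M / K) = K / (K + 1) * al ^+ 2 * M by rewrite ea; field; rewrite ?nz1 ?nz2 ?nz3.
have -> : b ^+ 2 / M = be ^+ 2 * M by rewrite eb; field; rewrite ?nz1.
have be0 : 0 <= be by rewrite divr_ge0 // ltW.
have beal : be <= al by rewrite ler_pM2r // invr_gt0.
have al38 : 8 * al <= 3 by rewrite -(ler_pM2r M0) -mulrA -ea.
move=> hX.
have rho : K / (K + 1) = 1 - 1 / (K + 1) by field.
set rh := K / (K + 1) in hX rho *.
have hrh : (K + 1) * rh = K by rewrite /rh mulrC divfK.
suff : al * M <= 8 * (K * (al * M) - (X + K * al * be * M)) by rewrite -ea.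
have hX' : 2 * X <= ((K - 1 / 2) * (be - be ^+ 2 + (al - rh * al ^+ 2))) * M by rewrite {1}ea {1}eb in hX; lra.
suff h1 : al <= 8 * (K * al - (K - 1 / 2) * (be - be ^+ 2 + (al - rh * al ^+ 2)) / 2 - K * al * be).
  have := ler_wpM2r (ltW M0) h1; lra.
have h2 : be - be ^+ 2 <= al - al ^+ 2.
  rewrite -subr_ge0 (_ : _ - _ = (al - be) * (1 - (al + be))); last by ring.
  by apply: mulr_ge0; lra.
have h3 : (K - 1 / 2) * (be - be ^+ 2) <= (K - 1 / 2) * (al - al ^+ 2).
  by apply: ler_wpM2l => //; have := KK; lra.
have h4 : K * al * be <= K * al * al.
  by apply: ler_wpM2l => //; apply: mulr_ge0; have := KK; lra.
have h5 : K - (K - 1 / 2) * (1 + rh) / 2 <= 1.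
  have k0 : 0 < K + 1 by have := KK; lra.
  by rewrite -(ler_pM2l k0) mulr1; have := hrh; nra.
have h6 : al ^+ 2 * (K - (K - 1 / 2) * (1 + rh) / 2) <= al ^+ 2 * 1.
  by apply: ler_wpM2l => //; apply: sqr_ge0.
have h7 : al ^+ 2 <= 3 / 8 * al by rewrite expr2; apply: ler_wpM2r; lra.
lra.
Qed.
End Isoperimetry.

Lemma isoperimetry k (x : 'I_(2 * k + 1)) (A B : {set {set 'I_(2 * k + 1)}}) : (1 < k)%N ->
  A \subset ksets (2 * k + 1) k :\: star k x -> B \subset star k x -> (#|B| <= #|A|)%N ->
  (8 * #|A| <= 3 * star_size k)%N ->
  (#|A| <= 8 * \sum_(v in A) deg (star k x :\: B) v)%N.
Proof.
move=> k1 AW BS BA A38; have := isoperimetry_R rat k1 AW BS BA A38.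
by rewrite -natr_sum -natrM ler_nat.
Qed.

(* Two vertices have at most one common neighbour, so a small set cannot send
   many edges into a set of the same size. *)
Lemma small_isoperimetry k (x : 'I_(2 * k + 1)) (A B : {set {set 'I_(2 * k + 1)}}) : (400 <= k)%N ->
  A \subset ksets (2 * k + 1) k :\: star k x -> B \subset star k x -> (#|B| <= #|A|)%N ->
  (#|A| < 24 * k)%N ->
  (3 * k * #|A| <= 4 * \sum_(v in A) deg (star k x :\: B) v)%N.
Proof.
move=> k400 AW BS BA A24; set E := (\sum_(v in A) _)%N; set a := #|A|.
pose e := (\sum_(v in A) deg B v)%N.
have eE : (e + E = k * a)%N.
  rewrite /e /E -big_split /= [RHS]mulnC -[RHS]sum_nat_const; apply: eq_bigr => v vA.
  by rewrite deg_star_setD // (subsetP AW).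
have AV : A \subset ksets (2 * k + 1) k by apply: subset_trans AW (subsetDl _ _).
have BV : B \subset ksets (2 * k + 1) k.
  by apply: subset_trans BS _; apply/subsetP => S; rewrite !inE => /andP[].
have nE v u : v \in A -> u \in B -> (u \in nbr v) = (v \in nbr u).
  by move=> /(subsetP AV) vV /(subsetP BV) uV; rewrite nbr_sym.
have e1 : e = (\sum_(u in B) deg A u)%N by apply: sum_deg_swap.
have e2 : (\sum_(u in B) deg A u * deg A u <= e + a * a)%N.
  have -> : (\sum_(u in B) deg A u * deg A u = \sum_(v in A) \sum_(v' in A) #|nbr v :&: nbr v' :&: B|)%N.
    transitivity (\sum_(u in B) \sum_(v in A) \sum_(v' in A) (v \in nbr u) * (v' \in nbr u))%N.
      apply: eq_bigr => u uB; rewrite deg_sum big_distrl /=; apply: eq_bigr => v vA.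
      by rewrite big_distrr.
    rewrite exchange_big /=; apply: eq_bigr => v vA; rewrite exchange_big /=; apply: eq_bigr => v' v'A.
    rewrite -sum1_card [RHS]big_mkcond [LHS]big_mkcond; apply: eq_bigr => u _.
    rewrite !in_setI andbC; case: (boolP (u \in B)) => //= uB.
    by rewrite (nE v) // (nE v') //; case: (v \in nbr u); case: (v' \in nbr u).
  rewrite /e -[(a * a)%N]sum_nat_const -big_split /=; apply: leq_sum => v vA.
  rewrite (bigD1 v) //= setIid; apply: leq_add; first exact: leqnn.
  rewrite /a -sum1_card [leqRHS](bigD1 v) //=.
  apply: leq_trans (leq_addl _ _); apply: leq_sum => v' /andP[v'A ne].
  have ne' : v != v' by rewrite eq_sym.
  have := codeg_le1 (subsetP AV v vA) (subsetP AV v' v'A) ne'.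
  by apply: leq_trans; rewrite subset_leq_card // subsetIl.
have cs := sum_sqr_le B (deg A); rewrite -e1 in cs.
have h1 : (e * e <= a * (e + a * a))%N.
  by apply: leq_trans cs _; apply: leq_mul => //; apply: leq_trans e2; apply: leq_sum => u _; rewrite expnS expn1.
suff h2 : (4 * e <= k * a)%N by lia.
rewrite leqNgt; apply/negP => h2.
have a0 : (0 < a)%N by rewrite lt0n; apply/eqP => a0; rewrite a0 in h1 h2; lia.
have h3 : (e * (e - a) <= a * a * a)%N by rewrite mulnBr; lia.
have h4 : (k * a * (k * a - 4 * a) <= 4 * e * (4 * (e - a)))%N.
  by apply: leq_mul; lia.
have h5 : (k * (k - 4) * (a * a) <= 16 * a * (a * a))%N.
  have -> : (k * (k - 4) * (a * a) = k * a * (k * a - 4 * a))%N by rewrite -mulnBl; lia.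
  by apply: leq_trans h4 _; lia.
have : (k * (k - 4) <= 16 * a)%N by rewrite -(@leq_pmul2r (a * a)) // muln_gt0 a0.
(* [a < 24 * k] gives [16 * a < 384 * k], so [396 * k] is a contradiction; this is where [400 <= k]
   enters. *)
have h6 : (k * 396 <= k * (k - 4))%N by apply: leq_mul => //; lia.
by rewrite /a in A24 *; lia.
Qed.

(** * Sparse covers and walks *)

Section Cover.
Variables (R : realFieldType) (T T' : finType) (A : {set T}) (adj : T -> {set T'}) (w : T -> nat).
Variable (delta : R).
Let a : R := #|A|%:R.
Let E : R := (\sum_(v in A) w v)%:R.
Hypotheses (A0 : (0 < #|A|)%N) (delta_a : 0 <= delta <= a).

Lemma exists_below_average (g : T -> R) c : \sum_(v in A) g v <= a * c -> exists2 v, v \in A & g v <= c.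
Proof.
move=> h; apply/exists_inP; apply: contraLR h => /exists_inPn hn; rewrite -ltNge.
rewrite /a mulr_natl -sumr_const; have [v vA] := card_gt0P A0.
apply: ltr_sum; last by move=> u /hn; rewrite -ltNge.
by apply/hasP; exists v; rewrite ?mem_index_enum.
Qed.

(* Greedy covering: a step that does at least as well as a uniformly random
   element of A decreases the potential. *)
Lemma greedy_cover s (U : {set T'}) :
  (forall u, u \in U -> delta <= #|[set v in A | u \in adj v]|%:R) ->
  exists X : {set T}, [/\ X \subset A, (#|X| <= s)%N &
    (#|U :\: \bigcup_(v in X) adj v| + \sum_(v in X) w v)%:R <=
    #|U|%:R * (1 - delta / a) ^+ s + s%:R * (E / a)].
Proof.
have a0 : 0 < a by rewrite ltr0n.
case/andP: delta_a => d0 da.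
have z0 : 0 <= 1 - delta / a by rewrite subr_ge0 ler_pdivrMr ?mul1r.
elim: s U => [|s IH] U hU.
  exists set0; rewrite sub0set cards0 !big_set0 setD0 addn0 expr0 mulr1 mul0r addr0.
  by split.
pose g v := #|U :\: adj v|%:R * (1 - delta / a) ^+ s + (w v)%:R.
have [v vA hv] : exists2 v, v \in A & g v <= #|U|%:R * (1 - delta / a) ^+ s.+1 + E / a.
  apply: exists_below_average; rewrite /g big_split /= -mulr_suml (_ : \sum_(i in A) (w i)%:R = E); last by rewrite /E natr_sum.
  have -> : a * (#|U|%:R * (1 - delta / a) ^+ s.+1 + E / a) = #|U|%:R * (a - delta) * (1 - delta / a) ^+ s + E.
    by rewrite exprSr; set t := _ ^+ s; field; rewrite gt_eqF.
  rewrite lerD2r; apply: ler_wpM2r; first exact: exprn_ge0.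
  have -> : \sum_(v in A) #|U :\: adj v|%:R = \sum_(u in U) (a - #|[set v in A | u \in adj v]|%:R).
    transitivity (\sum_(v in A) \sum_(u in U) (u \notin adj v)%:R : R).
      apply: eq_bigr => v _; rewrite -sum1_card natr_sum [LHS]big_mkcond [RHS]big_mkcond.
      by apply: eq_bigr => u _; rewrite inE andbC; case: (u \in U); case: (u \in adj v).
    rewrite exchange_big; apply: eq_bigr => u uU /=.
    apply/esym/eqP; rewrite subr_eq -sum1_card natr_sum [in X in _ + X]big_mkcond /= /a -sum1_card natr_sum.
    rewrite [X in X == _]big_mkcond [X in _ == X + _]big_mkcond -big_split; apply/eqP; apply: eq_bigr => v _ /=.
    by rewrite inE; case: (v \in A) => //=; rewrite ?addr0 //; case: (u \in adj v); rewrite ?addr0 ?add0r.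
  apply: (@le_trans _ _ (\sum_(u in U) (a - delta))).
    by apply: ler_sum => u uU; rewrite lerD2l lerN2 hU.
  by rewrite sumr_const -[_ *+ #|U|]mulr_natl.
have [|X [XA cX hX]] := IH (U :\: adj v).
  by move=> u /setDP[uU _]; apply: hU.
exists (v |: X); split.
- by rewrite subUset sub1set vA.
- by rewrite cardsU1; case: (v \notin X) => /=; lia.
apply: (@le_trans _ _ ((w v)%:R + (#|U :\: adj v :\: \bigcup_(u in X) adj u| + \sum_(u in X) w u)%:R)).
  rewrite -natrD ler_nat addnCA; apply: leq_add.
    apply: subset_leq_card; apply/subsetP => u /setDP[uU nb]; rewrite !in_setD uU andbT.
    apply/andP; split; apply: contra nb => hu; apply/bigcupP.
      by have [z zX uz] := bigcupP hu; exists z; rewrite // !inE zX orbT.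
    by exists v; rewrite // !inE eqxx.
  have [vX|vX] := boolP (v \in X); last by rewrite big_setU1.
  by rewrite (setUidPr _) ?sub1set // leq_addl.
apply: le_trans (lerD (lexx _) hX) _.
by move: hv; rewrite /g -natr1 mulrDl mul1r; lra.
Qed.
End Cover.

Lemma bernoulli_inv (R : realFieldType) (z : R) s : 0 <= z <= 1 -> (1 - z) ^+ s * (1 + s%:R * z) <= 1.
Proof.
move=> /andP[z0 z1]; elim: s => [|s IH]; first by rewrite expr0 mul1r mul0r addr0.
apply: le_trans IH; rewrite exprSr -mulrA; apply: ler_wpM2l; first by apply: exprn_ge0; lra.
have s0 : 0 <= s%:R :> R by apply: ler0n.
by rewrite -natr1; have := mulr_ge0 z0 z0; have := mulr_ge0 s0 (mulr_ge0 z0 z0); nra.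
Qed.

(** [r] trades the size of the cover against what it leaves. About [#|A| / r] greedy steps, each
    covering on average a fraction [k / (2 * #|A|)] of the remainder, leave at most a fraction
    [1 / (1 + r / 2) <= 2 / r] of [U]. In the uses, [w v] counts the neighbours of [v] on the wrong
    side, so its sum bounds what is covered in excess. *)
Lemma sparse_cover (T T' : finType) (A : {set T}) (adj : T -> {set T'}) (w : T -> nat) (U : {set T'}) k r :
  (0 < r)%N -> (r * r <= k)%N -> (k <= #|A|)%N ->
  (forall u, u \in U -> (k <= 2 * #|[set v in A | u \in adj v]|)%N) ->
  exists X : {set T}, [/\ X \subset A, (r * #|X| <= 2 * #|A|)%N &
    (r * (#|U :\: \bigcup_(v in X) adj v| + \sum_(v in X) w v) <= 2 * #|U| + 2 * \sum_(v in A) w v)%N].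
Proof.
move=> r0 rk kA hU; set a := #|A| in kA *; pose s := (a %/ r).+1.
have rs1 : (a <= r * s)%N by rewrite /s; have := divn_eq a r; have := ltn_pmod a r0; lia.
have rs2 : (r * s <= 2 * a)%N.
  have := leq_trunc_div a r; rewrite /s.
  have : (r <= a)%N by nia.
  by lia.
have a0 : (0 < a)%N by nia.
pose R := rat.
have ak : k%:R / 2 <= a%:R :> R.
  have : k%:R <= a%:R :> R by rewrite ler_nat.
  by have : 0 <= k%:R :> R by []; lra.
have [||X [XA cX hX]] := @greedy_cover R _ _ A adj w (k%:R / 2) a0 _ s U.
- by rewrite ak andbT divr_ge0.
- move=> u /hU; rewrite -(ler_nat R) natrM => hu.
  by rewrite ler_pdivrMr // mulrC.
exists X; split=> //; first by apply: leq_trans rs2; rewrite leq_mul2l cX orbT.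
rewrite -(ler_nat R) natrM.
have r0' : 0 < r%:R :> R by rewrite ltr0n.
apply: le_trans (ler_wpM2l (ltW r0') hX) _; rewrite -/a.
have a0' : 0 < a%:R :> R by rewrite ltr0n.
set z := k%:R / 2 / a%:R; set E := (\sum_(v in A) w v)%N.
have z01 : 0 <= z <= 1 by rewrite /z divr_ge0 ?divr_ge0 //= ler_pdivrMr // mul1r.
have hs : s%:R * z * 2 >= r%:R.
  have -> : s%:R * z * 2 = s%:R * k%:R / a%:R :> R by rewrite /z; field; rewrite gt_eqF.
  rewrite ler_pdivlMr // -!natrM ler_nat.
  by apply: leq_trans (leq_mul (leqnn s) rk); have := leq_mul (leqnn r) rs1; lia.
have hb := bernoulli_inv s z01.
have p0 : 0 <= (1 - z) ^+ s by apply: exprn_ge0; case/andP: z01; lra.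
have hp : r%:R * (1 - z) ^+ s <= 2 by nra.
have hE : r%:R * (s%:R * (E%:R / a%:R)) <= 2 * E%:R :> R.
  have -> : r%:R * (s%:R * (E%:R / a%:R)) = (r * s)%:R * E%:R / a%:R :> R by rewrite natrM; ring.
  rewrite ler_pdivrMr // mulrAC; apply: ler_wpM2r => //.
  by rewrite -natrM ler_nat.
rewrite mulrDr natrD !natrM; apply: lerD => //.
by rewrite mulrCA [2 * _]mulrC; apply: ler_wpM2l.
Qed.

(** * Walks through linked sets and their encoding *)

Section Walks.
Variables (T : finType) (e : rel T).
Hypotheses (e_refl : reflexive e) (e_sym : symmetric e).

Definition reach r u v := exists p, [/\ path e u p, last u p = v & (size p <= r)%N].

Lemma reach0 r u : reach r u u.
Proof. by exists [::]; split. Qed.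

Lemma reach1 u v : e u v -> reach 1 u v.
Proof. by move=> uv; exists [:: v]; split; rewrite //= uv. Qed.

Lemma reach_le r r' u v : (r <= r')%N -> reach r u v -> reach r' u v.
Proof. by move=> h [p [? ? sp]]; exists p; split => //; apply: leq_trans h. Qed.

Lemma reach_trans r r' u v z : reach r u v -> reach r' v z -> reach (r + r') u z.
Proof.
move=> [p [pp lp sp]] [q [pq lq sq]]; exists (p ++ q); split.
- by rewrite cat_path pp lp.
- by rewrite last_cat lp.
- by rewrite size_cat leq_add.
Qed.

Lemma reach_sym r u v : reach r u v -> reach r v u.
Proof.
move=> [p [pp lp sp]]; exists (rev (belast u p)); split.
- by rewrite -lp rev_path (eq_path (e' := e)) // => ? ?; exact: e_sym.
- case: p lp {pp sp} => [|z p] /= lp; first by rewrite -lp.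
  by rewrite rev_cons last_rcons.
- by rewrite size_rev size_belast.
Qed.

(** Connectivity of [Y] in the graph joining points at distance at most [r], in the form of a
    condition on cuts; the walks may leave [Y]. *)
Definition linked r (Y : {set T}) := forall Y1 : {set T}, Y1 \subset Y -> Y1 != set0 -> Y1 != Y ->
  exists y1 y2, [/\ y1 \in Y1, y2 \in Y :\: Y1 & reach r y1 y2].

(** The visited part grows one point at a time: a new point within distance [r] of a visited one is
    inserted into the walk as a detour there and back. *)
Lemma linked_walk r (Y : {set T}) v0 : linked r Y -> v0 \in Y ->
  exists p, [/\ path e v0 p, {subset Y <= v0 :: p} & (size p <= 2 * r * #|Y|.-1)%N].
Proof.
move=> lY v0Y.
suff : forall j, (j < #|Y|)%N -> exists p (Z : {set T}),
    [/\ path e v0 p, (Z \subset Y) && (v0 \in Z), {subset Z <= v0 :: p}, #|Z| = j.+1 & (size p <= 2 * r * j)%N].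
  move=> /(_ #|Y|.-1); have Y0 : (0 < #|Y|)%N by apply/card_gt0P; exists v0.
  rewrite prednK // leqnn => /(_ isT)[p [Z [pp /andP[ZY _] sZ cZ sp]]].
  exists p; split=> // u uY; apply: sZ.
  by have /eqP -> : Z == Y by rewrite eqEcard ZY cZ leqnn.
elim=> [|j IH] jY.
  exists [::], [set v0]; split; rewrite ?cards1 // ?sub1set ?v0Y ?set11 //.
  by move=> u; rewrite !inE.
have [p [Z [pp /andP[ZY v0Z] sZ cZ sp]]] := IH (ltnW jY).
have [||y1 [y2 [y1Z y2Y [q [pq lq sq]]]]] := lY Z ZY.
- by apply/set0Pn; exists v0.
- by apply: contraTneq jY => <-; rewrite cZ ltnn.
have [q' [pq' lq' sq']] : reach r y2 y1 by apply: reach_sym; exists q.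
have y1p := sZ _ y1Z.
case/splitPl: y1p pp sp sZ => p1 p2 lp1 pp sp sZ.
move: pp; rewrite cat_path lp1 => /andP[pp1 pp2].
exists (p1 ++ q ++ q' ++ p2), (y2 |: Z); case/setDP: y2Y => y2Y y2Z; split.
- by rewrite !cat_path pp1 lp1 pq lq pq' lq'.
- by rewrite subUset sub1set y2Y ZY !inE v0Z orbT.
- move=> u; rewrite !inE => /orP[/eqP ->|/sZ].
    rewrite !mem_cat; case: q lq {pq sq} => [|z q] /= lq.
      by move: y2Z; rewrite -lq y1Z.
    by rewrite -lq mem_last !orbT.
  by rewrite !inE !mem_cat => /or3P[->|->|->]; rewrite ?orbT.
- by rewrite cardsU1 y2Z cZ.
- by move: sp; rewrite !size_cat; nia.
Qed.

Variables (Dg q : nat).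
Hypothesis degD : forall u, (#|[set v | e u v]| <= Dg)%N.

Definition step u i := nth u (enum [set v | e u v]) i.

Fixpoint trace u (cs : seq ('I_Dg * {set 'I_q})) : seq (T * {set 'I_q}) :=
  if cs is c :: cs' then let v := step u c.1 in (v, c.2) :: trace v cs' else [::].

Lemma trace_path (mark : T -> {set 'I_q}) u p : path e u p ->
  exists cs, size cs = size p /\ trace u cs = [seq (v, mark v) | v <- p].
Proof.
elim: p u => [|v p IH] u /=; first by exists [::].
move=> /andP[uv /IH[cs [scs tcs]]].
have hi : (index v (enum [set v | e u v]) < Dg)%N.
  by apply: leq_trans (degD u); rewrite cardE index_mem mem_enum inE.
exists ((Ordinal hi, mark v) :: cs); rewrite /= scs; split=> //.
have -> : step u (index v (enum [set v | e u v])) = v.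
  by rewrite /step nth_index // mem_enum inE.
by rewrite tcs.
Qed.

Definition marked (tr : seq (T * {set 'I_q})) (j : 'I_q) : {set T} :=
  [set v | has (fun c : T * {set 'I_q} => (c.1 == v) && (j \in c.2)) tr].

(* A linked set is covered by a walk twice as long as a spanning tree; the
   marks along the walk recover the individual sets S j. *)
Lemma count_linked r y (Z : finType) (P : {set Z}) (dec : ('I_q -> {set T}) -> Z) : (0 < r)%N ->
  (forall S S', S =1 S' -> dec S = dec S') ->
  (forall z, z \in P -> exists S : 'I_q -> {set T},
     [/\ dec S = z, linked r (\bigcup_j S j), \bigcup_j S j != set0 & (#|\bigcup_j S j| <= y)%N]) ->
  (#|P| <= #|T| * (Dg * 2 ^ q) ^ (2 * r * y))%N.
Proof.
move=> r0 ext hP; pose L := (2 * r * y)%N.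
pose D := (T * L.-tuple ('I_Dg * {set 'I_q}))%type.
pose decode (d : D) := dec (marked (trace d.1 d.2)).
suff sub : P \subset decode @: [set: D].
  apply: leq_trans (subset_leq_card sub) _; apply: leq_trans (leq_imset_card _ _) _.
  have c2 : #|{set 'I_q}| = (2 ^ q)%N by rewrite -cardsT -powersetT card_powerset cardsT card_ord.
  by rewrite cardsT card_prod card_tuple card_prod card_ord c2.
apply/subsetP => z /hP[S [dz lS S0 cS]]; set Y := \bigcup_j S j in lS S0 cS.
have [v0 v0Y] := set0Pn _ S0.
have [p [pp sp szp]] := linked_walk lS v0Y.
(* [trace] lists only the vertices after the start, so a loop at [v0] puts [v0] itself on record;
   loops at the end pad the length to exactly [L]. *)
pose p' := v0 :: p ++ nseq (L - (size p).+1) (last v0 p).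
have Y0 : (0 < #|Y|)%N by rewrite card_gt0.
have szL : (size p < L)%N.
  rewrite /L; have : (2 * r * #|Y| <= 2 * r * y)%N by rewrite leq_mul2l cS orbT.
  by move: szp; rewrite -subn1 mulnBr; nia.
have sp' : size p' = L by rewrite /= size_cat size_nseq; lia.
have pp' : path e v0 p'.
  rewrite /= e_refl cat_path pp /=; move: (last v0 p) => l.
  by elim: (L - _)%N => //= m ->; rewrite e_refl.
pose mark u := [set j | u \in S j].
have [cs [scs tcs]] := trace_path mark pp'.
have szcs : size cs == L by rewrite scs sp'.
apply/imsetP; exists (v0, Tuple szcs); rewrite ?inE // /decode /= tcs -dz.
apply: ext => j; apply/setP => u; rewrite inE has_map.
apply/idP/hasP => [uS|[v vp] /=].
  exists u; last by rewrite /= eqxx inE.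
  have : u \in v0 :: p by apply: sp; apply/bigcupP; exists j.
  by rewrite !inE mem_cat => /orP[->|->]; rewrite ?orbT.
by case/andP => /eqP ->; rewrite inE.
Qed.
End Walks.

(** * Counting local obstructions *)

Local Open Scope nat_scope.

Lemma leq_card_sum (T : finType) (P : {set T}) (g : T -> nat) k :
  (forall v, v \in P -> k <= 2 * g v) -> k * #|P| <= 2 * \sum_(v in P) g v.
Proof.
by move=> h; rewrite mulnC -sum_nat_const big_distrr; apply: leq_sum.
Qed.

Fact missing_arith a b e E k s : e + E = k * a -> b <= a -> s + e = k.+1 * b -> s <= a + E.
Proof.
move=> h1 h2 h3; have h4 : k.+1 * b <= k.+1 * a by rewrite leq_mul2l h2.
lia.
Qed.

Fact half_arith a b k : a + b = k -> 2 * a < k -> k <= 2 * b.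
Proof. by lia. Qed.

Fact half_arith' a k : 2 * a < k -> k <= 2 * (k.+1 - a).
Proof. by lia. Qed.

Fact small_code_arith a b E k r p q : 400 <= k -> r <= k -> b <= a ->
  3 * k * a <= 4 * E -> k * p <= 2 * (a + E) -> k * q <= 2 * E ->
  r * (0 + 0 + b + p + q) <= 72 * E.
Proof.
move=> k400 rk ba hE hp hq; rewrite !add0n !mulnDr.
have h6 : r * b <= k * a by apply: leq_mul.
have h7 : 400 * a <= k * a by apply: leq_mul.
have h8 : r * p <= k * p by apply: leq_mul.
have h9 : r * q <= k * q by apply: leq_mul.
by lia.
Qed.

(** With [a <= 8 * E], the costs after multiplication by [r] are [16 * E] for [t], [18 * E] for [x1]
    and [c] together, [18 * E] for each of [v] and [p], and [2 * E] for [q]: [72 * E] in all. *)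
Fact large_code_arith a E k r t c x1 x2 p q l : r <= k -> l <= a -> a <= 8 * E ->
  r * t <= 2 * a -> r * (c + x2) <= 2 * l + 2 * E ->
  x1 <= x2 -> k * p <= 2 * (a + E) -> k * q <= 2 * E -> forall u v, u <= c + v -> k * v <= 2 * (a + E) ->
  r * (t + x1 + u + p + q) <= 72 * E.
Proof.
move=> rk la aE ht hc hx hp hq u v hu hv; rewrite !mulnDr; rewrite mulnDr in hc.
have h1 : r * x1 <= r * x2 by apply: leq_mul.
have h8 : r * p <= k * p by apply: leq_mul.
have h9 : r * q <= k * q by apply: leq_mul.
have h10 : r * v <= k * v by apply: leq_mul.
have : r * u <= r * c + r * v by rewrite -mulnDr leq_mul2l hu orbT.
by lia.
Qed.

(** * Connectivity through common neighbours *)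

Section Adjacency.
Variable k : nat.
Notation n := (2 * k + 1).
Notation V := (ksets n k).
Implicit Types (u v : {set 'I_n}) (A B : {set {set 'I_n}}).

(** The loops allow walks to be padded to a common length. Sets that are not vertices are joined
    only to themselves. *)
Definition lazy_adj u v := (u == v) || ((u \in V) && (v \in nbr u)).

Lemma lazy_adj_refl : reflexive lazy_adj.
Proof. by move=> u; rewrite /lazy_adj eqxx. Qed.

Lemma nbrV u v : v \in nbr u -> v \in V.
Proof. by rewrite inE => /andP[]. Qed.

Lemma lazy_adj_sym : symmetric lazy_adj.
Proof.
move=> u v; rewrite /lazy_adj eq_sym; congr (_ || _).
have [uV|uV] := boolP (u \in V); have [vV|vV] := boolP (v \in V) => //=.
- by rewrite nbr_sym.
- by apply: contraNF vV; apply: nbrV.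
- by apply/esym; apply: contraNF uV; apply: nbrV.
Qed.

Lemma lazy_adj_deg u : #|[set v | lazy_adj u v]| <= k + 2.
Proof.
have [uV|uV] := boolP (u \in V); last first.
  apply: (@leq_trans #|[set u]|); last by rewrite cards1; lia.
  by apply: subset_leq_card; apply/subsetP => v; rewrite !inE /lazy_adj (negbTE uV) orbF eq_sym.
apply: (@leq_trans #|u |: nbr u|).
  by apply: subset_leq_card; apply/subsetP => v; rewrite inE in_setU1 /lazy_adj uV eq_sym.
by rewrite cardsU1 card_nbr //; case: (u \notin _); lia.
Qed.

Lemma nbr_reach u v : u \in V -> v \in nbr u -> reach lazy_adj 1 u v.
Proof. by move=> uV uv; apply: reach1; rewrite /lazy_adj uV uv orbT. Qed.

Definition coadjacent u v := nbr u :&: nbr v != set0.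

Lemma coadjacent_reach u v : u \in V -> v \in V -> coadjacent u v -> reach lazy_adj 2 u v.
Proof.
move=> uV vV /set0Pn[z /setIP[zu zv]]; rewrite -[2]/(1 + 1).
apply: (reach_trans (nbr_reach uV zu)); apply: reach_sym; first exact: lazy_adj_sym.
exact: nbr_reach.
Qed.

Definition two_linked A := [forall A1 : {set {set 'I_n}},
  [&& A1 \subset A, A1 != set0 & A1 != A] ==>
  [exists u in A1, exists v in A :\: A1, coadjacent u v]].

(** Each point of [A] is sent by [g] to a point of [Y] within distance 2, and a cut of [Y] is pulled
    back to [A]. If the pulled-back cut is proper, a coadjacent pair across it gives distance
    [2 + 2 + 2]. If it is trivial, a point of [Y] on the side missed by [g] is at distance at most 4
    from the image of a nearby point of [A]. *)
Lemma two_linked_reach A Y : A \subset V -> two_linked A -> Y != set0 ->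
  (forall u, u \in A -> exists2 y, y \in Y & reach lazy_adj 2 u y) ->
  (forall y, y \in Y -> exists2 u, u \in A & reach lazy_adj 2 u y) ->
  linked lazy_adj 6 Y.
Proof.
move=> AV lA Y0 hA hY Y1 Y1Y Y10 Y1n.
have rs := reach_sym lazy_adj_sym.
have [g hg] : exists g, forall u, u \in A -> g u \in Y /\ reach lazy_adj 2 u (g u).
  apply: (fin_all_exists (P := fun u y => u \in A -> y \in Y /\ reach lazy_adj 2 u y)) => u.
  have [uA|uA] := boolP (u \in A); last by exists set0.
  by have [y yY r] := hA u uA; exists y.
have [y2 y2Y y2n] : exists2 y, y \in Y & y \notin Y1.
  by apply/subsetPn; apply: contra Y1n => h; rewrite eqEsubset Y1Y.
have [y1 y1Y] := set0Pn _ Y10.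
pose A1 := [set u in A | g u \in Y1].
have [h|A1A] := eqVneq A1 A.
  have [a2 a2A ra2] := hY _ y2Y; have [gY rg] := hg _ a2A.
  move: (a2A); rewrite -h inE => /andP[_ g1]; exists (g a2), y2; split=> //.
    by rewrite inE y2n.
  by apply: (@reach_le _ _ (2 + 2)) => //; apply: reach_trans ra2; apply: rs.
have [h|A10] := eqVneq A1 set0.
  have [a1 a1A ra1] := hY _ (subsetP Y1Y _ y1Y); have [gY rg] := hg _ a1A.
  exists y1, (g a1); split=> //.
    rewrite inE gY andbT; apply/negP => g1.
    by have := in_set0 a1; rewrite -h inE a1A g1.
  by apply: (@reach_le _ _ (2 + 2)) => //; apply: reach_trans rg; apply: rs.
have sA1 : A1 \subset A by apply/subsetP => u; rewrite inE => /andP[].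
have := forallP lA A1; rewrite sA1 A10 A1A /= => /exists_inP[u uA1 /exists_inP[v /setDP[vA vn] uv]].
move: uA1; rewrite inE => /andP[uA gu].
have [gvY rv] := hg _ vA; have [_ ru] := hg _ uA.
exists (g u), (g v); split=> //.
  by rewrite inE gvY andbT; apply: contra vn => gv; rewrite inE vA.
apply: (@reach_trans _ _ 2 4 _ u); first exact: rs.
apply: (@reach_trans _ _ 2 2 _ v) => //.
by apply: coadjacent_reach => //; apply: (subsetP AV).
Qed.

End Adjacency.

(** * The code of a pair (A, B) and its size *)

Section LocalEncoding.
Variables (k : nat) (x : 'I_(2 * k + 1)).
Notation n := (2 * k + 1).
Notation V := (ksets n k).
Notation W := (V :\: star k x).
Implicit Types (A B T : {set {set 'I_n}}).

Definition neighbours T : {set {set 'I_n}} := \bigcup_(v in T) nbr v.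

Definition saturated B := [set v in W | k <= 2 * deg B v].

(* A pair (A, B) is recovered from five small sets: a sparse subset T of A and
   the corrections needed because B is only almost the part of the star adjacent
   to T, and A only almost the set of vertices with at least half of their
   neighbours in the star inside B. *)
Definition local_decode (S : 'I_5 -> {set {set 'I_n}}) :=
  let B := ((neighbours (S (inord 0)) :&: star k x) :\: S (inord 1)) :|: S (inord 2) in
  ((saturated B :\: S (inord 3)) :|: S (inord 4), B).

Definition local_code A B T (j : 'I_5) : {set {set 'I_n}} :=
  nth set0 [:: T; (neighbours T :&: star k x) :\: B; B :\: neighbours T;
               saturated B :\: A; A :\: saturated B] j.

Lemma setD_code (X Y : {set {set 'I_n}}) : (X :\: (X :\: Y)) :|: (Y :\: X) = Y.
Proof.
by apply/setP=> z; rewrite !inE; case: (z \in X); case: (z \in Y).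
Qed.

Lemma local_decodeK A B T : B \subset star k x -> local_decode (local_code A B T) = (A, B).
Proof.
move=> BS; rewrite /local_decode /local_code !inordK //=.
have -> : (neighbours T :&: star k x :\: (neighbours T :&: star k x :\: B)) :|: (B :\: neighbours T) = B.
  apply/setP=> z; rewrite !(in_setU, in_setD, in_setI).
  have := subsetP BS z; case: (z \in B); case: (z \in star k x); case: (z \in neighbours T) => //=.
  by move=> /(_ isT).
by rewrite setD_code.
Qed.

Variables (A B T : {set {set 'I_n}}).
Hypotheses (k0 : 0 < k) (AW : A \subset W) (BS : B \subset star k x) (TA : T \subset A).
Hypotheses (BN : B \subset neighbours A) (lA : two_linked A) (A0 : A != set0).
Let Y := \bigcup_j local_code A B T j.
Let AV : A \subset V. Proof. exact: subset_trans AW (subsetDl _ _). Qed.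
Let SV : star k x \subset V.
Proof. by apply/subsetP => S; rewrite !inE => /andP[]. Qed.
Let BV : B \subset V. Proof. exact: subset_trans BS SV. Qed.

Let in_Y S : S \in Y = [|| S \in T, S \in (neighbours T :&: star k x) :\: B, S \in B :\: neighbours T,
   S \in saturated B :\: A | S \in A :\: saturated B].
Proof.
apply/bigcupP/idP => [[[[|[|[|[|[|j]]]]] //= jP] _]|].
- by rewrite /local_code /= => ->.
- by rewrite /local_code /= => ->; rewrite !orbT.
- by rewrite /local_code /= => ->; rewrite !orbT.
- by rewrite /local_code /= => ->; rewrite !orbT.
- by rewrite /local_code /= => ->; rewrite !orbT.
move=> /or4P[h|h|h|/orP[h|h]].
- by exists (inord 0); rewrite ?/local_code ?inordK.
- by exists (inord 1); rewrite ?/local_code ?inordK.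
- by exists (inord 2); rewrite ?/local_code ?inordK.
- by exists (inord 3); rewrite ?/local_code ?inordK.
- by exists (inord 4); rewrite ?/local_code ?inordK.
Qed.

Lemma local_code_card : #|Y| <= #|T| + #|(neighbours T :&: star k x) :\: B| + #|B :\: neighbours T| +
   #|saturated B :\: A| + #|A :\: saturated B|.
Proof.
have -> : Y = T :|: ((neighbours T :&: star k x) :\: B) :|: (B :\: neighbours T) :|:
   (saturated B :\: A) :|: (A :\: saturated B).
  by apply/setP => S; rewrite in_Y !in_setU !orbA.
do 3!(apply: leq_trans (leq_of_leqif (leq_card_setU _ _)) _; rewrite leq_add2r).
exact: leq_of_leqif (leq_card_setU _ _).
Qed.

Let satN v : v \in saturated B -> exists2 u, u \in B & u \in nbr v.
Proof.
rewrite inE => /andP[_ hv]; have : 0 < deg B v.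
  by rewrite lt0n; apply: contraTneq hv => ->; rewrite muln0 -ltnNge.
by move/card_gt0P => [u /setIP[? ?]]; exists u.
Qed.

Let nbrV' v u : v \in V -> u \in nbr v -> reach (@lazy_adj k) 1 u v.
Proof. by move=> vV uv; apply: reach_sym; [apply: lazy_adj_sym|apply: nbr_reach]. Qed.

(** Every point of [A] is near the code: if unsaturated it belongs to the code; otherwise it has a
    neighbour in [B], which belongs to the code or is a neighbour of some [t] in [T]. Conversely,
    every part of the code lies within distance 2 of [A], so the connectivity of [A] is
    inherited. *)
Lemma local_code_linked : linked (@lazy_adj k) 6 Y /\ Y != set0.
Proof.
have near u : u \in A -> exists2 y, y \in Y & reach (@lazy_adj k) 2 u y.
  move=> uA; have uV := subsetP AV _ uA; have [us|us] := boolP (u \in saturated B); last first.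
    exists u; last by apply: (@reach_le _ _ 0) => //; apply: reach0.
    by rewrite in_Y !in_setD uA us !orbT.
  have [z zB zu] := satN us; have [zN|zN] := boolP (z \in neighbours T); last first.
    exists z; last by apply: (@reach_le _ _ 1) => //; apply: nbr_reach.
    by rewrite in_Y !in_setD zN zB !orbT.
  have /bigcupP[t tT zt] := zN; exists t; first by rewrite in_Y tT.
  apply: (@reach_trans _ _ 1 1 _ z); first exact: nbr_reach.
  by apply: nbrV' => //; rewrite (subsetP AV) // (subsetP TA).
have Y0 : Y != set0.
  by have [u uA] := set0Pn _ A0; have [y yY _] := near _ uA; apply/set0Pn; exists y.
split=> //; apply: (two_linked_reach AV lA Y0 near) => y; rewrite in_Y.
have inN (C : {set {set 'I_n}}) z : C \subset A -> z \in neighbours C -> exists2 u, u \in A & reach (@lazy_adj k) 1 u z.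
  move=> CA /bigcupP[u uC uz]; exists u; first exact: (subsetP CA).
  by apply: nbr_reach => //; rewrite (subsetP AV) // (subsetP CA).
have self u : u \in A -> exists2 v, v \in A & reach (@lazy_adj k) 2 v u.
  by move=> uA; exists u => //; apply: (@reach_le _ _ 0) => //; apply: reach0.
have le1 u z : reach (@lazy_adj k) 1 u z -> reach (@lazy_adj k) 2 u z by apply: reach_le.
case/or4P => [/(subsetP TA)/self //|/setDP[/setIP[+ _] _]|/setDP[yB _]|/orP[/setDP[ys _]|/setDP[/self //]]].
- by move=> /(inN _ _ TA)[u uA ru]; exists u => //; apply: le1.
- by have [u uA ru] := inN _ _ (subxx _) (subsetP BN _ yB); exists u => //; apply: le1.
have [z zB zy] := satN ys; have [u uA ru] := inN _ _ (subxx _) (subsetP BN _ zB).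
exists u => //; apply: (@reach_trans _ _ 1 1 _ z) => //; apply: nbrV' => //.
by move: ys; rewrite inE => /andP[/setDP[]].
Qed.

Hypothesis BA : #|B| <= #|A|.
Let E := \sum_(v in A) deg (star k x :\: B) v.

Let degAB : \sum_(v in A) deg B v + E = k * #|A|.
Proof.
rewrite /E -big_split /= [RHS]mulnC -[RHS]sum_nat_const; apply: eq_bigr => v vA.
by rewrite deg_star_setD // (subsetP AW).
Qed.

(** [A] sends [k * #|A| - E] edges into [B], whose vertices have [k.+1 * #|B|] edges in all. The
    extra [#|A|] arises because a vertex off the star has [k] neighbours in it, while a vertex of
    the star has [k + 1] off it. *)
Let missing : \sum_(u in B) (k.+1 - deg A u) <= #|A| + E.
Proof.
have h : \sum_(u in B) (k.+1 - deg A u) + \sum_(u in B) deg A u = k.+1 * #|B|.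
  rewrite -big_split /= [RHS]mulnC -[RHS]sum_nat_const; apply: eq_bigr => u uB.
  by rewrite subnK // -(card_nbr (subsetP BV _ uB)) subset_leq_card // subsetIl.
have := degAB; rewrite sum_deg_swap // => e2.
exact: missing_arith e2 BA h.
Qed.

(** A saturated vertex outside [A] absorbs at least [k / 2] of the edges that leave [B] and miss
    [A], which [missing] counts. The two bounds below charge [k / 2] edges per vertex likewise. *)
Lemma card_new_saturated : k * #|saturated B :\: A| <= 2 * (#|A| + E).
Proof.
apply: (@leq_trans (2 * \sum_(v in saturated B :\: A) deg B v)).
  by apply: leq_card_sum => v /setDP[]; rewrite inE => /andP[].
rewrite leq_mul2l /=; apply: leq_trans missing.
rewrite sum_deg_swap //; last by apply/subsetP => v /setDP[]; rewrite inE => /andP[/setDP[]].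
apply: leq_sum => u uB; rewrite leq_subRL; last first.
  by rewrite -(card_nbr (subsetP BV _ uB)) subset_leq_card // subsetIl.
rewrite -(card_nbr (subsetP BV _ uB)) /deg -cardsUI -setIUr.
have -> : nbr u :&: A :&: (nbr u :&: (saturated B :\: A)) = set0.
  by apply/setP => z; rewrite !inE; case: (z \in A); rewrite ?andbF //= ?andbF.
by rewrite cards0 addn0 subset_leq_card // subsetIl.
Qed.

Lemma card_unsaturated : k * #|A :\: saturated B| <= 2 * E.
Proof.
apply: (@leq_trans (2 * \sum_(v in A :\: saturated B) deg (star k x :\: B) v)).
  apply: leq_card_sum => v /setDP[vA]; have vW := subsetP AW _ vA.
  by rewrite inE vW /= -ltnNge; apply: half_arith; apply: deg_star_setD.
rewrite leq_mul2l /= /E [leqRHS](big_setID (A :\: saturated B)) /= (setIidPr (subsetDl _ _)).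
exact: leq_addr.
Qed.

Definition well_covered := [set u in B | k <= 2 * deg A u].

Lemma card_poorly_covered : k * #|B :\: well_covered| <= 2 * (#|A| + E).
Proof.
apply: (@leq_trans (2 * \sum_(u in B :\: well_covered) (k.+1 - deg A u))).
  by apply: leq_card_sum => u /setDP[uB]; rewrite inE uB /= -ltnNge; apply: half_arith'.
rewrite leq_mul2l /=; apply: leq_trans missing.
rewrite [leqRHS](big_setID (B :\: well_covered)) /= (setIidPr (subsetDl _ _)).
exact: leq_addr.
Qed.
End LocalEncoding.

(* If A is large compared with k, a sparse subset T of A has almost the same
   neighbourhood in the star as A; if A is small, T = set0 is enough. *)
Lemma local_code_exists k (x : 'I_(2 * k + 1)) (A B : {set {set 'I_(2 * k + 1)}}) r :
  400 <= k -> 0 < r -> r * r <= k ->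
  A \subset ksets (2 * k + 1) k :\: star k x -> B \subset star k x ->
  #|B| <= #|A| -> 1 < #|A| -> 8 * #|A| <= 3 * star_size k ->
  3 * k <= 2 * \sum_(v in A) deg (star k x :\: B) v /\
  exists2 T : {set {set 'I_(2 * k + 1)}}, T \subset A &
    r * #|\bigcup_j local_code x A B T j| <= 72 * \sum_(v in A) deg (star k x :\: B) v.
Proof.
move=> k400 r0 rk AW BS BA A1 A38; set E := \sum_(v in A) _.
have rk' : r <= k by apply: leq_trans rk; rewrite leq_pmull.
have h3 := card_new_saturated AW BS BA; rewrite -/E in h3.
have h4 := card_unsaturated AW BS; rewrite -/E in h4.
(* Below [24 * k] the codegree estimate gives [4 * E >= 3 * k * #|A| >= 6 * k]; from [24 * k] on,
   [E >= #|A| / 8 >= 3 * k]. *)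
have [Asmall|Alarge] := ltnP #|A| (24 * k).
  have hE := small_isoperimetry k400 AW BS BA Asmall; rewrite -/E in hE.
  have h5 : 3 * k * 2 <= 3 * k * #|A| by rewrite leq_mul2l A1 orbT.
  split; first by move: (leq_trans h5 hE); clear; lia.
  exists set0; first exact: sub0set.
  have N0 : neighbours (set0 : {set {set 'I_(2 * k + 1)}}) = set0 by rewrite /neighbours big_set0.
  apply: leq_trans (leq_mul (leqnn r) (local_code_card x A B set0)) _.
  rewrite N0 set0I set0D setD0 !cards0.
  exact: small_code_arith k400 rk' BA hE h3 h4.
have k1 : 1 < k by apply: leq_trans k400.
have hE := isoperimetry k1 AW BS BA A38; rewrite -/E in hE.
split; first by move: (leq_trans Alarge hE); clear; lia.
have h5 := card_poorly_covered AW BS BA; rewrite -/E in h5.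
have AV : A \subset ksets (2 * k + 1) k by apply: subset_trans AW (subsetDl _ _).
have BV : B \subset ksets (2 * k + 1) k.
  by apply: subset_trans BS _; apply/subsetP => S; rewrite !inE => /andP[].
have [||T [TA cT hT]] := @sparse_cover _ _ A (@nbr k) (deg (star k x :\: B)) (well_covered A B) k r r0 rk.
- by apply: leq_trans Alarge; apply: leq_pmull.
- move=> u; rewrite inE => /andP[uB]; rewrite /deg; congr (_ <= 2 * _).
  apply: eq_card => v; rewrite !in_setI inE andbC; have [vA|//] := boolP (v \in A).
  by rewrite (nbr_sym (subsetP BV u uB) (subsetP AV v vA)).
exists T => //; apply: leq_trans (leq_mul (leqnn r) (local_code_card x A B T)) _.
rewrite -/E in hT.
have c1 : #|(neighbours T :&: star k x) :\: B| <= \sum_(v in T) deg (star k x :\: B) v.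
  have -> : (neighbours T :&: star k x) :\: B = \bigcup_(v in T) (nbr v :&: (star k x :\: B)).
    by rewrite /neighbours -setIDA -big_distrl.
  by rewrite /deg; elim/big_rec2: _ => [|v m X vT h]; rewrite ?cards0 //; apply: leq_trans (leq_of_leqif (leq_card_setU _ _)) _; rewrite leq_add2l.
have c2 : #|B :\: neighbours T| <= #|well_covered A B :\: neighbours T| + #|B :\: well_covered A B|.
  apply: leq_trans (leq_of_leqif (leq_card_setU _ _)); apply: subset_leq_card; apply/subsetP => u.
  by rewrite !in_setU !in_setD => /andP[-> ->]; rewrite andbT; case: (u \in _).
have c3 : #|well_covered A B| <= #|A|.
  by apply: leq_trans BA; apply: subset_leq_card; apply/subsetP => u; rewrite inE => /andP[].
exact: (large_code_arith rk' c3 hE cT hT c1 h3 h4 c2 h5).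
Qed.

(** The local obstructions other than near-stars: [p.1] stands for a minimal violating set of at
    least two vertices, [p.2] for its random-graph neighbours in the star. Only consequences of
    minimality that do not mention the random graph are kept, so that a union bound can run over
    these pairs. *)
Definition bad_pairs k (x : 'I_(2 * k + 1)) : {set {set {set 'I_(2 * k + 1)}} * {set {set 'I_(2 * k + 1)}}} :=
  [set p : {set {set 'I_(2 * k + 1)}} * {set {set 'I_(2 * k + 1)}} | [&& p.1 \subset ksets (2 * k + 1) k :\: star k x, p.2 \subset star k x, 1 < #|p.1|,
    #|p.2| <= #|p.1|, 8 * #|p.1| <= 3 * star_size k, p.2 \subset neighbours p.1 & two_linked p.1]].

(** The number of Kneser edges that must all be absent if [p.2] contains every random-graph
    neighbour of [p.1] in the star. *)
Definition pair_defect k (x : 'I_(2 * k + 1)) (p : {set {set 'I_(2 * k + 1)}} * {set {set 'I_(2 * k + 1)}}) :=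
  \sum_(v in p.1) deg (star k x :\: p.2) v.

Lemma pair_defect_ge k (x : 'I_(2 * k + 1)) p : 400 <= k -> p \in bad_pairs x -> 3 * k <= 2 * pair_defect x p.
Proof.
move=> k400; rewrite inE => /and5P[AW BS A1 BA /and3P[A38 BN lA]].
have k0 : 1 * 1 <= k by apply: leq_trans k400.
by have [] := local_code_exists k400 (ltn0Sn 0) k0 AW BS BA A1 A38.
Qed.

(** [2 ^ (2 * k + 1)] bounds the starting points of a walk, [2 ^ 5] the marks for the five sets of
    the code, and 6 is the linking distance. The starting points are paid for by the lower bound
    [pair_defect_ge]. *)
Lemma card_bad_pairs k (x : 'I_(2 * k + 1)) r E : 400 <= k -> 0 < r -> r * r <= k ->
  #|[set p in bad_pairs x | pair_defect x p == E]| <=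
  2 ^ (2 * k + 1) * ((k + 2) * 2 ^ 5) ^ (2 * 6 * (72 * E %/ r)).
Proof.
move=> k400 r0 rk.
have c2 : #|{set 'I_(2 * k + 1)}| = 2 ^ (2 * k + 1).
  by rewrite -cardsT -powersetT card_powerset cardsT card_ord.
rewrite -c2; apply: (count_linked (@lazy_adj_refl k) (@lazy_adj_sym k) (@lazy_adj_deg k) (dec := @local_decode k x)) => //.
  by move=> S S' eS; rewrite /local_decode !eS.
move=> [A B]; rewrite !inE /= => /andP[/and5P[AW BS A1 BA /and3P[A38 BN lA]] /eqP dE].
have [_ [T TA hT]] := local_code_exists k400 r0 rk AW BS BA A1 A38.
have A0 : A != set0 by rewrite -card_gt0 ltnW.
have k0 : 0 < k by apply: leq_trans k400.
have [lY Y0] := local_code_linked k0 AW TA BN lA A0.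
exists (local_code x A B T); split=> //; first exact: local_decodeK.
by rewrite leq_divRL // mulnC; apply: leq_trans hT _; rewrite -dE.
Qed.

(** * Counting families far from stars *)

Lemma sum_subsets_exp (T : finType) (V : {set T}) k :
  \sum_(X : {set T} | X \subset V) k ^ (#|V| - #|X|) = k.+1 ^ #|V|.
Proof.
rewrite -[k.+1]addn1 expnDn.
have h (X : {set T}) : X \subset V -> #|X| < #|V|.+1 by move=> /subset_leq_card.
rewrite (partition_big (fun X : {set T} => inord #|X| : 'I_#|V|.+1) predT) //=.
apply: eq_bigr => i _; rewrite exp1n muln1.
transitivity (\sum_(X in [set X : {set T} | X \subset V & #|X| == i]) k ^ (#|V| - i)).
  apply: eq_big => [X|X /andP[XV /eqP <-]]; last by rewrite inordK ?h.
  rewrite inE; have [XV|//] := boolP (X \subset V).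
  by rewrite -val_eqE /= inordK ?h.
by rewrite sum_nat_const cards_draws.
Qed.

(** Each small [X] gets the weight [k ^ (y - #|X|) >= 1], and the binomial theorem sums such weights
    over all subsets. Without denominators cleared: at most [k^y * (1 + 1/k)^#|V|] small subsets. *)
Lemma card_small_subsets (T : finType) (V : {set T}) k y : 0 < k ->
  #|[set X : {set T} | X \subset V & #|X| <= y]| * k ^ #|V| <= k ^ y * k.+1 ^ #|V|.
Proof.
move=> k0; rewrite -sum_subsets_exp -sum_nat_const big_distrr /=.
rewrite [leqRHS](bigID (fun X : {set T} => #|X| <= y)) /=; apply: leq_trans (leq_addr _ _).
rewrite (eq_bigl (fun X : {set T} => (X \subset V) && (#|X| <= y))); last by move=> X; rewrite inE.
apply: leq_sum => X /andP[XV Xy]; rewrite -expnD leq_pexp2l //.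
by have := subset_leq_card XV; lia.
Qed.

(** The bound on [u] is the worst one: [r * u <= 8 * M + 4 * w < 132 * w <= 264 * e]. *)
Fact global_arith M w e r k t c x1 x2 u q l : 0 < r -> r <= k -> r * t <= 2 * M -> r * (c + x2) <= 2 * l + 2 * w ->
  l <= 2 * M -> x1 <= x2 -> u <= c + q -> k * q <= 4 * M + 2 * w -> M < 16 * w -> w <= 2 * e ->
  [/\ t <= 264 * e %/ r, x1 <= 264 * e %/ r & u <= 264 * e %/ r].
Proof.
move=> r0 rk ht hc hl hx hu hq hM hw; rewrite mulnDr in hc.
have h1 : r * x1 <= r * x2 by apply: leq_mul.
have h9 : r * q <= k * q by apply: leq_mul.
have h10 : r * u <= r * c + r * q by rewrite -mulnDr leq_mul2l hu orbT.
by split; rewrite leq_divRL // mulnC; lia.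
Qed.

Fact poorly_arith k M N w s : k * N = (2 * k + 1) * M -> 0 < k ->
  s + (k.+1 * M - w) = k.+1 * (N - M) -> w <= k.+1 * M -> s <= 2 * M + w /\ N - M <= 2 * M.
Proof.
move=> h k0 hs hw.
have h1 : k * (N - M) = k.+1 * M by rewrite mulnBr h; lia.
have h2 : k * (N - M) <= k * (2 * M) by rewrite h1 mulnA leq_mul2r; apply/orP; right; lia.
have h3 : N - M <= 2 * M by move: h2; rewrite leq_pmul2l.
split=> //.
have h4 : k.+1 * (N - M) <= k.+1 * M + 2 * M by rewrite mulSn h1; lia.
by lia.
Qed.

Section Global.
Variable k : nat.
Notation n := (2 * k + 1).
Notation V := (ksets n k).
Implicit Types (F T : {set {set 'I_n}}).

Definition internal_edges F := [set e in kneser_edges n k | e \subset F].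

Lemma sum_deg_le_edges F : F \subset V -> 0 < k -> \sum_(S in F) deg F S <= 2 * #|internal_edges F|.
Proof.
move=> FV k0.
pose P := [set p : {set 'I_n} * {set 'I_n} | (p.1 \in F) && (p.2 \in nbr p.1 :&: F)].
have -> : \sum_(S in F) deg F S = #|P|.
  rewrite /deg -sum1_card (eq_bigl (fun p => (p.1 \in F) && (p.2 \in nbr p.1 :&: F))); last first.
    by move=> p; rewrite inE.
  rewrite -(pair_big_dep (fun S => S \in F) (fun S S' => S' \in nbr S :&: F) (fun _ _ => 1)) /=.
  by apply: eq_bigr => S _; rewrite sum1_card.
rewrite -sum1_card (partition_big (fun p => [set p.1; p.2]) (mem (internal_edges F))) /=.
  rewrite [leqRHS]mulnC -[leqRHS]sum_nat_const; apply: leq_sum => e; rewrite inE => /andP[+ _].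
  rewrite inE => /existsP[a /andP[aV /existsP[b /and3P[bV dab /eqP ->]]]].
  have nab : a != b.
    apply: contraTneq dab => <-; rewrite -setI_eq0 setIid -card_gt0.
    by move: aV; rewrite inE => /eqP ->.
  rewrite sum1dep_card; apply: (@leq_trans #|[set (a, b); (b, a)]|); last by rewrite cards2; case: eqP.
  apply: subset_leq_card; apply/subsetP => [[p q]]; rewrite !inE /= => /andP[/and3P[pF /andP[qV dpq] qF] /eqP e2].
  have npq : p != q.
    apply: contraTneq dpq => <-; rewrite -setI_eq0 setIid -card_gt0.
    by have := subsetP FV _ pF; rewrite inE => /eqP ->.
  have : p \in [set a; b] by rewrite -e2 !inE eqxx.
  have : q \in [set a; b] by rewrite -e2 !inE eqxx orbT.
  rewrite !inE => /orP[/eqP eq|/eqP eq] /orP[/eqP ep|/eqP ep]; rewrite eq ep ?eqxx ?orbT //;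
    by rewrite eq ep eqxx in npq.
move=> [p q]; rewrite inE /= => /andP[pF /setIP[pq qF]].
rewrite inE subUset !sub1set pF qF inE !andbT; apply/existsP; exists p; rewrite (subsetP FV) //=.
move: pq; rewrite inE => /andP[qV dpq].
by apply/existsP; exists q; rewrite qV dpq eqxx.
Qed.

(** The families of star size to which [stability] does not apply. *)
Definition bad_families := [set F : {set {set 'I_n}} | [&& F \subset V, #|F| == star_size k &
  star_size k < 16 * \sum_(S in F) deg F S]].

Lemma bad_family_edges F : 0 < k -> F \in bad_families -> star_size k < 32 * #|internal_edges F|.
Proof.
move=> k0; rewrite inE => /and3P[FV _ h]; apply: leq_trans h _.
by rewrite -[32]/(16 * 2) -mulnA leq_mul2l sum_deg_le_edges.
Qed.

Lemma card_bad_families r e : 0 < r -> r * r <= k -> 0 < k ->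
  #|[set F in bad_families | #|internal_edges F| == e]| * (k ^ #|V|) ^ 3 <=
  (k ^ (264 * e %/ r) * k.+1 ^ #|V|) ^ 3.
Proof.
move=> r0 rk k0; pose y := 264 * e %/ r.
pose small := [set X : {set {set 'I_n}} | X \subset V & #|X| <= y].
apply: (@leq_trans ((#|small| * k ^ #|V|) ^ 3)); last by rewrite leq_exp2r // card_small_subsets.
rewrite expnMn leq_mul2r; apply/orP; right.
pose decode (p : {set {set 'I_n}} * {set {set 'I_n}} * {set {set 'I_n}}) :=
  V :\: ((neighbours p.1.1 :\: p.1.2) :|: p.2).
apply: (@leq_trans #|decode @: setX (setX small small) small|); last first.
  by apply: leq_trans (leq_imset_card _ _) _; rewrite !cardsX !expnS expn0 muln1 mulnA.
apply: subset_leq_card; apply/subsetP => F; rewrite 2!inE => /andP[/and3P[FV /eqP cF hM] /eqP eF].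
set w := \sum_(S in F) deg F S in hM.
have we : w <= 2 * e by rewrite -eF sum_deg_le_edges.
have rk' : r <= k by apply: leq_trans rk; rewrite leq_pmull.
pose U := [set u in V :\: F | k <= 2 * deg F u].
have kF : k <= #|F|.
  rewrite cF /star_size; case: (k) k0 => [//|j] _ /=.
  apply: leq_trans (leq_bin2l j (_ : j.+1 <= 2 * j.+1)); last by lia.
  by rewrite binSn.
have [|T [TF cT hT]] := @sparse_cover _ _ F (@nbr k) (deg F) U k r r0 rk kF.
  move=> u; rewrite 2!inE => /andP[/andP[_ uV]]; rewrite /deg; congr (_ <= 2 * _).
  apply: eq_card => v; rewrite !in_setI inE andbC; have [vF|//] := boolP (v \in F).
  by rewrite (nbr_sym uV (subsetP FV v vF)).
rewrite -/w cF in cT hT.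
have NV X : neighbours X \subset V.
  by apply/subsetP => u /bigcupP[v _]; apply: nbrV.
pose X1 := neighbours T :&: F; pose X2 := (V :\: F) :\: neighbours T.
have c1 : #|X1| <= \sum_(v in T) deg F v.
  have -> : X1 = \bigcup_(v in T) (nbr v :&: F) by rewrite /X1 /neighbours -big_distrl.
  rewrite /deg; elim/big_rec2: _ => [|v m X vT h]; rewrite ?cards0 //.
  by apply: leq_trans (leq_of_leqif (leq_card_setU _ _)) _; rewrite leq_add2l.
have c2 : #|X2| <= #|U :\: neighbours T| + #|(V :\: F) :\: U|.
  apply: leq_trans (leq_of_leqif (leq_card_setU _ _)); apply: subset_leq_card; apply/subsetP => u.
  rewrite !(in_setU, in_setD) => /and3P[-> -> ->] /=; by case: (u \in U).
have UV : #|U| <= #|V :\: F| by apply: subset_leq_card; apply/subsetP => u; rewrite inE => /andP[].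
(* The total shortfall of the degrees into [F] from outside. Counting the edges at [F] bounds it by
   [2 * star_size k + w], so few vertices have less than half of their neighbours in [F]. *)
pose s := \sum_(u in V :\: F) (k.+1 - deg F u).
have degle u : u \in V -> deg F u <= k.+1.
  by move=> uV; rewrite -(card_nbr uV) subset_leq_card // subsetIl.
have sumdeg : \sum_(u in V) deg F u = k.+1 * #|F|.
  rewrite -sum_deg_swap // [RHS]mulnC -[RHS]sum_nat_const; apply: eq_bigr => v vF.
  by rewrite /deg (setIidPl _) ?card_nbr ?(subsetP FV) //; apply/subsetP => u; apply: nbrV.
have sumF : w + \sum_(u in V :\: F) deg F u = k.+1 * #|F|.
  by rewrite -sumdeg [RHS](big_setID F) /= (setIidPr FV).
have hs : s + (k.+1 * #|F| - w) = k.+1 * (#|V| - #|F|).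
  have cVF : #|V :\: F| = #|V| - #|F| by rewrite cardsD (setIidPr FV).
  rewrite -sumF addKn /s -big_split /= -cVF [RHS]mulnC -[RHS]sum_nat_const.
  by apply: eq_bigr => u /setDP[uV _]; rewrite subnK // degle.
have wle : w <= k.+1 * #|F| by rewrite -sumF leq_addr.
rewrite cF in hs wle; have [s_le VF_le] := poorly_arith (bin_ksets k0) k0 hs wle.
have hq : k * #|(V :\: F) :\: U| <= 4 * star_size k + 2 * w.
  apply: (@leq_trans (2 * \sum_(u in (V :\: F) :\: U) (k.+1 - deg F u))).
    apply: leq_card_sum => u /setDP[uVF]; rewrite inE uVF /= -ltnNge; exact: half_arith'.
  rewrite (_ : 4 * _ + _ = 2 * (2 * star_size k + w)); last by rewrite mulnDr mulnA.
  rewrite leq_mul2l /=; apply: leq_trans s_le.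
  rewrite /s [leqRHS](big_setID ((V :\: F) :\: U)) /= (setIidPr (subsetDl _ _)).
  exact: leq_addr.
have lU : #|U| <= 2 * star_size k.
  by apply: leq_trans UV _; rewrite cardsD (setIidPr FV) cF.
have [h1 h2 h3] := global_arith r0 rk' cT hT lU c1 c2 hq hM we.
apply/imsetP; exists (T, X1, X2).
  rewrite !inE /= h1 h2 h3 (subset_trans TF FV) !andbT; apply/andP; split.
    by apply: subset_trans (subsetIl _ _) (NV _).
  by apply: subset_trans (subsetDl _ _) (subsetDl _ _).
apply/setP => u; rewrite /decode /X1 /X2 !(in_setU, in_setD, in_setI) /=.
have := subsetP FV u; have := subsetP (NV T) u.
case: (u \in neighbours T); case: (u \in F); case: (u \in V) => //=; by [move=> /(_ isT)|move=> _ /(_ isT)].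
Qed.
End Global.

(** * Random labellings *)

Lemma ffact_ratio_le a m s : a <= m -> a ^_ s * m ^ s <= a ^ s * m ^_ s.
Proof.
move=> am; elim: s => [|s IH]; first by rewrite !ffactn0 !expn0.
rewrite !ffactnSr !expnSr.
have h : (a - s) * m <= a * (m - s) by rewrite mulnBl mulnBr; apply: leq_sub2l; nia.
have -> : a ^_ s * (a - s) * (m ^ s * m) = a ^_ s * m ^ s * ((a - s) * m) by ring.
have -> : a ^ s * a * (m ^_ s * (m - s)) = a ^ s * m ^_ s * (a * (m - s)) by ring.
exact: leq_mul.
Qed.

Lemma ffact_add a d s : a ^_ (d + s) = a ^_ d * (a - d) ^_ s.
Proof.
elim: s => [|s IH]; first by rewrite addn0 ffactn0 muln1.
by rewrite addnS !ffactnSr IH mulnA subnDA.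
Qed.

(** Factor by factor, [(a - d - j) * (m - j) <= (a - j) * (m - d - j)]. This is the negative
    correlation of two disjoint edge sets under sampling without replacement. *)
Lemma ffact_neg_corr a m d : a <= m ->
  a ^_ (d + d) * (m ^_ d * m ^_ d) <= a ^_ d * a ^_ d * m ^_ (d + d).
Proof.
move=> am; rewrite !ffact_add.
suff h : (a - d) ^_ d * m ^_ d <= a ^_ d * (m - d) ^_ d.
  have -> : a ^_ d * (a - d) ^_ d * (m ^_ d * m ^_ d) = a ^_ d * m ^_ d * ((a - d) ^_ d * m ^_ d) by ring.
  have -> : a ^_ d * a ^_ d * (m ^_ d * (m - d) ^_ d) = a ^_ d * m ^_ d * (a ^_ d * (m - d) ^_ d) by ring.
  exact: leq_mul.
rewrite !ffact_prod -!big_split /=; apply: leq_prod => j _.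
have [h|h] := leqP (a - d) j; first by rewrite (eqP (_ : a - d - j == 0)) // subn_eq0.
nia.
Qed.

Lemma ffact_ratio_ge a m d p q : p * m + q * d <= q * a -> p ^ d * m ^_ d <= q ^ d * a ^_ d.
Proof.
move=> h; rewrite !ffact_prod -[d in p ^ d]card_ord -[d in q ^ d]card_ord -!prod_nat_const -!big_split /=.
apply: leq_prod => j _; have jd := ltn_ord j.
have : q * j <= q * d by rewrite leq_mul2l ltnW ?orbT.
rewrite !mulnBr => h2; have : p * (m - j) <= p * m by rewrite leq_mul2l leq_subr orbT.
rewrite mulnBr; lia.
Qed.

Section Labellings.
Variables (E : finType) (m i0 : nat).
Hypotheses (cE : #|E| = m) (i0m : i0 <= m).
Implicit Types (pi : {ffun E -> 'I_m}) (S : {set E}).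

Definition labellings := [set pi : {ffun E -> 'I_m} | injectiveb pi].
Definition late S := [set pi in labellings | [forall e in S, i0 <= pi e]].

Lemma card_labellings_gt0 : 0 < #|labellings|.
Proof.
by rewrite /labellings card_inj_ffuns card_ord cE ffactnn fact_gt0.
Qed.

Lemma late_tperm S e e' : e \notin S -> e' \notin S -> #|late (e |: S)| <= #|late (e' |: S)|.
Proof.
move=> eS e'S; pose g pi : {ffun E -> 'I_m} := [ffun z => pi (tperm e e' z)].
have gK : involutive g by move=> pi; apply/ffunP => z; rewrite !ffunE tpermK.
rewrite -(card_imset _ (inv_inj gK)); apply: subset_leq_card; apply/subsetP => pi /imsetP[pi0 + ->].
rewrite !inE => /andP[/injectiveP ipi /forall_inP hpi]; apply/andP; split.
  by apply/injectiveP => a b; rewrite !ffunE => /ipi /perm_inj.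
apply/forall_inP => z; rewrite ffunE => /setU1P[->|zS].
  by rewrite tpermR; apply: hpi; rewrite setU11.
rewrite tpermD; first by apply: hpi; rewrite setU1r.
  by apply: contraNneq eS => ->.
by apply: contraNneq e'S => ->.
Qed.

(** By the transpositions of [late_tperm], all [e'] outside [S] give the same count. Summing over
    them counts, for each labelling in [late S], the [m - i0 - #|S|] remaining late edges. *)
Lemma late_step S e : e \notin S ->
  #|late (e |: S)| * (m - #|S|) = #|late S| * (m - i0 - #|S|).
Proof.
move=> eS; transitivity (\sum_(e' in ~: S) #|late (e' |: S)|).
  have -> : m - #|S| = #|~: S| by rewrite -cE -(cardsC S) addKn.
  rewrite [LHS]mulnC -[LHS]sum_nat_const; apply: eq_bigr => e'; rewrite inE => e'S.
  by apply/eqP; rewrite eqn_leq !late_tperm.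
transitivity (\sum_(e' in ~: S) \sum_(pi in late S) (i0 <= pi e')).
  apply: eq_bigr => e'; rewrite inE => e'S; rewrite -sum1_card [LHS]big_mkcond [RHS]big_mkcond.
  apply: eq_bigr => pi _; rewrite !inE.
  case: (injectiveb pi) => //=; case: forall_inP => [h|h].
    rewrite (introT forall_inP) ?h ?setU11 //; by move=> z zS; apply: h; rewrite setU1r.
  case: forall_inP => [h2|//]; case: (boolP (i0 <= pi e')) => // h3; case: h => z /setU1P[->|/h2] //.
rewrite exchange_big /= -[RHS]sum_nat_const; apply: eq_bigr => pi; rewrite !inE => /andP[/injectiveP ipi /forall_inP hpi].
pose D := [set z | i0 <= pi z].
have SD : S \subset D by apply/subsetP => z /hpi; rewrite inE.
have cD : #|D| = m - i0.
  have bij : bijective pi by apply: inj_card_bij => //; rewrite card_ord cE.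
  have -> : D = pi @^-1: [set i : 'I_m | i0 <= i] by apply/setP => z; rewrite !inE.
  rewrite on_card_preimset; last exact: onW_bij.
  rewrite -sum1dep_card -(big_geq_mkord i0 m predT (fun=> 1)) /=.
  by rewrite sum_nat_const_nat muln1.
have <- : #|D :\: S| = m - i0 - #|S| by rewrite cardsD (setIidPr SD) cD.
rewrite -sum1_card [LHS]big_mkcond [RHS]big_mkcond; apply: eq_bigr => z _.
by rewrite !inE; case: (z \in S); case: (i0 <= pi z).
Qed.

Lemma card_late S : #|late S| * m ^_ #|S| = #|labellings| * (m - i0) ^_ #|S|.
Proof.
have [s] := ubnP #|S|; elim: s S => // s IH S; rewrite ltnS => Ss.
have [->|/set0Pn[e eS]] := eqVneq S set0.
  rewrite cards0 !ffactn0; congr (#|pred_of_set _| * _); apply/setP => pi.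
  rewrite inE; case: (pi \in labellings) => //=.
  by apply/forall_inP => e; rewrite inE.
have cS : #|S| = #|S :\ e|.+1 by rewrite (cardsD1 e) eS.
have := late_step (_ : e \notin S :\ e); rewrite setD1K // => /(_ (negbT (setD11 _ _))) h.
have := IH (S :\ e) (ltac:(lia)) => h2.
rewrite cS !ffactnSr.
have -> : #|late S| * (m ^_ #|S :\ e| * (m - #|S :\ e|)) = #|late S| * (m - #|S :\ e|) * m ^_ #|S :\ e| by ring.
rewrite h.
have -> : #|late (S :\ e)| * (m - i0 - #|S :\ e|) * m ^_ #|S :\ e| = #|late (S :\ e)| * m ^_ #|S :\ e| * (m - i0 - #|S :\ e|) by ring.
by rewrite h2 mulnA.
Qed.

Lemma late_le S : 3 * (m - i0) <= m -> #|late S| * 3 ^ #|S| <= #|labellings|.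
Proof.
move=> h; have Sm : #|S| <= m by rewrite -cE max_card.
have f0 : 0 < m ^_ #|S| by rewrite ffact_gt0.
rewrite -(leq_pmul2r f0) mulnAC card_late -mulnA leq_mul2l; apply/orP; right.
have [m0|m0] := posnP m.
  by have -> : #|S| = 0; [lia|rewrite !ffactn0 expn0].
have p0 : 0 < m ^ #|S| by rewrite expn_gt0 m0.
rewrite -(leq_pmul2r p0).
have h2 := ffact_ratio_le #|S| (leq_subr i0 m).
apply: (@leq_trans ((m - i0) ^ #|S| * m ^_ #|S| * 3 ^ #|S|)).
  by rewrite mulnAC leq_mul2r h2 orbT.
have -> : (m - i0) ^ #|S| * m ^_ #|S| * 3 ^ #|S| = m ^_ #|S| * (3 * (m - i0)) ^ #|S| by rewrite expnMn; ring.
by rewrite leq_mul2l; case: #|S| => [|j]; rewrite ?expn0 ?orbT // leq_exp2r // h orbT.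
Qed.

(* Second moment method: the events [late (S z)] are negatively correlated. *)
Lemma second_moment (Z : finType) (P : {set Z}) (S : Z -> {set E}) d L : 0 < m ->
  (forall z, z \in P -> #|S z| = d) -> {in P &, forall z z', z != z' -> [disjoint S z & S z']} ->
  (forall z, z \in P -> #|late (S z)| = L) ->
  #|[set pi in labellings | [forall z in P, pi \notin late (S z)]]| * (#|P| * L) <= #|labellings| ^ 2.
Proof.
move=> m0 cS dS cL; set B := #|labellings|; set bad := [set pi in _ | _].
have [PL0|PL0] := posnP (#|P| * L); first by rewrite PL0 muln0.
have [z0 z0P] : exists z, z \in P by apply/card_gt0P; move: PL0; rewrite muln_gt0 => /andP[].
have L0 : 0 < L by move: PL0; rewrite muln_gt0 => /andP[].
have dm : d <= m by rewrite -(cS _ z0P) -cE max_card.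
have eL : L * m ^_ d = B * (m - i0) ^_ d by rewrite -(cS _ z0P) -(cL _ z0P) card_late.
have two z z' : z \in P -> z' \in P -> z != z' -> #|late (S z) :&: late (S z')| * B <= L * L.
  move=> zP z'P ne; have dd := dS _ _ zP z'P ne.
  have -> : late (S z) :&: late (S z') = late (S z :|: S z').
    apply/setP => pi; rewrite !inE; case: (injectiveb pi) => //=.
    apply/andP/forall_inP => [[/forall_inP h1 /forall_inP h2] e /setUP[/h1|/h2]//|h].
    by split; apply/forall_inP => e eS; apply: h; rewrite inE eS ?orbT.
  have cSS : #|S z :|: S z'| = d + d by rewrite cardsU (disjoint_setI0 dd) cards0 subn0 !cS.
  have ddm : d + d <= m by rewrite -cSS -cE max_card.
  have e2 := card_late (S z :|: S z'); rewrite cSS in e2.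
  have p0 : 0 < m ^_ (d + d) * (m ^_ d * m ^_ d) by rewrite !muln_gt0 !ffact_gt0 ddm dm.
  rewrite -(leq_pmul2r p0).
  have -> : #|late (S z :|: S z')| * B * (m ^_ (d + d) * (m ^_ d * m ^_ d)) =
    (B * B) * ((m - i0) ^_ (d + d) * (m ^_ d * m ^_ d)).
    have -> : #|late (S z :|: S z')| * B * (m ^_ (d + d) * (m ^_ d * m ^_ d)) =
      (#|late (S z :|: S z')| * m ^_ (d + d)) * B * (m ^_ d * m ^_ d) by ring.
    by rewrite e2 -/B; ring.
  have -> : L * L * (m ^_ (d + d) * (m ^_ d * m ^_ d)) = (L * m ^_ d) * (L * m ^_ d) * m ^_ (d + d) by ring.
  rewrite eL; have -> : B * (m - i0) ^_ d * (B * (m - i0) ^_ d) * m ^_ (d + d) =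
    (B * B) * ((m - i0) ^_ d * (m - i0) ^_ d * m ^_ (d + d)) by ring.
  by rewrite leq_mul2l ffact_neg_corr ?orbT // leq_subr.
pose X pi := \sum_(z in P) (pi \in late (S z)).
have latesub z : late (S z) \subset labellings by apply/subsetP => pi; rewrite inE => /andP[].
have sumlate (D : {set {ffun E -> 'I_m}}) : D \subset labellings -> \sum_(pi in labellings) (pi \in D) = #|D|.
  move=> DB; rewrite -sum1_card [LHS]big_mkcond [RHS]big_mkcond; apply: eq_bigr => pi _.
  by have := subsetP DB pi; case: (pi \in D) => [->|_] //; case: ifP.
have EX : \sum_(pi in labellings) X pi = #|P| * L.
  rewrite exchange_big /= -sum_nat_const; apply: eq_bigr => z zP.
  by rewrite sumlate ?cL.
have EX2 : (\sum_(pi in labellings) X pi * X pi) * B <= #|P| * L * B + (#|P| * L) ^ 2.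
  have -> : \sum_(pi in labellings) X pi * X pi =
     \sum_(z in P) \sum_(z' in P) #|late (S z) :&: late (S z')|.
    transitivity (\sum_(pi in labellings) \sum_(z in P) \sum_(z' in P) (pi \in late (S z) :&: late (S z'))).
      apply: eq_bigr => pi _; rewrite /X big_distrl /=; apply: eq_bigr => z _.
      by rewrite big_distrr /=; apply: eq_bigr => z' _; rewrite in_setI; case: (pi \in late (S z)); rewrite ?mul1n.
    rewrite exchange_big; apply: eq_bigr => z _; rewrite exchange_big; apply: eq_bigr => z' _ /=.
    by rewrite sumlate // (subset_trans (subsetIl _ _)).
  rewrite big_distrl /= -mulnn.
  have -> : #|P| * L * B + #|P| * L * (#|P| * L) = \sum_(z in P) (L * B + #|P| * (L * L)).
    by rewrite sum_nat_const; ring.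
  apply: leq_sum => z zP; rewrite (bigD1 z) //= setIid cL // mulnDl leq_add2l big_distrl /=.
  rewrite -sum_nat_const [leqRHS](bigD1 z) //=; apply: leq_trans (leq_addl _ _).
  by apply: leq_sum => z' /andP[z'P ne]; apply: two; rewrite // eq_sym.
pose R := rat; set mu : R := ((#|P| * L)%N%:R)%R.
have B0 : (0 < B%:R :> R)%R by rewrite ltr0n card_labellings_gt0.
(* Chebyshev: [X] vanishes on [bad], so each labelling there contributes the squared mean to the
   total variance. *)
have : (#|bad|%:R * (mu / B%:R) ^+ 2 <= \sum_(pi in labellings) ((X pi)%:R - mu / B%:R) ^+ 2)%R.
  have -> : (#|bad|%:R * (mu / B%:R) ^+ 2 = \sum_(pi in bad) ((X pi)%:R - mu / B%:R) ^+ 2)%R.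
    rewrite mulr_natl -sumr_const; apply: eq_bigr => pi; rewrite inE => /andP[_ /forall_inP h].
    by rewrite /X big1 ?sub0r ?sqrrN // => z /h /negbTE ->.
  rewrite [leRHS](big_setID bad) /= (setIidPr _); last by apply/subsetP => pi; rewrite inE => /andP[].
  by rewrite lerDl; apply: sumr_ge0 => pi _; apply: sqr_ge0.
have -> : (\sum_(pi in labellings) ((X pi)%:R - mu / B%:R) ^+ 2 =
   (\sum_(pi in labellings) X pi * X pi)%N%:R - mu ^+ 2 / B%:R)%R.
  transitivity ((\sum_(pi in labellings) ((X pi * X pi)%N%:R - 2 * (mu / B%:R) * (X pi)%:R + (mu / B%:R) ^+ 2))%R : R).
    by apply: eq_bigr => pi _; rewrite natrM; ring.
  rewrite !big_split /= sumrN -mulr_sumr -!natr_sum EX sumr_const -[(_ *+ #|_|)%R]mulr_natl -/B -/mu.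
  by field; rewrite gt_eqF.
move=> h1; have h2 : ((\sum_(pi in labellings) X pi * X pi)%N%:R * B%:R <= mu * B%:R + mu ^+ 2 :> R)%R.
  by rewrite /mu -natrX -!natrM -natrD ler_nat.
have mu0 : (0 < mu)%R by rewrite ltr0n.
rewrite -(ler_nat R) natrM natrX -/mu.
have h3 : (#|bad|%:R * mu ^+ 2 <= B%:R ^+ 2 * mu)%R.
  have : (#|bad|%:R * (mu / B%:R) ^+ 2 * B%:R ^+ 2 <= ((\sum_(pi in labellings) X pi * X pi)%N%:R - mu ^+ 2 / B%:R) * B%:R ^+ 2)%R.
    by apply: ler_wpM2r h1; apply: sqr_ge0.
  have -> : (#|bad|%:R * (mu / B%:R) ^+ 2 * B%:R ^+ 2 = #|bad|%:R * mu ^+ 2)%R by field; rewrite gt_eqF.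
  have -> : (((\sum_(pi in labellings) X pi * X pi)%N%:R - mu ^+ 2 / B%:R) * B%:R ^+ 2 =
     ((\sum_(pi in labellings) X pi * X pi)%N%:R * B%:R - mu ^+ 2) * B%:R)%R by field; rewrite gt_eqF.
  move=> h4; apply: le_trans h4 _.
  have -> : (B%:R ^+ 2 * mu = mu * B%:R * B%:R)%R by ring.
  by apply: ler_wpM2r; [exact: ltW|lra].
by rewrite -(ler_pM2r mu0) -mulrA -expr2.
Qed.
End Labellings.

(** * From local obstructions to EKR *)

Fact complement_arith a b M : a + b = M -> 5 * M <= 8 * b -> 8 * a <= 3 * M.
Proof. by lia. Qed.

Section Deterministic.
Variable k : nat.
Notation n := (2 * k + 1).
Notation V := (ksets n k).
Hypothesis k1 : 1 < k.
Implicit Types (u v : {set 'I_n}) (F A B : {set {set 'I_n}}) (G : {set {set {set 'I_n}}}).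

Lemma kneser_edge_nbr v u : ([set v; u] \in kneser_edges n k) = (v \in V) && (u \in nbr v).
Proof.
apply/idP/andP => [|[vV]]; last first.
  rewrite inE => /andP[uV d]; rewrite inE; apply/exists_inP; exists v => //.
  by apply/exists_inP; exists u; rewrite // d eqxx.
rewrite inE => /exists_inP[a aV /exists_inP[b bV /andP[d /eqP e]]].
have nab : a != b.
  apply: contraTneq d => <-; rewrite -setI_eq0 setIid -card_gt0.
  by move: aV; rewrite inE => /eqP ->; apply: ltnW.
have : v \in [set a; b] by rewrite -e !inE eqxx.
have : u \in [set a; b] by rewrite -e !inE eqxx orbT.
have ha : a \in [set v; u] by rewrite e !inE eqxx.
have hb : b \in [set v; u] by rewrite e !inE eqxx orbT.
rewrite !inE => /orP[/eqP eu|/eqP eu] /orP[/eqP ev|/eqP ev]; subst.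
- by move: hb; rewrite !inE orbb eq_sym (negbTE nab).
- by move: aV bV; rewrite !inE disjoint_sym => -> ->.
- by move: aV bV; rewrite !inE => -> ->.
- by move: ha; rewrite !inE orbb (negbTE nab).
Qed.

Lemma kneser_edgeP e : e \in kneser_edges n k -> exists v u, [/\ e = [set v; u], v \in V & u \in nbr v].
Proof.
rewrite inE => /exists_inP[a aV /exists_inP[b bV /andP[d /eqP ->]]].
by exists a, b; split=> //; rewrite inE bV d.
Qed.

Lemma star_subV x : star k x \subset V.
Proof. by apply/subsetP => S; rewrite !inE => /andP[]. Qed.

Lemma star_nbr x v u : v \in star k x -> u \in nbr v -> u \notin star k x.
Proof.
rewrite !inE => /andP[_ xv] /andP[_ d]; rewrite negb_and; apply/orP; right.
by rewrite (disjointFr d xv).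
Qed.

Lemma star_independent G x : G \subset kneser_edges n k -> independent k G (star k x).
Proof.
move=> GE; rewrite /independent star_subV; apply/forall_inP => e eG.
have [v [u [-> vV uv]]] := kneser_edgeP (subsetP GE _ eG).
apply/negP; rewrite subUset !sub1set => /andP[vS uS].
by have := star_nbr vS uv; rewrite uS.
Qed.

Lemma independent_sub G F F' : F' \subset F -> independent k G F -> independent k G F'.
Proof.
move=> FF /andP[FV /forall_inP h]; rewrite /independent (subset_trans FF FV).
by apply/forall_inP => e /h; apply: contra => /subset_trans; apply.
Qed.

Lemma card_near_star x v (B : {set 'I_n}) : v \in V :\: star k x -> B \in star k x ->
  #|v |: (star k x :\ B)| = star_size k.
Proof.
move=> /setDP[vV vS] BS; rewrite cardsU1 in_setD1 (negbTE vS) andbF.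
by have := cardsD1 B (star k x); rewrite BS card_star ?(ltnW k1) // => ->.
Qed.

Lemma near_star_not_star F : is_near_star k F -> ~~ is_star k F.
Proof.
move=> /existsP[x /exists_inP[v vW /exists_inP[B BS /eqP ->]]].
apply/negP => /existsP[y /eqP e].
case/setDP: (vW) => vV vS.
have [exy|xy] := eqVneq y x.
  by case/negP: vS; rewrite -exy -e setU11.
have h : star k y :\: star k x \subset [set v].
  by rewrite -e; apply/subsetP => S; rewrite !inE => /andP[/negbTE] ->; case: (S == v); rewrite ?andbF.
have := subset_leq_card h; rewrite cards1 cardsD card_star ?(ltnW k1) //.
have -> : star k y :&: star k x = [set S in V | (y \in S) && (x \in S)].
  by apply/setP => S; rewrite !inE; case: (#|S| == k).
rewrite card_star2 // -(bin_star2 k1) addnK leqNgt => /negP; apply.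
case: (k) k1 => [|[|j]] //= _.
apply: leq_trans (leq_bin2l j.+1 (_ : j.+2 <= _)); first by rewrite binSn.
by rewrite mulnS /=; lia.
Qed.

(** An independent near-star has the size of a star, hence would be a maximum independent set of an
    EKR graph without being a star. *)
Lemma EKR_no_near_star G : G \subset kneser_edges n k -> EKR k G -> no_independent_near_star k G.
Proof.
move=> GE /forallP ekr; apply/forallP => F; apply/implyP => nF; apply/negP => iF.
have i0 : independent k G set0.
  rewrite /independent sub0set; apply/forall_inP => e eG.
  have [v [u [-> _ _]]] := kneser_edgeP (subsetP GE _ eG).
  by apply/negP => /subsetP/(_ v); rewrite !inE eqxx => /(_ isT).
case: (arg_maxnP (fun F : {set {set 'I_n}} => #|F|) i0) => F0 iF0 maxF0.
have mF0 : maximum_independent k G F0.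
  by rewrite /maximum_independent iF0; apply/forallP => F'; apply/implyP => /maxF0.
have /existsP[y /eqP ey] := implyP (ekr F0) mF0.
have cF : #|F| = #|F0|.
  have /existsP[x /exists_inP[v vW /exists_inP[B BS /eqP ->]]] := nF.
  by rewrite card_near_star // ey card_star // ltnW.
have mF : maximum_independent k G F.
  by rewrite /maximum_independent iF; apply/forallP => F'; apply/implyP => /maxF0; rewrite cF.
by have := near_star_not_star nF; rewrite (implyP (ekr F) mF).
Qed.

Definition graph_nbrs G x A := [set u in star k x | [exists v in A, [set v; u] \in G]].

Lemma graph_nbrsU G x A A' : graph_nbrs G x (A :|: A') = graph_nbrs G x A :|: graph_nbrs G x A'.
Proof.
apply/setP => u; rewrite !inE -andb_orr; congr (_ && _).
apply/exists_inP/orP => [[v /setUP[vA|vA] h]|[/exists_inP[v vA h]|/exists_inP[v vA h]]].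
- by left; apply/exists_inP; exists v.
- by right; apply/exists_inP; exists v.
- by exists v; rewrite // inE vA.
- by exists v; rewrite // inE vA orbT.
Qed.

Lemma exists_subset_card (T : finType) (A : {set T}) m : m <= #|A| -> exists2 B : {set T}, B \subset A & #|B| = m.
Proof.
move=> h; have : 0 < #|[set B : {set T} | B \subset A & #|B| == m]| by rewrite cards_draws bin_gt0.
by move/card_gt0P => [B]; rewrite inE => /andP[? /eqP]; exists B.
Qed.

(* A minimal violation of Hall's condition for the bipartite graph between the
   complement of the star and the star is connected: otherwise one of the two
   parts would be a smaller violation. *)
Lemma no_near_star_EKR G : 4 <= k -> G \subset kneser_edges n k ->
  (forall F, F \in bad_families k -> ~~ independent k G F) ->
  (forall x p, p \in bad_pairs x -> exists v u, [/\ v \in p.1, u \in star k x :\: p.2 & [set v; u] \in G]) ->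
  no_independent_near_star k G -> EKR k G.
Proof.
move=> k4 GE hF hP /forallP near; apply/forallP => F; apply/implyP => /andP[iF /forallP maxF].
apply: contraT => nS; exfalso.
have noN x v (B : {set 'I_n}) : v \in V :\: star k x -> B \in star k x -> ~~ independent k G (v |: (star k x :\ B)).
  move=> vW BS; apply: (implyP (near _)); apply/existsP; exists x.
  by apply/exists_inP; exists v => //; apply/exists_inP; exists B.
have star0 (x : 'I_n) : exists b : {set 'I_n}, b \in star k x.
  by apply/card_gt0P; rewrite card_star ?star_size_gt0 // ltnW.
have x0 : 'I_n := Ordinal (ltn_addl (2 * k) (ltnSn 0)).
have cF : star_size k <= #|F|.
  by have := implyP (maxF (star k x0)) (star_independent x0 GE); rewrite card_star // ltnW.
(* [F] may be larger than a star. If the chosen subset of star size happens to be a star, a further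
   vertex of [F] together with it already yields an independent near-star. *)
have [F' [F'F cF' nF']] : exists F', [/\ F' \subset F, #|F'| = star_size k & ~~ is_star k F'].
  have [F1 F1F cF1] := exists_subset_card cF.
  have [/existsP[x /eqP e]|] := boolP (is_star k F1); last by exists F1.
  have [v vF vF1] : exists2 v, v \in F & v \notin F1.
    apply/subsetPn; apply: contra nS => FF1; apply/existsP; exists x.
    by rewrite -e eqEsubset FF1.
  have [B BS] := star0 x.
  have vW : v \in V :\: star k x.
    by rewrite inE -e vF1; case/andP: iF => /subsetP/(_ _ vF).
  case/negP: (noN x v B vW BS); apply: independent_sub iF.
  by rewrite subUset sub1set vF (subset_trans _ F1F) // e subD1set.
have iF' := independent_sub F'F iF.
have F'V : F' \subset V by case/andP: iF'.
have [x hx] : exists x : 'I_n, 5 * star_size k <= 8 * #|F' :&: star k x|.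
  apply: stability => //; rewrite leqNgt; apply/negP => h.
  have : F' \in bad_families k by rewrite inE F'V cF' eqxx.
  by move/hF; rewrite iF'.
pose A := F' :\: star k x.
have AW : A \subset V :\: star k x by apply: setSD.
have cA : #|A| + #|F' :&: star k x| = star_size k by rewrite addnC cardsID.
have A0 : A != set0.
  apply: contra nF'; rewrite setD_eq0 => sF; apply/existsP; exists x.
  by rewrite eqEcard sF cF' card_star ?(ltnW k1) // leqnn.
have NA : #|graph_nbrs G x A| <= #|A|.
  have h : graph_nbrs G x A \subset star k x :\: F'.
    apply/subsetP => u /setIdP[uS /exists_inP[v /setDP[vF' _] vu]]; rewrite in_setD uS andbT.
    apply/negP => uF'; case/andP: iF' => _ /forall_inP/(_ _ vu).
    by rewrite subUset !sub1set vF' uF'.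
  apply: leq_trans (subset_leq_card h) _; rewrite cardsD card_star ?(ltnW k1) //.
  by rewrite setIC -cA addnK.
pose P (X : {set {set 'I_n}}) := [&& X \subset A, X != set0 & #|graph_nbrs G x X| <= #|X|].
have PA : P A by rewrite /P subxx A0.
case: (arg_minnP (fun X : {set {set 'I_n}} => #|X|) PA) => A' /and3P[A'A A'0 NA'] minA'.
have A'W := subset_trans A'A AW.
have [A'1|A'1] := leqP #|A'| 1.
  have [v eA'] : exists v, A' = [set v].
    by apply/cards1P; rewrite eqn_leq A'1 card_gt0.
  have vW : v \in V :\: star k x by rewrite (subsetP A'W) // eA' set11.
  (* A single vertex [v] with at most one graph neighbour in the star: removing that neighbour, or
     any vertex if there is none, and adding [v] gives an independent near-star. *)
  have [B BS hB] : exists2 B : {set 'I_n}, B \in star k x & graph_nbrs G x A' \subset [set B].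
    have [e|/set0Pn[B BN]] := eqVneq (graph_nbrs G x A') set0.
      by have [B BS] := star0 x; exists B; rewrite // e sub0set.
    exists B; first by move: BN; rewrite inE => /andP[].
    have : #|graph_nbrs G x A'| == 1.
      by rewrite eqn_leq (leq_trans NA' A'1); apply/card_gt0P; exists B.
    by move/cards1P => [B' e]; move: BN; rewrite e inE => /eqP ->.
  case/negP: (noN x v B vW BS); apply/andP; split.
    rewrite subUset sub1set; case/setDP: vW => -> _ /=.
    exact: subset_trans (subD1set _ _) (star_subV x).
  have key a b : [set a; b] \in G -> b \in nbr a -> a \in v |: star k x :\ B -> b \in v |: star k x :\ B -> b \in star k x :\ B -> False.
    move=> abG ab aF bF bS.
    have [aS|aS] := boolP (a \in star k x).
      by move: bS; rewrite in_setD1 (negbTE (star_nbr aS ab)) andbF.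
    have av : a = v by apply/eqP; move: aF; rewrite in_setU1 in_setD1 (negbTE aS) andbF orbF.
    move: bS; rewrite in_setD1 => /andP[bB bS]; case/negP: bB.
    rewrite -in_set1 (subsetP hB) // inE bS; apply/exists_inP; exists v; first by rewrite eA' set11.
    by rewrite -av.
  apply/forall_inP => e eG; have [a [b [ee aV ab]]] := kneser_edgeP (subsetP GE _ eG).
  apply/negP; rewrite ee subUset !sub1set => /andP[aF bF].
  have ba : a \in nbr b by rewrite nbr_sym // (nbrV ab).
  have [bS|bS] := boolP (b \in star k x :\ B); first by apply: (key a b) => //; rewrite -ee.
  have [aS|aS] := boolP (a \in star k x :\ B); first by apply: (key b a) => //; rewrite setUC -ee.
  move: aF bF; rewrite !in_setU1 (negbTE aS) (negbTE bS) !orbF => /eqP av /eqP bv.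
  move: ab aV; rewrite av bv !inE => /andP[_]; rewrite -setI_eq0 setIid => /eqP ->.
  by rewrite cards0 eq_sym gtn_eqF // ltnW.
have lA' : two_linked A'.
  apply/forallP => A1; apply/implyP => /and3P[A1A A10 A1n]; apply: contraT => hn.
  have A20 : A' :\: A1 != set0.
    by rewrite setD_eq0; apply: contra A1n => h; rewrite eqEsubset A1A h.
  have c12 : #|A1| + #|A' :\: A1| = #|A'| by rewrite -(cardsID A1 A') (setIidPr A1A).
  have P1 : ~~ P A1.
    apply/negP => /minA'; rewrite -c12 -[leqRHS]addn0 leq_add2l leqn0 cards_eq0.
    by rewrite (negbTE A20).
  have P2 : ~~ P (A' :\: A1).
    apply/negP => /minA'; rewrite -c12 -[leqRHS]add0n leq_add2r leqn0 cards_eq0.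
    by rewrite (negbTE A10).
  have d0 : graph_nbrs G x A1 :&: graph_nbrs G x (A' :\: A1) = set0.
    apply/eqP; apply: contraR hn => /set0Pn[u /setIP[]].
    move=> /setIdP[_ /exists_inP[v vA1 vu]] /setIdP[_ /exists_inP[v' vA2 vu']].
    apply/exists_inP; exists v => //; apply/exists_inP; exists v' => //.
    apply/set0Pn; exists u; rewrite inE.
    by move: (subsetP GE _ vu) (subsetP GE _ vu'); rewrite !kneser_edge_nbr => /andP[_ ->] /andP[_ ->].
  have cN : #|graph_nbrs G x A1| + #|graph_nbrs G x (A' :\: A1)| = #|graph_nbrs G x A'|.
    rewrite -cardsUI d0 cards0 addn0 -graph_nbrsU; congr #|pred_of_set (graph_nbrs _ _ _)|.
    by rewrite -{2}(setID A' A1) (setIidPr A1A).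
  move: P1 P2; rewrite /P A10 A20 (subset_trans A1A A'A) (subset_trans (subsetDl _ _) A'A) /=.
  rewrite -!ltnNge => h1 h2; have := leq_add h1 h2.
  by rewrite addSn addnS cN c12 => h3; have := leq_trans h3 NA'; rewrite ltnNge leqnSn.
have [|v [u [vA uN vu]]] := hP x (A', graph_nbrs G x A').
  rewrite inE /= A'W A'1 NA' lA' /= !andbT; apply/and3P; split.
  - by apply/subsetP => u; rewrite inE => /andP[].
  - have h1 : 8 * #|A'| <= 8 * #|A| by rewrite leq_mul2l subset_leq_card.
    by apply: leq_trans h1 _; exact: complement_arith cA hx.
  - apply/subsetP => u; rewrite inE => /andP[_ /exists_inP[v vA vu]].
    apply/bigcupP; exists v => //.
    by move: (subsetP GE _ vu); rewrite kneser_edge_nbr => /andP[].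
move: uN => /setDP[uS /negP]; apply; rewrite inE uS.
by apply/exists_inP; exists v.
Qed.

Lemma isolated_near_star G v : v \in V -> (forall e, e \in G -> v \notin e) -> G \subset kneser_edges n k ->
  ~~ no_independent_near_star k G.
Proof.
move=> vV iso GE; have [x xv] : exists x, x \notin v.
  have : 0 < #|~: v| by rewrite card_nbr_compl.
  by move/card_gt0P => [x]; rewrite inE; exists x.
have [B BS] : exists b : {set 'I_n}, b \in star k x.
  by apply/card_gt0P; rewrite card_star ?star_size_gt0 // ltnW.
apply/negP => /forallP/(_ (v |: (star k x :\ B)))/implyP h.
have : is_near_star k (v |: (star k x :\ B)).
  apply/existsP; exists x; apply/exists_inP; exists v; last by apply/exists_inP; exists B.
  by rewrite inE vV andbT; move: vV; rewrite !inE => ->.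
move/h => /negP; apply; rewrite /independent subUset sub1set vV /=.
rewrite (subset_trans (subD1set _ _) (star_subV x)); apply/forall_inP => e eG.
apply/negP => se; have := star_independent x GE => /andP[_ /forall_inP/(_ _ eG)/negP]; apply.
apply/subsetP => u ue; have := subsetP se _ ue; rewrite in_setU1 => /orP[/eqP uv|].
  by have := iso _ eG; rewrite -uv ue.
by rewrite in_setD1 => /andP[].
Qed.
End Deterministic.

(** * Asymptotic estimates *)

Lemma exp_bernoulli p q r : q < p -> q ^ r * (q + r) <= p ^ r * q.
Proof.
move=> qp; elim: r => [|r IH]; first by rewrite !expn0 addn0.
rewrite !expnS.
have h1 : q ^ r <= p ^ r by case: r {IH} => // r; rewrite leq_exp2r // ltnW.
have h2 : q.+1 * (p ^ r * q) <= p * (p ^ r * q) by rewrite leq_mul2r qp orbT.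
have h3 : q * (q ^ r * (q + r)) <= q * (p ^ r * q) by rewrite leq_mul2l IH orbT.
have h4 : q ^ r * q <= p ^ r * q by rewrite leq_mul2r h1 orbT.
have -> : q * q ^ r * (q + r.+1) = q * (q ^ r * (q + r)) + q ^ r * q by rewrite addnS; ring.
have -> : p * p ^ r * q = p * (p ^ r * q) by ring.
by apply: leq_trans h2; rewrite mulSn addnC leq_add.
Qed.

(** [p / q] is the product of [(p + q) / (2 * q)] and [2 * p / (p + q)], both above 1. Bernoulli
    gives the power of each a factor [r] up to a constant; one factor [r] pays for the constants,
    the other is the claim. *)
Lemma exp_dominates_linear p q : 0 < q -> q < p -> exists K, forall r, K <= r -> r * q ^ r <= p ^ r.
Proof.
move=> q0 qp; exists (2 * q * (p + q)) => r hr.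
have [->|r0] := posnP r; first by rewrite mul0n.
have h1 := @exp_bernoulli (p + q) (2 * q) r (ltac:(lia)).
have h2 := @exp_bernoulli (2 * p) (p + q) r (ltac:(lia)).
have h3 : (2 * q) ^ r * r <= (p + q) ^ r * (2 * q).
  by apply: leq_trans h1; rewrite leq_mul2l leq_addl orbT.
have h4 : (p + q) ^ r * r <= (2 * p) ^ r * (p + q).
  by apply: leq_trans h2; rewrite leq_mul2l leq_addl orbT.
have p0 : 0 < 2 ^ r by rewrite expn_gt0.
have h5 : (2 * q) ^ r * r * r <= (2 * p) ^ r * (2 * q * (p + q)).
  apply: (@leq_trans ((p + q) ^ r * (2 * q) * r)); first by rewrite leq_mul2r h3 orbT.
  have -> : (p + q) ^ r * (2 * q) * r = (p + q) ^ r * r * (2 * q) by ring.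
  have -> : (2 * p) ^ r * (2 * q * (p + q)) = (2 * p) ^ r * (p + q) * (2 * q) by ring.
  by rewrite leq_mul2r h4 orbT.
have h6 : (2 * q) ^ r * r * r <= (2 * p) ^ r * r.
  by apply: leq_trans h5 _; rewrite leq_mul2l hr orbT.
move: h6; rewrite leq_pmul2r // !expnMn -mulnA leq_pmul2l //.
by rewrite mulnC.
Qed.

Lemma exp_dominates_poly c d p q : 0 < q -> q < p -> exists K, forall r, K <= r -> c * r ^ d * q ^ r <= p ^ r.
Proof.
elim: d p q => [|d IH] p q q0 qp.
  have [K hK] := exp_dominates_linear q0 qp; exists (maxn K c) => r; rewrite geq_max => /andP[Kr cr].
  by apply: leq_trans (hK r Kr); rewrite expn0 muln1 leq_mul2r cr orbT.
(* The same splitting of [p / q]: one part absorbs degree [d] by induction, the other the remaining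
   factor [r]. *)
have [K1 h1] := IH (p + q) (2 * q) (ltac:(lia)) (ltac:(lia)).
have [K2 h2] := @exp_dominates_linear (2 * p) (p + q) (ltac:(lia)) (ltac:(lia)).
exists (maxn K1 K2) => r; rewrite geq_max => /andP[/h1 e1 /h2 e2].
have p0 : 0 < 2 ^ r * (p + q) ^ r by rewrite muln_gt0 !expn_gt0; lia.
rewrite -(leq_pmul2l p0).
have -> : 2 ^ r * (p + q) ^ r * (c * r ^ d.+1 * q ^ r) = (c * r ^ d * (2 * q) ^ r) * (r * (p + q) ^ r).
  by rewrite expnMn expnS; ring.
have -> : 2 ^ r * (p + q) ^ r * p ^ r = (p + q) ^ r * (2 * p) ^ r by rewrite expnMn; ring.
exact: leq_mul.
Qed.

(** Bernoulli's inequality [(k / (k+1))^d >= 1 - d / (k+1)] without denominators; truncated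
    subtraction makes it trivial for [d > k]. *)
Lemma succ_exp_le k d : k.+1 ^ d * (k.+1 - d) <= k ^ d * k.+1.
Proof.
elim: d => [|d IH]; first by rewrite !expn0 subn0.
rewrite !expnS; apply: (@leq_trans (k * (k.+1 ^ d * (k.+1 - d)))).
  have h : k.+1 * (k.+1 - d.+1) <= k * (k.+1 - d) by nia.
  have -> : k.+1 * k.+1 ^ d * (k.+1 - d.+1) = k.+1 ^ d * (k.+1 * (k.+1 - d.+1)) by ring.
  have -> : k * (k.+1 ^ d * (k.+1 - d)) = k.+1 ^ d * (k * (k.+1 - d)) by ring.
  by rewrite leq_mul2l h orbT.
by rewrite -mulnA leq_mul2l IH orbT.
Qed.

Lemma succ_exp_ratio k d p q : p * k.+1 <= q * (k.+1 - d) -> k.+1 ^ d * p <= k ^ d * q.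
Proof.
move=> h; rewrite -(@leq_pmul2r k.+1) //.
apply: (@leq_trans (k.+1 ^ d * (k.+1 - d) * q)).
  by rewrite -!mulnA leq_mul2l [(k.+1 - d) * q]mulnC h orbT.
by rewrite [leqRHS]mulnAC leq_mul2r succ_exp_le orbT.
Qed.

Lemma succ_exp_ratio_pow k d p q N e : 0 < k -> k.+1 ^ d * p <= k ^ d * q -> N <= d * e ->
  k.+1 ^ N * p ^ e <= k ^ N * q ^ e.
Proof.
move=> k0 h Nd.
have h2 : (k.+1 ^ d * p) ^ e <= (k ^ d * q) ^ e by case: e {Nd} => // e; rewrite leq_exp2r.
rewrite !expnMn -!expnM in h2.
have h3 : k ^ (d * e - N) <= k.+1 ^ (d * e - N) by case: (_ - _) => // j; rewrite leq_exp2r.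
have p1 : 0 < k ^ (d * e - N) by rewrite expn_gt0 k0.
rewrite -(leq_pmul2r p1); apply: (@leq_trans (k.+1 ^ (d * e) * p ^ e)).
  rewrite -[X in _ <= k.+1 ^ X * _](subnKC Nd) expnD.
  by rewrite [leqLHS]mulnAC leq_mul2r leq_mul2l h3 !orbT.
apply: leq_trans h2 _; rewrite -{1}(subnKC Nd) expnD.
by rewrite mulnAC.
Qed.

(** Consecutive star sizes have a ratio that tends to 4 and is never below [7/2]. The base only has
    to exceed the [10/3] of [no_isolated_weight]. *)
Lemma star_size_ge k : 7 ^ k <= star_size k.+1 * 2 ^ k.
Proof.
elim: k => [|k IH]; first by [].
have : 7 * star_size k.+1 <= star_size k.+2 * 2.
  rewrite /star_size /=.
  have e1 : k.+1 * 'C(2 * k.+2, k.+1) = 2 * k.+2 * 'C((2 * k.+2).-1, k) by rewrite mul_bin_diag.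
  have e2 : k.+3 * 'C((2 * k.+2).-1, k) = (2 * k.+2).-1 * 'C(2 * k.+1, k).
    have -> : 2 * k.+1 = (2 * k.+2).-1.-1 by lia.
    by rewrite mul_bin_down; congr (_ * _); lia.
  have e3 : k.+3 * (k.+1 * 'C(2 * k.+2, k.+1)) = 2 * k.+2 * ((2 * k.+2).-1 * 'C(2 * k.+1, k)).
    by rewrite e1 -e2; ring.
  have p0 : 0 < k.+3 * k.+1 by [].
  rewrite -(leq_pmul2l p0).
  have -> : k.+3 * k.+1 * ('C(2 * k.+2, k.+1) * 2) = k.+3 * (k.+1 * 'C(2 * k.+2, k.+1)) * 2 by ring.
  rewrite e3; move: 'C(2 * k.+1, k) => c.
  have -> : k.+3 * k.+1 * (7 * c) = 7 * (k.+3 * k.+1) * c by ring.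
  have -> : 2 * k.+2 * ((2 * k.+2).-1 * c) * 2 = 2 * k.+2 * (2 * k.+2).-1 * 2 * c by ring.
  rewrite leq_mul2r; apply/orP; right.
  have -> : (2 * k.+2).-1 = 2 * k + 3 by lia.
  nia.
move=> h; rewrite !expnS; apply: (@leq_trans (7 * (star_size k.+1 * 2 ^ k))).
  by rewrite leq_mul2l IH orbT.
by rewrite !mulnA leq_mul2r h orbT.
Qed.

Lemma exists_sqrt k : exists r, (r * r <= k) && (k < r.+1 * r.+1).
Proof.
elim: k => [|k [r /andP[h1 h2]]]; first by exists 0.
have [h|h] := ltnP k.+1 (r.+1 * r.+1); first by exists r; rewrite h andbT; lia.
by exists r.+1; apply/andP; split; nia.
Qed.

Lemma geometric_tail (R : realFieldType) (q : R) a b : (0 <= q <= 1 / 2)%R ->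
  (\sum_(a <= e < b) q ^+ e <= 2 * q ^+ a)%R.
Proof.
move=> /andP[q0 q2]; have qa : (0 <= q ^+ a)%R by apply: exprn_ge0.
have [ab|ab] := leqP a b; last by rewrite big_geq ?(ltnW ab) // mulr_ge0.
rewrite -(subnK ab); elim: (b - a) => [|j IH]; first by rewrite big_geq // mulr_ge0.
have -> : (\sum_(a <= e < j.+1 + a) q ^+ e = q ^+ a + q * \sum_(a <= e < j + a) q ^+ e)%R.
  rewrite addSn big_ltn ?ltnS ?leq_addl // big_add1 /= mulr_sumr; congr (_ + _)%R.
  by apply: eq_bigr => e _; rewrite exprS.
have h : (q * \sum_(a <= e < j + a) q ^+ e <= 1 / 2 * (2 * q ^+ a))%R.
  by apply: ler_pM => //; apply: sumr_ge0 => e _; apply: exprn_ge0.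
lra.
Qed.

Lemma weighted_count (R : realFieldType) (Z : finType) (P : {set Z}) (D : Z -> nat) (c q : R) e0 :
  (0 <= c)%R -> (0 <= q <= 1 / 2)%R -> (forall z, z \in P -> e0 <= D z) ->
  (forall e : nat, (e0 <= e)%N -> #|[set z in P | D z == e]|%:R * (1 / 3) ^+ e <= c * q ^+ e)%R ->
  (\sum_(z in P) (1 / 3) ^+ D z <= 2 * c * q ^+ e0)%R.
Proof.
move=> c0 q01 hD hc; pose b := (\max_(z in P) D z).+1.
have Db z : z \in P -> D z < b.
  move=> zP; rewrite /b ltnS. exact: leq_bigmax_cond.
have -> : (\sum_(z in P) (1 / 3) ^+ D z = \sum_(e0 <= e < b) #|[set z in P | D z == e]|%:R * (1 / 3 : R) ^+ e)%R.
  rewrite big_mkcond big_geq_mkord /=.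
  rewrite (eq_bigr (fun z : Z => (\sum_(e < b | (e0 <= e)%N) (if (z \in P) && (D z == e) then (1 / 3 : R) ^+ e else 0))%R)); last first.
    move=> z _; case: (boolP (z \in P)) => zP /=; last by rewrite big1.
    rewrite (bigD1 (Ordinal (Db z zP))) /=; last exact: hD.
    rewrite eqxx big1 ?addr0 // => e /andP[_ ne].
    by case: eqP => // De; case/negP: ne; apply/eqP/val_inj.
  rewrite exchange_big /=; apply: eq_bigr => e _.
  rewrite -big_mkcond /= sumr_const [in RHS]mulr_natl.
  by congr (_ *+ _)%R; apply: eq_card => z; rewrite inE.
apply: (@le_trans _ _ (\sum_(e0 <= e < b) c * q ^+ e)%R).
  by rewrite !big_geq_mkord; apply: ler_sum => e /= he; apply: hc.
by rewrite -mulr_sumr -mulrA mulrCA; apply: ler_wpM2l => //; apply: geometric_tail.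
Qed.

(** * The union bound *)

Section Process.
Variable k : nat.
Notation n := (2 * k + 1).
Notation V := (ksets n k).
Notation m := #|kneser_edges n k|.
Implicit Types (v u : {set 'I_n}) (F : {set {set 'I_n}}) (U : {set {set {set 'I_n}}}).
Implicit Types (pi : labelling n k) (p : {set {set 'I_n}} * {set {set 'I_n}}).

Definition lift_edges U : {set edge n k} := [set e | val e \in U].

Lemma card_lift_edges U : U \subset kneser_edges n k -> #|lift_edges U| = #|U|.
Proof.
move=> UE; rewrite -(card_imset _ val_inj); apply: eq_card => e.
apply/imsetP/idP => [[e' + ->]|eU]; first by rewrite inE.
by exists (exist _ e (subsetP UE _ eU)); rewrite ?inE.
Qed.

Lemma card_edge : #|{: edge n k}| = m.
Proof. by rewrite card_sig; apply: eq_card. Qed.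

Lemma processP pi i e : reflect (exists2 e' : edge n k, e = val e' & pi e' < i) (e \in process pi i).
Proof.
apply: (iffP imsetP) => [[e' + ->]|[e' -> h]]; first by rewrite inE; exists e'.
by exists e'; rewrite ?inE.
Qed.

Lemma process_sub pi i : process pi i \subset kneser_edges n k.
Proof. by apply/subsetP => e /processP[e' -> _]; apply: (valP e'). Qed.

Lemma process_mono pi i j : i <= j -> process pi i \subset process pi j.
Proof.
by move=> ij; apply/subsetP => e /processP[e' -> h]; apply/processP; exists e' => //; apply: leq_trans ij.
Qed.

Lemma not_late pi i U : pi \in bijections n k -> pi \notin late m i (lift_edges U) ->
  exists2 e, e \in U & e \in process pi i.
Proof.
move=> pb; rewrite inE pb /= negb_forall => /existsP[e]; rewrite negb_imply inE -ltnNge => /andP[eU h].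
by exists (val e) => //; apply/processP; exists e.
Qed.

Lemma late_process pi i U e : pi \in late m i (lift_edges U) -> e \in process pi i -> e \notin U.
Proof.
rewrite inE => /andP[_ /forall_inP h] /processP[e' -> lt]; apply/negP => eU.
by have := h e'; rewrite inE eU leqNgt lt => /(_ isT).
Qed.

Definition cross_pairs (x : 'I_n) (p : {set {set 'I_n}} * {set {set 'I_n}}) :=
  [set q : {set 'I_n} * {set 'I_n} | (q.1 \in p.1) && (q.2 \in nbr q.1 :&: (star k x :\: p.2))].

Definition cross_edges x p := [set [set q.1; q.2] | q in cross_pairs x p].

Lemma cross_edges_sub x p : p.1 \subset V -> 1 < k -> cross_edges x p \subset kneser_edges n k.
Proof.
move=> AV k1; apply/subsetP => e /imsetP[[v u]]; rewrite inE /= => /andP[vA /setIP[vu _]] ->.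
by rewrite kneser_edge_nbr // (subsetP AV).
Qed.

Lemma card_cross_edges x p : p.1 \subset V :\: star k x -> #|cross_edges x p| = pair_defect x p.
Proof.
move=> AW; rewrite /cross_edges card_in_imset.
  rewrite -sum1_card (eq_bigl (fun q => (q.1 \in p.1) && (q.2 \in nbr q.1 :&: (star k x :\: p.2)))); last first.
    by move=> q; rewrite inE.
  rewrite -(pair_big_dep (fun v => v \in p.1) (fun v u => u \in nbr v :&: (star k x :\: p.2)) (fun _ _ => 1)) /=.
  by apply: eq_bigr => v _; rewrite sum1_card.
move=> [v u] [v' u']; rewrite !inE /= => /andP[vA /andP[_ /andP[_ uS]]] /andP[vA' /andP[_ /andP[_ uS']]] e.
have nvu (a b : {set 'I_n}) : a \in p.1 -> (#|b| == k) && (x \in b) -> a != b.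
  move=> /(subsetP AW); rewrite !inE => /andP[h _] bS.
  by apply: contraNneq h => ->.
have : v \in [set v'; u'] by rewrite -e !inE eqxx.
have : u \in [set v'; u'] by rewrite -e !inE eqxx orbT.
rewrite !inE (negbTE (nvu _ _ vA uS')) orbF eq_sym (negbTE (nvu _ _ vA' uS)) /=.
by move=> /eqP -> /eqP ->.
Qed.

Definition edges_at v := [set e in kneser_edges n k | v \in e].

Lemma card_edges_at v : 1 < k -> v \in V -> #|edges_at v| = k.+1.
Proof.
move=> k1 vV; rewrite -(card_nbr vV).
have nv u : u \in nbr v -> u != v.
  rewrite inE => /andP[_ d]; apply: contraTneq d => ->.
  by rewrite -setI_eq0 setIid -card_gt0; move: vV; rewrite inE => /eqP ->; apply: ltnW.
rewrite -(card_in_imset (f := fun u => [set v; u])) => [|u u' /nv nu /nv nu' e]; last first.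
  by have : u \in [set v; u'] by [rewrite -e !inE eqxx orbT]; rewrite !inE (negbTE nu) => /eqP.
apply: eq_card => e; apply/setIdP/imsetP => [[eE ve]|[u uv ->]]; last first.
  by rewrite kneser_edge_nbr // vV uv !inE eqxx.
have [a [b [ee aV ab]]] := kneser_edgeP eE; move: ve; rewrite ee !inE => /orP[/eqP va|/eqP vb].
  by exists b; rewrite va.
by exists a; rewrite vb; [rewrite nbr_sym // (nbrV ab) | rewrite setUC].
Qed.

Lemma edges_at_disjoint x v v' : 1 < k -> v \in star k x -> v' \in star k x -> v != v' ->
  [disjoint lift_edges (edges_at v) & lift_edges (edges_at v')].
Proof.
move=> k1 vS vS' ne; rewrite -setI_eq0; apply/eqP/setP => e; rewrite !inE /=.
apply/negbTE/negP => /andP[/andP[eE ve] /andP[_ ve']].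
have [a [b [ee aV ab]]] := kneser_edgeP (valP e); move: ve ve'; rewrite ee !inE.
move=> /orP[/eqP va|/eqP va] /orP[/eqP vb|/eqP vb]; rewrite va vb ?eqxx // in ne vS vS' *.
  by have := star_nbr vS ab; rewrite vS'.
by have := star_nbr vS' ab; rewrite vS.
Qed.

(** The two properties agree at every time, so both searches stop together. Up to [i0] both fail
    because of the isolated vertex; after [i0] the obstructions excluded at [i0] remain excluded. *)
Lemma tau_eq pi i0 : 4 <= k -> pi \in bijections n k ->
  (forall F, F \in bad_families k -> pi \notin late m i0 (lift_edges (internal_edges F))) ->
  (forall x p, p \in bad_pairs x -> pi \notin late m i0 (lift_edges (cross_edges x p))) ->
  (exists2 v, v \in V & pi \in late m i0 (lift_edges (edges_at v))) ->
  tau_EKR pi = tau_near pi.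
Proof.
move=> k4 pb hF hP [v vV hv]; have k1 : 1 < k by apply: leq_trans k4.
rewrite /tau_EKR /tau_near /hitting_time; apply: eq_find => i.
apply/idP/idP; first exact: EKR_no_near_star (process_sub pi i).
have [ii0|i0i] := leqP i i0.
  move=> nn; exfalso; move: nn; apply/negP; apply: (isolated_near_star k1 vV) (process_sub pi i) => e ei.
  have eE := subsetP (process_sub pi i) _ ei.
  have := late_process hv (subsetP (process_mono pi ii0) _ ei).
  by rewrite inE eE.
have sub := subsetP (process_mono pi (ltnW i0i)).
apply: no_near_star_EKR => //; first exact: process_sub.
  move=> F FB; have [e eF ei] := not_late pb (hF F FB); apply/negP => /andP[_ /forall_inP/(_ _ (sub _ ei))].
  by move: eF; rewrite inE => /andP[_ ->].
move=> x p pB; have [e /imsetP[[a b] + ee] ei] := not_late pb (hP x p pB).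
rewrite inE /= => /andP[aA /setIP[_ bS]].
by exists a, b; split=> //; apply: sub; rewrite -ee.
Qed.
End Process.

Fact mul_div_le a c d e r : a * c <= d -> a * (c * e %/ r) * r <= d * e.
Proof.
move=> h; rewrite -mulnA; apply: (@leq_trans (a * (c * e))); last by rewrite mulnA leq_mul2r h orbT.
by rewrite leq_mul2l leq_trunc_div orbT.
Qed.

Fact three_k k : 0 < k -> 2 * k + 1 <= 3 * k.
Proof. by lia. Qed.

Fact nine_eighths k : 2592 <= k -> 8 * k.+1 <= 9 * (k.+1 - 288).
Proof. by lia. Qed.

Fact half_three k : 3 * k <= 2 * (3 * k).+1./2.
Proof. by lia. Qed.

Fact half_three_le k d : 3 * k <= 2 * d -> (3 * k).+1./2 <= d.
Proof. by lia. Qed.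

Fact m_lower k : 400 <= k -> 30 * k + 50 <= 32 * k * k.+1.
Proof. by nia. Qed.

Fact m_lower_pos k : 0 < 30 * k + 50.
Proof. by lia. Qed.

Fact m_lower_succ k : k.+1 <= 30 * k + 50.
Proof. by lia. Qed.

Fact third_ge k m : 30 * k + 50 <= m -> 3 * m + 10 * k.+1 <= 10 * (m %/ 3).
Proof. by lia. Qed.

Fact late_arith L b f g p q : L * f = b * g -> 0 < f -> p * f <= q * g -> b * p <= L * q.
Proof.
move=> e f0 h; rewrite -(leq_pmul2r f0) [leqRHS]mulnAC e -!mulnA leq_mul2l [g * q]mulnC h.
exact: orbT.
Qed.

(** * Probabilities of the three bad events *)

Section UnionBound.
Variables (R : realFieldType) (k r : nat).
Notation n := (2 * k + 1).
Notation V := (ksets n k).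
Notation m := #|kneser_edges n k|.
Hypotheses (k400 : 400 <= k) (r0 : 0 < r) (rk : r * r <= k).
(** [big_r] says that [864 / r] choices among [32 * (k + 2)] cost at most a factor [9/8];
    [864 = 12 * 72] is the need of the walks and exceeds [3 * 264], that of the bad families.
    [2592 = 9 * 288] gives [(1 + 1/k)^288 <= 9/8]. *)
Hypotheses (big_r : (2 ^ 5 * (k + 2)) ^ 864 * 8 ^ r <= 9 ^ r) (big_k : 2592 <= k).
Hypothesis big_M : 32 * k <= star_size k.
Let i0 := m - m %/ 3.
Let B : R := (#|bijections n k|%:R)%R.
Let mi0 : m - i0 = m %/ 3. Proof. by rewrite /i0 subKn // leq_div. Qed.
Let i0m : i0 <= m. Proof. exact: leq_subr. Qed.
Let m3 : 3 * (m - i0) <= m. Proof. by rewrite mi0 mulnC leq_trunc_div. Qed.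
Let k1 : 1 < k. Proof. exact: leq_trans k400. Qed.
Let B0 : (0 < B)%R.
Proof. by rewrite ltr0n; apply: (card_labellings_gt0 (card_edge k)). Qed.

Let late_weight (U : {set {set {set 'I_n}}}) : U \subset kneser_edges n k ->
  (#|late m i0 (lift_edges U)|%:R <= B * (1 / 3) ^+ #|U|)%R.
Proof.
move=> UE; have := late_le (card_edge k) i0m (lift_edges U) m3.
rewrite card_lift_edges // -(ler_nat R) natrM natrX => h.
have p3 : (0 < (3 : R) ^+ #|U|)%R by rewrite exprn_gt0.
by rewrite expr_div_n expr1n mulrA mulr1 ler_pdivlMr.
Qed.

Let pow_le y a c : y * r <= c * a -> forall b, b ^ c * 8 ^ r <= 9 ^ r -> b ^ y * 8 ^ a <= 9 ^ a.
Proof.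
move=> ya b hb; have [b0|b0] := posnP b.
  rewrite b0; case: y ya => [|y] ya; last by rewrite exp0n.
  by rewrite expn0 mul1n; case: a {ya} => // a; rewrite leq_exp2r.
rewrite -(@leq_exp2r _ _ r) // expnMn -!expnM.
apply: (@leq_trans (b ^ (c * a) * 8 ^ (a * r))); first by rewrite leq_mul2r leq_pexp2l // orbT.
rewrite [a * r]mulnC !expnM -expnMn; case: a {ya} => // a.
by rewrite leq_exp2r.
Qed.

Lemma bad_families_weight :
  (\sum_(F in bad_families k) #|late m i0 (lift_edges (internal_edges F))|%:R <= B * (2 * (1 / 2) ^+ k))%R.
Proof.
apply: (@le_trans _ _ (B * \sum_(F in bad_families k) (1 / 3) ^+ #|internal_edges F|)%R).
  rewrite mulr_sumr; apply: ler_sum => F _; apply: late_weight.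
  by apply/subsetP => e; rewrite inE => /andP[].
apply: ler_wpM2l; first exact: ltW.
rewrite -[X in (_ <= X * _)%R]mulr1; apply: weighted_count => //; first by lra.
  move=> F FB; have := bad_family_edges (ltnW k1) FB; move: big_M; clear.
  by move: (star_size k) #|_| => a b; lia.
move=> e ke; set P := [set F in _ | _]; rewrite [(1 * (1 / 2) ^+ e)%R]mul1r.
have [->|P0] := eqVneq P set0; first by rewrite cards0 mul0r exprn_ge0 //; lra.
have Me : star_size k < 32 * e.
  by have [F] := set0Pn _ P0; rewrite inE => /andP[FB /eqP <-]; apply: bad_family_edges (ltnW k1) FB.
have := card_bad_families e r0 rk (ltnW k1); rewrite -/P.
set y := 264 * e %/ r => hc.
have yr : 3 * y * r <= 864 * e by exact: mul_div_le.
have hy : k ^ (3 * y) * 8 ^ e <= 9 ^ e.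
  apply: (pow_le yr); apply: leq_trans big_r; rewrite leq_mul2r leq_exp2r //; apply/orP; right.
  by rewrite -[k]mul1n; apply: leq_mul; [|rewrite mul1n leq_addr].
have N3 : 3 * #|V| <= 288 * e.
  have := bin_ksets (ltnW k1) => hN.
  have h1 : k * #|V| <= k * (3 * star_size k) by rewrite hN mulnA leq_mul2r [k * 3]mulnC three_k ?orbT ?(ltnW k1).
  by move: h1; rewrite leq_pmul2l ?(ltnW k1) //; move: Me; clear; move: (star_size k) #|_| => a b; lia.
have hk : k.+1 ^ (3 * #|V|) * 8 ^ e <= k ^ (3 * #|V|) * 9 ^ e.
  exact: succ_exp_ratio_pow (ltnW k1) (succ_exp_ratio (nine_eighths big_k)) N3.
(* One factor [(9/8)^e] pays for [k ^ (3 * y)], another for [(1 + 1/k)^(3 * #|V|)]. Multiplied by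
   [3^-e] this leaves [(27/64)^e], below [(1/2)^e]. *)
have hP : #|P| * 64 ^ e <= 81 ^ e.
  have pk : 0 < (k ^ #|V|) ^ 3 by rewrite !expn_gt0 (ltnW k1).
  rewrite -(leq_pmul2r pk).
  apply: (@leq_trans ((k ^ y * k.+1 ^ #|V|) ^ 3 * 64 ^ e)).
    by rewrite mulnAC leq_mul2r hc orbT.
  have -> : 64 ^ e = 8 ^ e * 8 ^ e by rewrite -expnMn.
  have -> : 81 ^ e = 9 ^ e * 9 ^ e by rewrite -expnMn.
  rewrite expnMn -!expnM [y * 3]mulnC [#|V| * 3]mulnC.
  by rewrite mulnACA -[leqRHS]mulnA [9 ^ e * k ^ _]mulnC; apply: leq_mul.
have p64 : (0 < (64 : R) ^+ e)%R by rewrite exprn_gt0.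
have hPR : (#|P|%:R <= (81 / 64) ^+ e :> R)%R.
  by rewrite expr_div_n ler_pdivlMr // -!natrX -natrM ler_nat.
apply: (@le_trans _ _ ((81 / 64) ^+ e * (1 / 3) ^+ e)%R).
  by apply: ler_wpM2r hPR; apply: exprn_ge0; lra.
rewrite -exprMn; apply: lerXn2r; rewrite ?nnegrE; lra.
Qed.

Lemma bad_pairs_weight (x : 'I_n) :
  (\sum_(p in bad_pairs x) #|late m i0 (lift_edges (cross_edges x p))|%:R <= B * (4 * (125 / 128) ^+ k))%R.
Proof.
have WV (p : {set {set 'I_n}} * {set {set 'I_n}}) : p \in bad_pairs x -> p.1 \subset V :\: star k x.
  by rewrite inE => /andP[].
apply: (@le_trans _ _ (B * \sum_(p in bad_pairs x) (1 / 3) ^+ pair_defect x p)%R).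
  rewrite mulr_sumr; apply: ler_sum => p /WV pW; rewrite -card_cross_edges //; apply: late_weight.
  by apply: cross_edges_sub => //; apply: subset_trans pW (subsetDl _ _).
apply: ler_wpM2l; first exact: ltW.
pose e0 := (3 * k).+1./2.
have he0 : 3 * k <= 2 * e0 by exact: half_three.
have c2 : (0 <= (2 ^ (2 * k + 1))%N%:R :> R)%R by apply: ler0n.
apply: (le_trans (weighted_count (D := pair_defect x) (e0 := e0) (c := (2 ^ (2 * k + 1))%N%:R) (q := 3 / 8) c2 _ _ _)).
- by lra.
- by move=> p /(pair_defect_ge k400); apply: half_three_le.
- move=> e _; set P := [set p in _ | _].
  have := card_bad_pairs x e k400 r0 rk; rewrite -/P; set y := 72 * e %/ r => hc.
  have yr : (2 * 6 * y) * r <= 864 * e by exact: mul_div_le.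
  have hy : ((k + 2) * 2 ^ 5) ^ (2 * 6 * y) * 8 ^ e <= 9 ^ e.
    by apply: (pow_le yr); rewrite [(k + 2) * _]mulnC.
  have hP : #|P| * 8 ^ e <= 2 ^ (2 * k + 1) * 9 ^ e.
    apply: (@leq_trans (2 ^ (2 * k + 1) * ((k + 2) * 2 ^ 5) ^ (2 * 6 * y) * 8 ^ e)).
      by rewrite leq_mul2r hc orbT.
    by rewrite -mulnA leq_mul2l hy orbT.
  have p8 : (0 < (8 : R) ^+ e)%R by rewrite exprn_gt0.
  have hPR : (#|P|%:R <= (2 ^ (2 * k + 1))%N%:R * (9 / 8) ^+ e :> R)%R.
    by rewrite expr_div_n mulrA ler_pdivlMr // -!natrX -!natrM ler_nat.
  apply: (@le_trans _ _ ((2 ^ (2 * k + 1))%N%:R * (9 / 8) ^+ e * (1 / 3) ^+ e)%R).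
    by apply: ler_wpM2r hPR; apply: exprn_ge0; lra.
  rewrite -mulrA -exprMn; apply: ler_wpM2l => //; apply: lerXn2r; rewrite ?nnegrE; lra.
(* [3/8 <= (5/8)^2] turns the exponent [3k/2] into [3k], and [4 * (5/8)^3 = 125/128] shows that the
   [4^k] starting points are outweighed. *)
have h1 : ((3 / 8 : R) ^+ e0 <= (5 / 8) ^+ (2 * e0))%R.
  by rewrite exprM; apply: lerXn2r; rewrite ?nnegrE; lra.
have h2 : ((5 / 8 : R) ^+ (2 * e0) <= (5 / 8) ^+ (3 * k))%R.
  by apply: ler_wiXn2l => //; lra.
have h3 : ((2 ^ (2 * k + 1))%N%:R * (5 / 8) ^+ (3 * k) = 2 * (125 / 128) ^+ k :> R)%R.
  rewrite natrX exprD expr1 !exprM [(_ * 2)%R]mulrC -mulrA -exprMn; congr (_ * _ ^+ _)%R.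
  by field.
have h4 : ((2 ^ (2 * k + 1))%N%:R * (3 / 8) ^+ e0 <= (2 ^ (2 * k + 1))%N%:R * (5 / 8) ^+ (3 * k) :> R)%R.
  by apply: ler_wpM2l => //; apply: le_trans h1 h2.
rewrite h3 in h4; rewrite -mulrA.
apply: le_trans (ler_wpM2l _ h4) _ => //.
by rewrite mulrA; apply: ler_wpM2r; [apply: exprn_ge0; lra | lra].
Qed.

(** Vertices of one star share no edge, so the second moment method applies to their edge sets. Each
    vertex is isolated with probability at least [(3/10)^(k+1)]; taking [3/10] in place of [1/3]
    absorbs the rounding in [i0] and the falling factorials. *)
Lemma no_isolated_weight (x : 'I_n) :
  (#|[set pi in bijections n k | [forall v in star k x, pi \notin late m i0 (lift_edges (edges_at v))]]|%:R *
     (star_size k)%:R <= B * (10 / 3) ^+ k.+1)%R.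
Proof.
pose S (v : {set 'I_n}) := lift_edges (edges_at v).
have sub (v : {set 'I_n}) : edges_at v \subset kneser_edges n k by apply/subsetP => e; rewrite inE => /andP[].
have cS v : v \in star k x -> #|S v| = k.+1.
  by move=> vS; rewrite card_lift_edges // card_edges_at // (subsetP (star_subV x)).
have [v0 v0S] : exists v : {set 'I_n}, v \in star k x.
  by apply/card_gt0P; rewrite card_star ?star_size_gt0 // ltnW.
have mk : star_size k * k.+1 <= m.
  have -> : star_size k * k.+1 = \sum_(v in star k x) #|S v|.
    by rewrite -(card_star x) ?(ltnW k1) // -sum_nat_const; apply: eq_bigr => v vS; rewrite cS.
  rewrite -card_edge -cardsT.
  have tr : trivIset [set S v | v in star k x].
    apply/trivIsetP => X Y /imsetP[v vS ->] /imsetP[v' vS' ->] ne.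
    by apply: (edges_at_disjoint k1 vS vS'); apply: contraNneq ne => ->.
  have inj : {in star k x &, injective S}.
    move=> v v' vS vS' e; apply/eqP; apply: contraT => ne.
    have := edges_at_disjoint k1 vS vS' ne; rewrite -/(S v) -/(S v') -e -setI_eq0 setIid -cards_eq0.
    by rewrite cS.
  rewrite -(big_imset (fun X : {set edge n k} => #|X|) inj) /= (eqP tr).
  by rewrite subset_leq_card // subsetT.
have m50 : 30 * k + 50 <= m.
  apply: leq_trans mk; apply: (@leq_trans (32 * k * k.+1)); last by rewrite leq_mul2r big_M orbT.
  exact: m_lower.
have m0 : 0 < m by apply: leq_trans m50; apply: m_lower_pos.
pose L := #|late m i0 (S v0)|.
have cL v : v \in star k x -> #|late m i0 (S v)| = L.
  move=> vS; have h1 := card_late (card_edge k) i0m (S v); have h2 := card_late (card_edge k) i0m (S v0).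
  rewrite !cS // in h1 h2.
  have p0 : 0 < m ^_ k.+1 by rewrite ffact_gt0; apply: leq_trans m50; apply: m_lower_succ.
  by apply/eqP; rewrite -(eqn_pmul2r p0) h1 -h2.
have := second_moment (P := star k x) (S := S) (card_edge k) i0m m0 cS (fun v v' vS vS' => edges_at_disjoint k1 vS vS') cL.
rewrite card_star ?(ltnW k1) //; set bad := [set pi in _ | _] => hb.
have Lge : #|bijections n k| * 3 ^ k.+1 <= L * 10 ^ k.+1.
  have h2 := card_late (card_edge k) i0m (S v0); rewrite cS // in h2.
  have p0 : 0 < m ^_ k.+1 by rewrite ffact_gt0; apply: leq_trans m50; apply: m_lower_succ.
  have hm : 3 * m + 10 * k.+1 <= 10 * (m - i0) by rewrite mi0; exact: third_ge m50.
  exact: late_arith h2 p0 (ffact_ratio_ge hm).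
have LgeR : (B * 3 ^+ k.+1 <= L%:R * 10 ^+ k.+1)%R by rewrite -!natrX -!natrM ler_nat.
have hbR : (#|bad|%:R * ((star_size k)%:R * L%:R) <= B ^+ 2 :> R)%R by rewrite -!natrM -natrX ler_nat.
have p10 : (0 < (10 : R) ^+ k.+1)%R by rewrite exprn_gt0.
have p3 : (0 < (3 : R) ^+ k.+1)%R by rewrite exprn_gt0.
rewrite expr_div_n mulrA ler_pdivlMr //.
rewrite -(ler_pM2l B0).
apply: (@le_trans _ _ (#|bad|%:R * (star_size k)%:R * (L%:R * 10 ^+ k.+1))%R).
  rewrite mulrCA; apply: ler_wpM2l => //.
  by rewrite mulr_ge0 ?ler0n.
have -> : (#|bad|%:R * (star_size k)%:R * (L%:R * 10 ^+ k.+1) = #|bad|%:R * ((star_size k)%:R * L%:R) * 10 ^+ k.+1 :> R)%R by ring.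
by apply: le_trans (ler_wpM2r (ltW p10) hbR) _; rewrite expr2 mulrA.
Qed.

Lemma bad_event_bound : 
  (#|[set pi in bijections n k | tau_EKR pi != tau_near pi]|%:R <=
   B * ((10 / 3) ^+ k.+1 / (star_size k)%:R + 2 * (1 / 2) ^+ k + (2 * k + 1)%N%:R * (4 * (125 / 128) ^+ k)))%R.
Proof.
pose x0 : 'I_n := Ordinal (ltn_addl (2 * k) (ltnSn 0)).
have h1 := no_isolated_weight x0.
have M0 : (0 < (star_size k)%:R :> R)%R by rewrite ltr0n star_size_gt0 // ltnW.
rewrite -ler_pdivlMr // in h1.
set X1 := [set pi in _ | _] in h1.
pose X2 := \bigcup_(F in bad_families k) late m i0 (lift_edges (internal_edges F)).
pose X3 := \bigcup_(x : 'I_n) \bigcup_(p in bad_pairs x) late m i0 (lift_edges (cross_edges x p)).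
have card_bigcup (I T : finType) (P : pred I) (Y : I -> {set T}) :
    #|\bigcup_(i | P i) Y i| <= \sum_(i | P i) #|Y i|.
  elim/big_rec2: _ => [|i y X _ hX]; first by rewrite cards0.
  by apply: leq_trans (leq_of_leqif (leq_card_setU _ _)) _; rewrite leq_add2l.
have h2 : (#|X2|%:R <= B * (2 * (1 / 2) ^+ k))%R.
  by apply: le_trans bad_families_weight; rewrite -natr_sum ler_nat; apply: card_bigcup.
have h3 : (#|X3|%:R <= B * ((2 * k + 1)%N%:R * (4 * (125 / 128) ^+ k)))%R.
  apply: (@le_trans _ _ (\sum_(x : 'I_n) B * (4 * (125 / 128) ^+ k))%R).
    apply: (@le_trans _ _ (\sum_(x : 'I_n) (\sum_(p in bad_pairs x) #|late m i0 (lift_edges (cross_edges x p))|%:R))%R).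
      under eq_bigr do rewrite -natr_sum.
      rewrite -natr_sum ler_nat; apply: leq_trans (card_bigcup _ _ _ _) _.
      by apply: leq_sum => x _; apply: card_bigcup.
    by apply: ler_sum => x _; apply: bad_pairs_weight.
  by rewrite sumr_const card_ord -[leLHS]mulr_natl mulrCA.
have sub : [set pi in bijections n k | tau_EKR pi != tau_near pi] \subset X1 :|: X2 :|: X3.
  apply/subsetP => pi /setIdP[pb ne]; apply: contraR ne; rewrite !in_setU !negb_or => /andP[/andP[n1 n2] n3].
  apply/eqP; apply: (@tau_eq k pi i0) => //.
  - exact: leq_trans k400.
  - by move=> F FB; apply: contra n2 => h; apply/bigcupP; exists F.
  - move=> x p pB; apply: contra n3 => h; apply/bigcupP; exists x => //.
    by apply/bigcupP; exists p.
  - move: n1; rewrite inE pb /= negb_forall => /existsP[v]; rewrite negb_imply negbK => /andP[vS hv].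
    by exists v => //; apply: (subsetP (star_subV x0)).
have cU (T : finType) (Y Z : {set T}) : #|Y :|: Z| <= #|Y| + #|Z| by apply: leq_of_leqif (leq_card_setU _ _).
have h : #|[set pi in bijections n k | tau_EKR pi != tau_near pi]| <= #|X1| + #|X2| + #|X3|.
  apply: leq_trans (subset_leq_card sub) _; apply: leq_trans (cU _ _ _) _.
  by rewrite leq_add2r.
apply: (@le_trans _ _ ((#|X1| + #|X2| + #|X3|)%N%:R)%R); first by rewrite ler_nat.
have -> : ((#|X1| + #|X2| + #|X3|)%N%:R = #|X1|%:R + #|X2|%:R + #|X3|%:R :> R)%R by rewrite !natrD.
rewrite !mulrDr; apply: lerD => //; apply: lerD => //; by rewrite mulrA.
Qed.
End UnionBound.

(** * The limit *)

Lemma eventually_sqrt_dominates D : exists K, forall k r, K <= k -> r * r <= k -> k < r.+1 * r.+1 ->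
  (2 ^ 5 * (k + 2)) ^ D * 8 ^ r <= 9 ^ r.
Proof.
have [K hK] := @exp_dominates_poly (160 ^ D) (2 * D) 9 8 isT isT.
exists (K.+1 * K.+1) => k r kK rk kr.
have Kr : K < r by rewrite -ltnS; have := leq_ltn_trans kK kr; nia.
apply: leq_trans (hK r (ltnW Kr)); rewrite leq_mul2r; apply/orP; right.
have r0 : 0 < r by apply: leq_trans Kr.
case: D {hK} => [|D]; first by rewrite muln0 !expn0.
rewrite expnM -expnMn leq_exp2r // -mulnn.
(* From [k < (r + 1)^2] and [r >= 1]; it is tight at [k = 3], [r = 1]. *)
have h : k + 2 <= 5 * (r * r) by nia.
by rewrite (_ : 160 = 2 ^ 5 * 5) // -mulnA leq_mul2l h orbT.
Qed.

Lemma eventually_star_size C : exists K, forall k, K <= k -> C * k <= star_size k.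
Proof.
have [K hK] := @exp_dominates_poly (7 * C) 1 7 2 isT isT.
exists K.+1 => [[//|k]] Kk; have := hK k.+1 (ltnW Kk); rewrite expn1 !expnS.
have p2 : 0 < 2 ^ k by rewrite expn_gt0.
have h2 := star_size_ge k => h; rewrite -(leq_pmul2r p2); apply: leq_trans h2.
rewrite -(@leq_pmul2l 7) //; apply: leq_trans h.
have -> : 7 * C * k.+1 * (2 * 2 ^ k) = 7 * (C * k.+1 * 2 ^ k) * 2 by ring.
exact: leq_pmulr.
Qed.

Section Limit.
Variable R : realFieldType.
Local Open Scope ring_scope.

Lemma eventually_geometric c d p q : (0 < q)%N -> (q < p)%N ->
  exists K : nat, forall k, (K <= k)%N -> c%:R * k%:R ^+ d * (q%:R / p%:R) ^+ k <= 1 :> R.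
Proof.
move=> q0 qp; have [K hK] := @exp_dominates_poly c d p q q0 qp; exists K => k /hK h.
have p0 : 0 < p%:R ^+ k :> R by rewrite exprn_gt0 // ltr0n (leq_trans _ qp).
by rewrite expr_div_n mulrA ler_pdivrMr // mul1r -!natrX -!natrM ler_nat.
Qed.

Lemma error_terms k : (0 < k)%N -> 12 * k%:R ^+ 1 * (20 / 21) ^+ k <= 1 :> R ->
  2 * k%:R ^+ 1 * (1 / 2) ^+ k <= 1 :> R -> 12 * k%:R ^+ 2 * (125 / 128) ^+ k <= 1 :> R ->
  (10 / 3) ^+ k.+1 / (star_size k)%:R + 2 * (1 / 2) ^+ k + (2 * k + 1)%N%:R * (4 * (125 / 128) ^+ k) <= 3 / k%:R :> R.
Proof.
move=> k0 hk3 hk4 hk5.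
have kR : 0 < k%:R :> R by rewrite ltr0n.
have M0 : 0 < (star_size k)%:R :> R by rewrite ltr0n star_size_gt0.
rewrite ler_pdivlMr //.
have t0 : (10 / 3) ^+ k.+1 / (star_size k)%:R * k%:R <= 1 :> R.
  apply: le_trans hk3; rewrite expr1.
  have : (7 / 2) ^+ k <= 7 / 2 * (star_size k)%:R :> R.
    case: (k) k0 => // j _; rewrite exprS; apply: ler_wpM2l; first lra.
    by rewrite expr_div_n ler_pdivrMr ?exprn_gt0 // -!natrX -natrM ler_nat star_size_ge.
  move=> h6.
  have p7 : 0 < (7 / 2) ^+ k :> R by apply: exprn_gt0; lra.
  rewrite mulrAC ler_pdivrMr // [leLHS]mulrC.
  have -> : 12 * k%:R * (20 / 21) ^+ k * (star_size k)%:R = k%:R * (12 * (20 / 21) ^+ k * (star_size k)%:R) :> R by ring.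
  apply: ler_wpM2l; first exact: ltW.
  (* The base [10/3] is below the growth rate [7/2] of the star size by the factor [20/21]; the
     constant 12 majorizes [10/3 * 7/2]. *)
  have e1 : (10 / 3) ^+ k = (20 / 21) ^+ k * (7 / 2) ^+ k :> R by rewrite -exprMn; congr (_ ^+ _); field.
  have h7 : (20 / 21) ^+ k * (7 / 2) ^+ k <= (20 / 21) ^+ k * (7 / 2 * (star_size k)%:R) :> R.
    by apply: ler_wpM2l => //; apply: exprn_ge0; lra.
  have h8 : 0 <= (20 / 21) ^+ k * (star_size k)%:R :> R by apply: mulr_ge0; [apply: exprn_ge0; lra|exact: ltW].
  rewrite exprS e1; lra.
have t1 : 2 * (1 / 2) ^+ k * k%:R <= 1 :> R.
  by apply: le_trans hk4; rewrite expr1 mulrAC.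
have t2 : (2 * k + 1)%N%:R * (4 * (125 / 128) ^+ k) * k%:R <= 1 :> R.
  apply: le_trans hk5; have -> : (2 * k + 1)%N%:R * (4 * (125 / 128) ^+ k) * k%:R = 4 * (2 * k + 1)%N%:R * k%:R * (125 / 128) ^+ k :> R by ring.
  apply: ler_wpM2r; first by apply: exprn_ge0; lra.
  rewrite expr2 mulrA; apply: ler_wpM2r; first exact: ltW.
  by rewrite -!natrM ler_nat; lia.
by rewrite 2!mulrDl; apply: le_trans (lerD (lerD t0 t1) t2) _; lra.
Qed.

(** The error bounds are exponentially small; the cruder rate [3 / k], one [1 / k] for each bad
    event, suffices for the limit and keeps it elementary. *)
Lemma Pr_hitting_times_agree : exists K : nat, forall k, (K <= k)%N ->
  `|1 - Pr_bij R (fun pi : labelling (2 * k + 1)%N k => tau_EKR pi == tau_near pi)| <= 3 / k%:R.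
Proof.
have [K1 h1] := eventually_sqrt_dominates 864.
have [K2 h2] := eventually_star_size 32.
have [K3 h3] := @eventually_geometric 12 1 21 20 isT isT.
have [K4 h4] := @eventually_geometric 2 1 2 1 isT isT.
have [K5 h5] := @eventually_geometric 12 2 128 125 isT isT.
exists (maxn K1 (maxn K2 (maxn K3 (maxn K4 (maxn K5 2592))))) => k.
rewrite !geq_max => /and5P[/h1 hk1 /h2 hk2 /h3 hk3 /h4 hk4 /andP[/h5 hk5 big_k]].
have [r /andP[rk kr]] := exists_sqrt k.
have k400 : (400 <= k)%N by apply: leq_trans big_k.
have k0 : (0 < k)%N by apply: leq_trans k400.
have r0 : (0 < r)%N by case: r rk kr => // _; rewrite ltnNge k0.
have hb := bad_event_bound R k400 r0 rk (hk1 r rk kr) big_k hk2.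
set bad := [set pi in _ | _] in hb.
pose good := [set pi in bijections (2 * k + 1) k | tau_EKR pi == tau_near pi].
have B0 : 0 < #|bijections (2 * k + 1) k|%:R :> R.
  by rewrite ltr0n; apply: (card_labellings_gt0 (card_edge k)).
have cgb : #|bijections (2 * k + 1) k|%:R = #|good|%:R + #|bad|%:R :> R.
  rewrite -natrD -(cardsID [set pi | tau_EKR pi == tau_near pi]); congr (_ + _)%N%:R; apply: eq_card => pi;
    by rewrite !inE // andbC.
rewrite /Pr_bij -/good.
have -> : 1 - #|good|%:R / #|bijections (2 * k + 1) k|%:R = #|bad|%:R / #|bijections (2 * k + 1) k|%:R :> R.
  have -> : #|good|%:R = #|bijections (2 * k + 1) k|%:R - #|bad|%:R :> R by rewrite cgb addrK.
  by field; rewrite gt_eqF.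
rewrite ger0_norm ?divr_ge0 // ler_pdivrMr // mulrC.
apply: le_trans hb _; apply: ler_wpM2l => //.
exact: error_terms.
Qed.
End Limit.

From mathcomp Require Import all_classical all_reals all_analysis.
Import numFieldNormedType.Exports.
Local Open Scope classical_set_scope.
Local Open Scope ring_scope.

Theorem theorem1p4 (R : realType) :
  Pr_bij R (fun pi : labelling (2 * k + 1)%N k => tau_EKR pi == tau_near pi)
    @[k --> \oo] --> (1 : R).
Proof.
have [K hK] := Pr_hitting_times_agree R.
apply/cvgrPdist_le => e e0; exists (maxn K (Num.truncn (3 / e)).+1) => // k /=.
rewrite geq_max => /andP[/hK h /= hk].
have k0 : (0 : R) < k%:R by rewrite ltr0n; apply: leq_trans hk.
apply: le_trans h _; rewrite ler_pdivrMr // mulrC -ler_pdivrMr //.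
apply: ltW; apply: lt_le_trans (truncnS_gt _) _; by rewrite ler_nat.
Qed.
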